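(* Let $X$ be a connected finite complex, $Y$ a compact nilmanifold, and $f,g:X\to Y$ (continuous) maps. If $R(f,g)=\infty$, then there is a map $f':X\to Y$ homotopic to $f$ such that $C(f',g)=\{x\in X\mid f'(x)=g(x)\}$ is empty.
   Context: Maps are continuous. Coincidence Reidemeister number: let $f_\sharp,g_\sharp:\pi_1(X)\to\pi_1(Y)$ be the homomorphisms induced by $f,g$ (with base point $x_0\in X$, and with $\pi_1(Y,f(x_0))$ and $\pi_1(Y,g(x_0))$ identified along a chosen path if $f(x_0)\neq g(x_0)$). $R(f,g)$ is the number (possibly $\infty$) of equivalence classes of $\pi_1(Y)$ under the relation $u\sim g_\sharp(x)\,u\,f_\sharp(x)^{-1}$, $x\in\pi_1(X)$; it does not depend on the choices. *)

(* Defs.v *)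
From HB Require Import structures.
From mathcomp Require Import all_boot all_order all_algebra generic_quotient.
From mathcomp Require Import all_classical all_reals all_analysis.
From mathcomp Require Import homotopy.
From mathcomp Require Import lra.

Set Implicit Arguments.
Unset Strict Implicit.
Unset Printing Implicit Defensive.

Import Order.TTheory GRing.Theory Num.Theory.
Import numFieldNormedType.Exports.

Local Open Scope classical_set_scope.
Local Open Scope ring_scope.

Section UnitInterval.
Variable R : realType.

Definition unit_interval : Type := set_type `[(0 : R), 1]%classic.

HB.instance Definition _ := Topological.on unit_interval.

Definition I_val (t : unit_interval) : R := set_val t.

Lemma clampI_subproof (r : R) :
  Order.max 0 (Order.min 1 r) \in `[(0 : R), 1]%classic.
Proof.
apply/mem_set; rewrite /= in_itv /= le_max lexx /= ge_max ler01 /=.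
by rewrite ge_min lexx.
Qed.

Definition clampI (r : R) : unit_interval :=
  exist (fun x => x \in `[(0 : R), 1]%classic) _ (clampI_subproof r).

Lemma I_val_clamp r : I_val (clampI r) = Order.max 0 (Order.min 1 r).
Proof. by []. Qed.

Lemma I_val_inj : injective I_val.
Proof. exact: val_inj. Qed.

Lemma I_val_itv t : 0 <= I_val t <= 1.
Proof. by have := set_valP t; rewrite /= in_itv. Qed.

Lemma I_valK : cancel I_val clampI.
Proof.
move=> t; apply: I_val_inj; rewrite I_val_clamp.
by have /andP[t0 t1] := I_val_itv t; rewrite min_r// max_r.
Qed.

Lemma zero_one_unit_interval : clampI 0 != clampI 1.
Proof.
apply/eqP => /(congr1 I_val); rewrite !I_val_clamp minxx.
by rewrite min_r ?ler01// maxxx max_r ?ler01// => /esym/eqP; rewrite oner_eq0.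
Qed.

HB.instance Definition _ :=
  isBiPointed.Build unit_interval zero_one_unit_interval.

Lemma I_val0 : I_val zero = 0.
Proof. by rewrite I_val_clamp min_r ?ler01// maxxx. Qed.

Lemma I_val1 : I_val one = 1.
Proof. by rewrite I_val_clamp minxx max_r ?ler01. Qed.

Lemma continuous_I_val : continuous I_val.
Proof. exact: initial_continuous. Qed.

Lemma continuous_clampI : continuous clampI.
Proof.
apply: continuous_comp_initial => r.
by apply: continuous_max; [exact: cst_continuous|];
  apply: continuous_min; [exact: cst_continuous|exact: cvg_id].
Qed.

End UnitInterval.
Arguments I_val {R}.
Arguments clampI {R}.

Notation path_in R x y := {path (unit_interval R) from x to y}.

Lemma continuous_fcomp {Z T U : topologicalType} (a : Z -> T) (b : T -> U) :
  continuous a -> continuous b -> continuous (fun z => b (a z)).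
Proof. by move=> ca cb z; apply: continuous_comp; [exact: ca|exact: cb]. Qed.

Lemma continuous_fpair {Z T U : topologicalType} (a : Z -> T) (b : Z -> U) :
  continuous a -> continuous b -> continuous (fun z => (a z, b z)).
Proof. by move=> ca cb z; apply: cvg_pair; [exact: ca|exact: cb]. Qed.

Lemma continuous_affine {R : realType} {Z : topologicalType} (a : Z -> R)
    (k l : R) :
  continuous a -> continuous (fun z => k * a z + l).
Proof.
move=> ca z; apply: cvgD; last exact: cvg_cst.
by apply: cvgM; [exact: cvg_cst|exact: ca].
Qed.

Lemma continuous_fmax {R : realType} {Z : topologicalType} (a b : Z -> R) :
  continuous a -> continuous b -> continuous (fun z => Order.max (a z) (b z)).
Proof. by move=> ca cb z; apply: continuous_max; [exact: ca|exact: cb]. Qed.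

Lemma continuous_fmin {R : realType} {Z : topologicalType} (a b : Z -> R) :
  continuous a -> continuous b -> continuous (fun z => Order.min (a z) (b z)).
Proof. by move=> ca cb z; apply: continuous_min; [exact: ca|exact: cb]. Qed.

Lemma continuous_fclamp {R : realType} {Z : topologicalType} (a : Z -> R) :
  continuous a -> continuous (fun z => clampI (a z)).
Proof. by move=> ca; apply: continuous_fcomp ca _; exact: continuous_clampI. Qed.

Lemma continuous_if {Z T : topologicalType} {R : realType} (c : Z -> R) (a : R)
    (A B : Z -> T) :
  continuous c -> continuous A -> continuous B ->
  (forall z, c z = a -> A z = B z) ->
  continuous (fun z => if c z <= a then A z else B z).
Proof.
move=> cc cA cB AB; apply/continuous_subspace_setT.
have -> : [set: Z] = [set z | c z <= a] `|` [set z | a <= c z].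
  rewrite eqEsubset; split=> z //= _.
  by have [|/ltW] := leP (c z) a; [left|right].
apply: withinU_continuous.
- apply: (@preimage_closed _ _ c [set r | r <= a]); last exact: closed_le.
  by move=> z _; exact: cc.
- apply: (@preimage_closed _ _ c [set r | a <= r]); last exact: closed_ge.
  by move=> z _; exact: cc.
- apply: (@subspace_eq_continuous _ _ _ A).
    by rewrite /from_subspace => z /set_mem /= ->.
  exact: (@continuous_subspaceT _ _ [set z | c z <= a] A).
- apply: (@subspace_eq_continuous _ _ _ B).
    rewrite /from_subspace => z /set_mem /=; case: ifPn => // ca ac.
    by rewrite AB//; apply/eqP; rewrite eq_le ca ac.
  exact: (@continuous_subspaceT _ _ [set z | a <= c z] B).
Qed.

Section Paths.
Variables (R : realType) (T : topologicalType).
Implicit Types x y z w : T.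
Local Notation I := (unit_interval R).

(* The extension of a path to the whole line, constant outside [0, 1]. *)
Definition path_ext x y (p : path_in R x y) (r : R) : T := p (clampI r).

Lemma continuous_path_ext x y (p : path_in R x y) : continuous (path_ext p).
Proof.
move=> r; apply: continuous_comp; first exact: continuous_clampI.
exact: cts_fun.
Qed.

Lemma path_extE x y (p : path_in R x y) t : path_ext p (I_val t) = p t.
Proof. by rewrite /path_ext I_valK. Qed.

Lemma path_ext_le0 x y (p : path_in R x y) r : r <= 0 -> path_ext p r = x.
Proof.
move=> r0; rewrite /path_ext -[RHS](@path_zero _ _ _ _ p); congr (p _).
apply: I_val_inj; rewrite I_val0 I_val_clamp min_r ?(le_trans r0)//.
by rewrite max_l.
Qed.

Lemma path_ext_ge1 x y (p : path_in R x y) r : 1 <= r -> path_ext p r = y.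
Proof.
move=> r1; rewrite /path_ext -[RHS](@path_one _ _ _ _ p); congr (p _).
by apply: I_val_inj; rewrite I_val1 I_val_clamp min_l// max_r.
Qed.

Section Concat.
Variables (x y z : T) (p : path_in R x y) (q : path_in R y z).

Definition path_cat_fun (r : R) : T :=
  if r <= 2^-1 then path_ext p (2 * r + 0) else path_ext q (2 * r + - 1).

Lemma continuous_path_cat_fun : continuous path_cat_fun.
Proof.
apply: continuous_if => [r|||r ->]; first exact: cvg_id.
- apply: (continuous_fcomp (b := path_ext p)); last exact: continuous_path_ext.
  by apply: continuous_affine => ?; exact: cvg_id.
- apply: (continuous_fcomp (b := path_ext q)); last exact: continuous_path_ext.
  by apply: continuous_affine => ?; exact: cvg_id.
- by rewrite addr0 divff// subrr path_ext_ge1// path_ext_le0.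
Qed.

Definition path_cat_I (t : I) : T := path_cat_fun (I_val t).

Lemma continuous_path_cat_I : continuous path_cat_I.
Proof.
move=> t; apply: continuous_comp; first exact: continuous_I_val.
exact: continuous_path_cat_fun.
Qed.

Lemma path_cat0 : path_cat_I zero = x.
Proof.
by rewrite /path_cat_I /path_cat_fun I_val0 invr_ge0 ler0n path_ext_le0// mulr0 addr0.
Qed.

Lemma path_cat1 : path_cat_I one = z.
Proof.
rewrite /path_cat_I /path_cat_fun I_val1 ifF; last by lra.
by rewrite path_ext_ge1//; lra.
Qed.

Definition path_cat : path_in R x z :=
  mk_path continuous_path_cat_I path_cat0 path_cat1.

Lemma path_ext_cat r : path_ext path_cat r =
  if r <= 2^-1 then path_ext p (2 * r) else path_ext q (2 * r - 1).
Proof.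
have [r0|r0] := leP r 0.
  rewrite path_ext_le0// ifT; last by lra.
  by rewrite path_ext_le0//; lra.
have [r1|r1] := leP 1 r.
  rewrite path_ext_ge1// ifF; last by lra.
  by rewrite path_ext_ge1//; lra.
rewrite -[r in LHS](_ : I_val (clampI r) = r) ?path_extE; last first.
  by rewrite I_val_clamp min_r ?max_r// ltW.
rewrite -[LHS]/(path_cat_fun (I_val (clampI r))) /path_cat_fun I_val_clamp.
by rewrite min_r ?max_r ?addr0// ltW.
Qed.

End Concat.

Section Reverse.
Variables (x y : T) (p : path_in R x y).

Definition path_rev_I (t : I) : T := path_ext p (- 1 * I_val t + 1).

Lemma continuous_path_rev_I : continuous path_rev_I.
Proof.
apply: (continuous_fcomp (b := path_ext p)); last exact: continuous_path_ext.
by apply: continuous_affine; exact: continuous_I_val.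
Qed.

Lemma path_rev0 : path_rev_I zero = y.
Proof. by rewrite /path_rev_I I_val0 mulr0 add0r path_ext_ge1. Qed.

Lemma path_rev1 : path_rev_I one = x.
Proof. by rewrite /path_rev_I I_val1 mulr1 addNr path_ext_le0. Qed.

Definition path_rev : path_in R y x :=
  mk_path continuous_path_rev_I path_rev0 path_rev1.

Lemma path_ext_rev r : path_ext path_rev r = path_ext p (1 - r).
Proof.
have [r0|r0] := leP r 0.
  by rewrite path_ext_le0// path_ext_ge1//; lra.
have [r1|r1] := leP 1 r.
  by rewrite path_ext_ge1// path_ext_le0//; lra.
rewrite -[r in LHS](_ : I_val (clampI r) = r) ?path_extE; last first.
  by rewrite I_val_clamp min_r ?max_r// ltW.
rewrite -[LHS]/(path_ext p (- 1 * I_val (clampI r) + 1)) I_val_clamp.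
by rewrite min_r ?max_r ?mulN1r 1?addrC// ltW.
Qed.

End Reverse.

Definition path_cst x : path_in R x x := [the path_in R x x of cst x].

Definition path_homotopic x y (p q : path_in R x y) : Prop :=
  exists H : I * I -> T, [/\ continuous H,
    forall t, H (t, zero) = p t, forall t, H (t, one) = q t,
    forall s, H (zero, s) = x & forall s, H (one, s) = y].

(* Two reparametrizations of the same curve [P], with the same endpoints, are
   homotopic relative to the endpoints. *)
Lemma path_homotopic_reparam x y (p q : path_in R x y) (P : R -> T)
    (u v : I -> R) :
  continuous P -> continuous u -> continuous v ->
  u zero = v zero -> u one = v one ->
  (forall t, p t = P (u t)) -> (forall t, q t = P (v t)) ->
  path_homotopic p q.
Proof.
move=> cP cu cv uv0 uv1 pE qE.
exists (fun ts => P (u ts.1 + I_val ts.2 * (v ts.1 - u ts.1))); split.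
- have c1 (w : I -> R) : continuous w ->
      continuous (fun ts : I * I => w ts.1).
    by move=> cw z; apply: continuous_comp; [exact: cvg_fst|exact: cw].
  have c2 : continuous (fun ts : I * I => I_val ts.2).
    move=> z; apply: continuous_comp; first exact: cvg_snd.
    exact: continuous_I_val.
  move=> z; apply: (@continuous_comp _ _ _
    (fun ts : I * I => u ts.1 + I_val ts.2 * (v ts.1 - u ts.1)) P).
    apply: cvgD; first exact: c1.
    apply: cvgM; first exact: c2.
    by apply: cvgB; exact: c1.
  exact: cP.
- by move=> t /=; rewrite I_val0 mul0r addr0 pE.
- by move=> t /=; rewrite I_val1 mul1r addrC subrK qE.
- by move=> s /=; rewrite uv0 subrr mulr0 addr0 -qE path_zero.
- by move=> s /=; rewrite uv1 subrr mulr0 addr0 -qE path_one.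
Qed.

Lemma path_homotopic_refl x y (p : path_in R x y) : path_homotopic p p.
Proof.
by apply: (@path_homotopic_reparam _ _ _ _ (path_ext p) I_val I_val) => //;
  [exact: continuous_path_ext|exact: continuous_I_val|exact: continuous_I_val
  |move=> t; rewrite path_extE..].
Qed.

Let cval1 : continuous (fun ts : I * I => I_val ts.1).
Proof.
move=> z; apply: continuous_comp; first exact: cvg_fst.
exact: continuous_I_val.
Qed.

Let cval2 : continuous (fun ts : I * I => I_val ts.2).
Proof.
move=> z; apply: continuous_comp; first exact: cvg_snd.
exact: continuous_I_val.
Qed.

Lemma path_homotopic_sym x y (p q : path_in R x y) :
  path_homotopic p q -> path_homotopic q p.
Proof.
move=> [H [cH H0 H1 Hx Hy]].
exists (fun ts => H (ts.1, clampI (-1 * I_val ts.2 + 1))); split => //=.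
- move=> z; apply: continuous_comp; last exact: cH.
  apply: continuous_fpair; first by move=> ?; exact: cvg_fst.
  by apply: continuous_fclamp; apply: continuous_affine.
- by move=> t; rewrite I_val0 mulr0 add0r -[1]I_val1 I_valK H1.
- by move=> t; rewrite I_val1 mulr1 addNr -I_val0 I_valK H0.
Qed.

Lemma path_homotopic_trans x y (p q r : path_in R x y) :
  path_homotopic p q -> path_homotopic q r -> path_homotopic p r.
Proof.
move=> [H [cH H0 H1 Hx Hy]] [K [cK K0 K1 Kx Ky]].
exists (fun ts => if I_val ts.2 <= 2^-1 then H (ts.1, clampI (2 * I_val ts.2 + 0))
                  else K (ts.1, clampI (2 * I_val ts.2 + -1))); split => /=.
- apply: continuous_if => //.
  + move=> z; apply: continuous_comp; last exact: cH.
    apply: continuous_fpair; first by move=> ?; exact: cvg_fst.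
    by apply: continuous_fclamp; apply: continuous_affine.
  + move=> z; apply: continuous_comp; last exact: cK.
    apply: continuous_fpair; first by move=> ?; exact: cvg_fst.
    by apply: continuous_fclamp; apply: continuous_affine.
  + move=> z ->; rewrite divff// addr0 subrr -[1]I_val1 -[0]I_val0 !I_valK.
    by rewrite H1 K0.
- by move=> t; rewrite I_val0 mulr0 addr0 invr_ge0 ler0n -I_val0 I_valK H0.
- move=> t; rewrite I_val1 ifF; last by lra.
  by rewrite (_ : 2 * 1 + -1 = I_val one) ?I_valK ?K1// I_val1; lra.
- by move=> s; rewrite Hx Kx; case: ifP.
- by move=> s; rewrite Hy Ky; case: ifP.
Qed.

Lemma path_homotopic_cat x y z (p p' : path_in R x y) (q q' : path_in R y z) :
  path_homotopic p p' -> path_homotopic q q' ->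
  path_homotopic (path_cat p q) (path_cat p' q').
Proof.
move=> [H [cH H0 H1 Hx Hy]] [K [cK K0 K1 Kx Ky]].
exists (fun ts => if I_val ts.1 <= 2^-1 then H (clampI (2 * I_val ts.1 + 0), ts.2)
                  else K (clampI (2 * I_val ts.1 + -1), ts.2)); split => /=.
- apply: continuous_if => //.
  + move=> w; apply: continuous_comp; last exact: cH.
    apply: continuous_fpair; last by move=> ?; exact: cvg_snd.
    by apply: continuous_fclamp; apply: continuous_affine.
  + move=> w; apply: continuous_comp; last exact: cK.
    apply: continuous_fpair; last by move=> ?; exact: cvg_snd.
    by apply: continuous_fclamp; apply: continuous_affine.
  + move=> w ->; rewrite divff// addr0 subrr -[1]I_val1 -[0]I_val0 !I_valK.
    by rewrite Hy Kx.
- by move=> t; rewrite H0 K0.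
- by move=> t; rewrite H1 K1.
- by move=> s; rewrite I_val0 mulr0 addr0 invr_ge0 ler0n -I_val0 I_valK Hx.
- move=> s; rewrite I_val1 ifF; last by lra.
  by rewrite (_ : 2 * 1 + -1 = I_val one) ?I_valK ?Ky// I_val1; lra.
Qed.

Lemma path_homotopic_rev x y (p p' : path_in R x y) :
  path_homotopic p p' -> path_homotopic (path_rev p) (path_rev p').
Proof.
move=> [H [cH H0 H1 Hx Hy]].
exists (fun ts => H (clampI (-1 * I_val ts.1 + 1), ts.2)); split => /=.
- move=> w; apply: continuous_comp; last exact: cH.
  apply: continuous_fpair; last by move=> ?; exact: cvg_snd.
  by apply: continuous_fclamp; apply: continuous_affine.
- by move=> t; rewrite H0.
- by move=> t; rewrite H1.
- by move=> s; rewrite I_val0 mulr0 add0r -[1]I_val1 I_valK Hy.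
- by move=> s; rewrite I_val1 mulr1 addNr -I_val0 I_valK Hx.
Qed.

Lemma path_catA x y z w (p : path_in R x y) (q : path_in R y z)
    (r : path_in R z w) :
  path_homotopic (path_cat p (path_cat q r)) (path_cat (path_cat p q) r).
Proof.
apply: path_homotopic_sym.
apply: (@path_homotopic_reparam _ _ _ _ (path_ext (path_cat (path_cat p q) r))
  I_val (fun t => Order.max (Order.max (2^-1 * I_val t + 0)
    (1 * I_val t + - 4^-1)) (2 * I_val t + - 1))).
- exact: continuous_path_ext.
- exact: continuous_I_val.
- have cv := @continuous_I_val R.
  apply: continuous_fmax; last exact: continuous_affine.
  by apply: continuous_fmax; exact: continuous_affine.
- rewrite I_val0 !mulr0 !add0r [X in Order.max X _]max_l; last by lra.
  by rewrite max_l//; lra.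
- rewrite I_val1 [X in Order.max X _]max_r; last by lra.
  by rewrite max_r; lra.
- by move=> t; rewrite path_extE.
- move=> t; rewrite -path_extE !path_ext_cat.
  move: (I_val t) => a; have [a2|a2] := leP a 2^-1.
    rewrite (@max_l _ _ (2^-1 * a + 0)); last by lra.
    rewrite max_l; last by lra.
    rewrite ifT; last by lra.
    rewrite ifT; last by lra.
    by congr (path_ext p _); lra.
  rewrite (@max_r _ _ (2^-1 * a + 0)); last by lra.
  have [a3|a3] := leP (2 * a - 1) 2^-1.
    rewrite max_l; last by lra.
    rewrite ifT; last by lra.
    rewrite ifF; last by lra.
    by congr (path_ext q _); lra.
  rewrite max_r; last by lra.
  rewrite ifF; last by lra.
  by congr (path_ext r _); lra.
Qed.

Lemma path_cat_cstl x y (p : path_in R x y) :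
  path_homotopic (path_cat (path_cst x) p) p.
Proof.
apply: (@path_homotopic_reparam _ _ _ _ (path_ext p)
  (fun t => Order.max (0 * I_val t + 0) (2 * I_val t + - 1)) I_val).
- exact: continuous_path_ext.
- have cv := @continuous_I_val R.
  by apply: continuous_fmax; exact: continuous_affine.
- exact: continuous_I_val.
- by rewrite I_val0 max_l//; lra.
- by rewrite I_val1 max_r//; lra.
- move=> t; rewrite -path_extE path_ext_cat; move: (I_val t) => a.
  have [a2|a2] := leP a 2^-1.
    by rewrite max_l ?(@path_ext_le0 _ _ p)//; lra.
  by rewrite max_r//; lra.
- by move=> t; rewrite path_extE.
Qed.

Lemma path_cat_cstr x y (p : path_in R x y) :
  path_homotopic (path_cat p (path_cst y)) p.
Proof.
apply: (@path_homotopic_reparam _ _ _ _ (path_ext p)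
  (fun t => Order.min (0 * I_val t + 1) (2 * I_val t + 0)) I_val).
- exact: continuous_path_ext.
- have cv := @continuous_I_val R.
  by apply: continuous_fmin; exact: continuous_affine.
- exact: continuous_I_val.
- by rewrite I_val0 min_r//; lra.
- by rewrite I_val1 min_l//; lra.
- move=> t; rewrite -path_extE path_ext_cat; move: (I_val t) => a.
  have [a2|a2] := leP a 2^-1.
    by rewrite min_r ?addr0//; lra.
  by rewrite min_l ?(@path_ext_ge1 _ _ p)//; lra.
- by move=> t; rewrite path_extE.
Qed.

Lemma path_cat_rev x y (p : path_in R x y) :
  path_homotopic (path_cat (path_rev p) p) (path_cst y).
Proof.
apply: (@path_homotopic_reparam _ _ _ _ (path_ext p)
  (fun t => Order.max (- 2 * I_val t + 1) (2 * I_val t + - 1))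
  (fun t => 0 * I_val t + 1)).
- exact: continuous_path_ext.
- have cv := @continuous_I_val R.
  by apply: continuous_fmax; exact: continuous_affine.
- by apply: continuous_affine; exact: continuous_I_val.
- by rewrite I_val0 max_l; lra.
- by rewrite I_val1 max_r; lra.
- move=> t; rewrite -path_extE path_ext_cat path_ext_rev; move: (I_val t) => a.
  have [a2|a2] := leP a 2^-1.
    by rewrite max_l; last lra; congr (path_ext p _); lra.
  by rewrite max_r//; lra.
- by move=> t; rewrite mul0r add0r path_ext_ge1.
Qed.

Lemma path_revK x y (p : path_in R x y) : path_rev (path_rev p) = p.
Proof.
apply/path_eqP => t; rewrite -path_extE !path_ext_rev.
by rewrite opprB addrC subrK path_extE.
Qed.

Lemma path_rev_cat x y (p : path_in R x y) :
  path_homotopic (path_cat p (path_rev p)) (path_cst x).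
Proof. by have := path_cat_rev (path_rev p); rewrite path_revK. Qed.

End Paths.

Section FundamentalGroup.
Variables (R : realType) (T : topologicalType).
Local Open Scope quotient_scope.

Definition loop_rel (x : T) : rel (path_in R x x) :=
  fun p q => `[< path_homotopic p q >].

Lemma loop_rel_refl x : reflexive (@loop_rel x).
Proof. by move=> p; apply/asboolP; exact: path_homotopic_refl. Qed.

Lemma loop_rel_sym x : symmetric (@loop_rel x).
Proof.
by move=> p q; apply/idP/idP => /asboolP h; apply/asboolP;
  exact: path_homotopic_sym.
Qed.

Lemma loop_rel_trans x : transitive (@loop_rel x).
Proof.
by move=> q p r /asboolP pq /asboolP qr; apply/asboolP;
  exact: path_homotopic_trans qr.
Qed.

Definition loop_equiv x :=
  EquivRel _ (@loop_rel_refl x) (@loop_rel_sym x) (@loop_rel_trans x).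

Definition pi1 (x : T) := {eq_quot loop_equiv x}.

HB.instance Definition _ x := Choice.on (pi1 x).
HB.instance Definition _ x := Quotient.on (pi1 x).

Variable x : T.

Definition pi1_class (p : path_in R x x) : pi1 x := \pi_(pi1 x) p.

Lemma pi1_classP p q : pi1_class p = pi1_class q <-> path_homotopic p q.
Proof.
split=> [/eqmodP/asboolP//|h].
by apply/eqmodP/asboolP.
Qed.

Lemma pi1_repr (u : pi1 x) : pi1_class (repr u) = u.
Proof. exact: reprK. Qed.

Lemma repr_pi1 p : path_homotopic (repr (pi1_class p)) p.
Proof. by apply/pi1_classP; rewrite pi1_repr. Qed.

Definition pi1_mul (u v : pi1 x) := pi1_class (path_cat (repr u) (repr v)).
Definition pi1_one := pi1_class (path_cst R x).
Definition pi1_inv (u : pi1 x) := pi1_class (path_rev (repr u)).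

Lemma pi1_mulE p q :
  pi1_mul (pi1_class p) (pi1_class q) = pi1_class (path_cat p q).
Proof. by apply/pi1_classP/path_homotopic_cat; exact: repr_pi1. Qed.

Lemma pi1_invE p : pi1_inv (pi1_class p) = pi1_class (path_rev p).
Proof. by apply/pi1_classP/path_homotopic_rev; exact: repr_pi1. Qed.

Lemma pi1_mulA : associative pi1_mul.
Proof.
move=> u v w; rewrite -(pi1_repr u) -(pi1_repr v) -(pi1_repr w) !pi1_mulE.
by apply/pi1_classP; exact: path_catA.
Qed.

Lemma pi1_mul1 : left_id pi1_one pi1_mul.
Proof.
move=> u; rewrite -(pi1_repr u) pi1_mulE.
by apply/pi1_classP; exact: path_cat_cstl.
Qed.

Lemma pi1_1mul : right_id pi1_one pi1_mul.
Proof.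
move=> u; rewrite -(pi1_repr u) pi1_mulE.
by apply/pi1_classP; exact: path_cat_cstr.
Qed.

Lemma pi1_mulV : left_inverse pi1_one pi1_inv pi1_mul.
Proof.
move=> u; rewrite -(pi1_repr u) pi1_invE pi1_mulE.
by apply/pi1_classP; exact: path_cat_rev.
Qed.

Lemma pi1_Vmul : right_inverse pi1_one pi1_inv pi1_mul.
Proof.
move=> u; rewrite -(pi1_repr u) pi1_invE pi1_mulE.
by apply/pi1_classP; exact: path_rev_cat.
Qed.

HB.instance Definition _ :=
  isGroup.Build (pi1 x) pi1_mulA pi1_mul1 pi1_1mul pi1_mulV pi1_Vmul.

End FundamentalGroup.
Arguments pi1 R {T} x.

Definition pi1_map (R : realType) (X Y : topologicalType)
    (f : continuousType X Y) (x : X) (u : pi1 R x) : pi1 R (f x) :=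
  pi1_class [the path_in R (f x) (f x) of f \o repr u].

Lemma pi1_mapE (R : realType) (X Y : topologicalType)
    (f : continuousType X Y) (x : X) (p : path_in R x x) :
  pi1_map f (pi1_class p) =
  pi1_class [the path_in R (f x) (f x) of f \o p].
Proof.
apply/pi1_classP; have [H [cH H0 H1 Hx Hy]] := repr_pi1 p.
exists (f \o H); split=> [z|t|t|s|s] /=; last 4 first.
- by rewrite H0.
- by rewrite H1.
- by rewrite Hx.
- by rewrite Hy.
by apply: continuous_comp; [exact: cH|exact: cts_fun].
Qed.

Lemma pi1_mapM (R : realType) (X Y : topologicalType)
    (f : continuousType X Y) (x : X) :
  {morph (@pi1_map R X Y f x) : u v / (u * v)%g}.
Proof.
move=> u v; rewrite -[LHS]/(pi1_map f (pi1_class (path_cat (repr u) (repr v)))).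
rewrite -[RHS]/(pi1_mul
  (pi1_class [the path_in R (f x) (f x) of f \o repr u])
  (pi1_class [the path_in R (f x) (f x) of f \o repr v])).
rewrite pi1_mapE pi1_mulE; congr pi1_class.
apply/path_eqP => t /=.
rewrite -[LHS]/(f (path_cat_fun (repr u) (repr v) (I_val t))).
rewrite -[RHS]/(path_cat_fun _ _ (I_val t)) /path_cat_fun.
by case: ifP.
Qed.

(* The isomorphism [p] |-> [w^-1 . p . w] attached to a path [w] from [x] to
   [y]. *)
Definition pi1_transport (R : realType) (T : topologicalType) (x y : T)
    (w : path_in R x y) (u : pi1 R x) : pi1 R y :=
  pi1_class (path_cat (path_rev w) (path_cat (repr u) w)).

Section Coincidence.
Variables (R : realType) (X Y : topologicalType) (f g : continuousType X Y).

Definition coincidence_set : set X := [set x | f x = g x].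

Definition homotopic : Prop :=
  exists H : X * unit_interval R -> Y, [/\ continuous H,
    forall x, H (x, zero) = f x & forall x, H (x, one) = g x].

Variables (x0 : X) (w : path_in R (f x0) (g x0)).
Local Open Scope group_scope.

Definition reidemeister_rel (u v : pi1 R (g x0)) : Prop :=
  exists x : pi1 R x0,
    v = pi1_map g x * u * (pi1_transport w (pi1_map f x))^-1.

Definition reidemeister_classes : set (set (pi1 R (g x0))) :=
  range (fun u => [set v | reidemeister_rel u v]).

Definition reidemeister_number : \bar R := counting reidemeister_classes.

End Coincidence.
Arguments homotopic R {X Y} f g.
Arguments reidemeister_number {R X Y} f g {x0} w.

Section FiniteComplex.
Variables (R : realType) (X : topologicalType).

Definition sqnorm n (v : 'rV[R]_n) : R := \sum_(i < n) v ord0 i ^+ 2.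
Definition disk n : set 'rV[R]_n := [set v | sqnorm v <= 1].
Definition open_disk n : set 'rV[R]_n := [set v | sqnorm v < 1].
Definition sphere n : set 'rV[R]_n := [set v | sqnorm v = 1].
Arguments disk : clear implicits.
Arguments open_disk : clear implicits.
Arguments sphere : clear implicits.

(* [Phi i], of which only the restriction to the disk matters, is the
   characteristic map of the [i]-th cell. The weak topology condition is
   automatic for a finite number of cells. *)
Definition is_cw_structure (I : finType) (d : I -> nat)
    (Phi : forall i, 'rV[R]_(d i) -> X) : Prop :=
  let cell i := Phi i @` open_disk (d i) in
  [/\ forall i, {within disk (d i), continuous (Phi i)},
      forall i, set_inj (open_disk (d i)) (Phi i),
      forall i (U : set 'rV[R]_(d i)), open U -> exists2 V : set X, open V &
        Phi i @` (open_disk (d i) `&` U) = cell i `&` V,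
      forall x, exists! i, cell i x &
      forall i v, sphere (d i) v ->
        exists2 j, (d j < d i)%N & cell j (Phi i v)].

Definition finite_complex : Prop :=
  hausdorff_space X /\
  exists (I : finType) (d : I -> nat) (Phi : forall i, 'rV[R]_(d i) -> X),
    is_cw_structure Phi.

End FiniteComplex.

Section Smooth.
Variables (R : realType) (V W : normedModType R).

(* In finite dimension this is the usual notion of a C^k map on an open set [U];
   the values outside of [U] are irrelevant. *)
Fixpoint Ck (k : nat) (U : set V) (f : V -> W) : Prop :=
  (forall x, U x -> {for x, continuous f}) /\
  if k is k'.+1 then
    forall v, (forall x, U x -> derivable f x v) /\ Ck k' U ('D_v f)
  else True.

Definition smooth_on (U : set V) (f : V -> W) : Prop := forall k, Ck k U f.

End Smooth.

Record chart (R : realType) (n : nat) (M : Type) := Chart {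
  chart_dom : set M;
  chart_coord : M -> 'rV[R]_n;
  chart_param : 'rV[R]_n -> M
}.

Section Chart.
Variables (R : realType) (n : nat) (M : topologicalType).

Definition chart_cod (c : chart R n M) : set 'rV[R]_n :=
  chart_coord c @` chart_dom c.

Definition is_chart (c : chart R n M) : Prop :=
  [/\ open (chart_dom c), open (chart_cod c),
      forall x, chart_dom c x -> chart_param c (chart_coord c x) = x,
      {within chart_dom c, continuous (chart_coord c)} &
      {within chart_cod c, continuous (chart_param c)}].

Definition is_smooth_atlas (A : set (chart R n M)) : Prop :=
  [/\ forall c, A c -> is_chart c,
      forall x, exists2 c, A c & chart_dom c x &
      forall a b, A a -> A b ->
        smooth_on [set u | chart_cod a u /\ chart_dom b (chart_param a u)]
          (chart_coord b \o chart_param a)].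

End Chart.

HB.mixin Record isTopologicalGroup G of Topological G & Group G := {
  continuous_mulg : continuous (fun p : G * G => (p.1 * p.2)%g);
  continuous_invg : continuous (fun x : G => x^-1%g)
}.

HB.structure Definition TopologicalGroup :=
  {G of Topological G & Group G & isTopologicalGroup G}.

HB.mixin Record isLieGroup (R : realType) (n : nat) G of TopologicalGroup G := {
  lie_hausdorff : hausdorff_space G;
  lie_second_countable : @second_countable G;
  lie_atlas : set (chart R n G);
  lie_atlasP : is_smooth_atlas lie_atlas;
  smooth_mulg : forall a b c, lie_atlas a -> lie_atlas b -> lie_atlas c ->
    smooth_on
      [set uv : 'rV[R]_n * 'rV[R]_n | [/\ chart_cod a uv.1, chart_cod b uv.2 &
         chart_dom c (chart_param a uv.1 * chart_param b uv.2)%g]]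
      (fun uv => chart_coord c (chart_param a uv.1 * chart_param b uv.2)%g);
  smooth_invg : forall a b, lie_atlas a -> lie_atlas b ->
    smooth_on [set u | chart_cod a u /\ chart_dom b (chart_param a u)^-1%g]
      (fun u => chart_coord b (chart_param a u)^-1%g)
}.

#[short(type="lieGroupType")]
HB.structure Definition LieGroup (R : realType) (n : nat) :=
  {G of TopologicalGroup G & isLieGroup R n G}.

Fixpoint upper_central (G : groupType) (k : nat) : set G :=
  if k is k'.+1 then [set x | forall y, upper_central k' [~ x, y]%g]
  else [set 1%g].

Definition nilpotent_group (G : groupType) : Prop :=
  exists k, upper_central k = [set: G].

Definition simply_connected (R : realType) (T : topologicalType) : Prop :=
  (forall x y : T, exists p : path_in R x y, True) /\
  (forall (x : T) (u : pi1 R x), u = 1%g).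

Section CosetSpace.
Local Open Scope quotient_scope.
Variables (G : TopologicalGroup.type) (H : groupClosed G).

Definition lcoset_rel : rel G := fun x y => (x^-1 * y)%g \in H.

Lemma lcoset_rel_refl : reflexive lcoset_rel.
Proof. by move=> x; rewrite /lcoset_rel mulVg gpred1. Qed.

Lemma lcoset_rel_sym : symmetric lcoset_rel.
Proof. by move=> x y; rewrite /lcoset_rel -gpredV invgM invgK. Qed.

Lemma lcoset_rel_trans : transitive lcoset_rel.
Proof.
move=> y x z xy yz; rewrite /lcoset_rel.
by rewrite -(mulVKg y z) mulgA gpredM.
Qed.

Definition lcoset_equiv :=
  EquivRel _ lcoset_rel_refl lcoset_rel_sym lcoset_rel_trans.

Definition coset_space := quotient_topology {eq_quot lcoset_equiv}.

HB.instance Definition _ := Topological.on coset_space.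

End CosetSpace.

Definition homeomorphic (X Y : topologicalType) : Prop :=
  exists (h : X -> Y) (k : Y -> X),
    [/\ continuous h, continuous k, cancel h k & cancel k h].

(* Quotients of simply connected nilpotent Lie groups by discrete cocompact
   subgroups, up to homeomorphism. *)
Definition compact_nilmanifold (R : realType) (Y : topologicalType) : Prop :=
  exists (n : nat) (N : lieGroupType R n) (Gamma : groupClosed N),
    [/\ nilpotent_group N, simply_connected R N,
        [set` Gamma] `<=` isolated [set` Gamma],
        compact [set: coset_space Gamma] &
        homeomorphic Y (coset_space Gamma)].

(* Main.v *)
(* Write Y = N / Gamma. Lifting f and g along paths of X turns the Reidemeister
   relation into the orbit relation of a subgroup P of Gamma * Gamma acting on
   Gamma by u |-> a u b^-1; here N simply connected makes lifts with equal ends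
   homotopic. Gamma is finitely generated nilpotent, and the integral characters of
   its central series extend to a tower N = B_0 > B_1 > ... of closed normal
   subgroups, B_(j+1) being the kernel of a continuous homomorphism t_j from B_j to
   the reals that is N-invariant and split. If there are infinitely many orbits,
   then at some level i the stabilizers in P of all cosets u B_i act trivially
   through t_i. On the closed set C where f and g agree modulo B_i, the
   t_i-component of the difference of the lifts is therefore a well defined
   continuous real function theta. Extend theta to X by Tietze and translate f by
   elements of B_i with t_i-value c - theta, where c is not in t_i(Gamma): this
   pushes f off g on C and changes nothing modulo B_i, so no coincidence is
   left. *)
Require Import Defs.
From HB Require Import structures.
From mathcomp Require Import all_boot all_order all_algebra.
From mathcomp Require Import all_classical all_reals all_analysis.
From mathcomp Require Import homotopy.
From mathcomp Require Import ring lra zify.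

Set Implicit Arguments.
Unset Strict Implicit.
Unset Printing Implicit Defensive.

Import Order.TTheory GRing.Theory Num.Theory.
Import numFieldNormedType.Exports.

Local Open Scope classical_set_scope.
Local Open Scope ring_scope.

(** * Isolators in nilpotent groups *)

(** No completion, Lie algebra or exponential map is used. A character of a cobounded subgroup is
    extended by sending a point to the value at a nearby lattice point, which is additive up to a
    bounded error, and by homogenizing along the powers [x ^+ (2 ^ n)]; nilpotency makes the
    commutators harmless. The continuous splittings come from iterated square roots in a chart,
    where multiplication is a small perturbation of addition. The level at which stabilizers act
    trivially is found by contradiction: otherwise every level has a coset whose stabilizer has a
    nonzero [t_j] value. Such a value must be carried to every other coset, for which [P] itself has
    too few elements; the elements having a power in [P], modulo the next tower subgroup, suffice,
    and they form a group because the ambient group is nilpotent. With nonzero values at all cosets,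
    each of them splits into finitely many classes at the next level, so the number of orbits would
    be finite. For theta to be well defined, one representative is fixed in each twisted class of
    cosets. *)

Section Subgroups.
Variable G : groupType.
Local Open Scope group_scope.
Implicit Types (S T P Q K : set G) (x y z : G).

Definition subgroup S :=
  [/\ S 1, forall x y, S x -> S y -> S (x * y) & forall x, S x -> S x^-1].

Definition normalized S T := forall x y, S x -> T y -> S (x ^ y).

Lemma subgroupX S x n : subgroup S -> S x -> S (x ^+ n).
Proof.
move=> [S1 SM _] Sx; elim: n => [|n IH]; first by rewrite expg0.
by rewrite expgS; exact: SM.
Qed.

Lemma subgroupR S x y : subgroup S -> S x -> S y -> S [~ x, y].
Proof.
move=> [_ SM SV] Sx Sy; rewrite /commg /conjg.
by apply: (SM); [exact: SV|apply: (SM); [exact: SV|exact: SM]].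
Qed.

Lemma subgroupI S T : subgroup S -> subgroup T -> subgroup (S `&` T).
Proof.
move=> [S1 SM SV] [T1 TM TV]; split=> //.
- by move=> x y [? ?] [? ?]; split; [exact: SM|exact: TM].
- by move=> x [? ?]; split; [exact: SV|exact: TV].
Qed.

Inductive gen S : set G :=
| gen_mem x : S x -> gen S x
| gen_1 : gen S 1
| gen_M x y : gen S x -> gen S y -> gen S (x * y)
| gen_V x : gen S x -> gen S x^-1.

Lemma gen_subgroup S : subgroup (gen S).
Proof. by split; [exact: gen_1|exact: gen_M|exact: gen_V]. Qed.

Lemma gen_sub S T : subgroup T -> S `<=` T -> gen S `<=` T.
Proof. by case=> T1 TM TV ST x; elim=> {x}; auto. Qed.

Lemma gen_normalized S T : (forall x y, S x -> T y -> gen S (x ^ y)) ->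
  normalized (gen S) T.
Proof.
move=> ST x y gx Ty; elim: gx => {x}.
- by move=> x Sx; exact: ST.
- by rewrite conj1g; exact: gen_1.
- by move=> x z _ ? _ ?; rewrite conjMg; exact: gen_M.
- by move=> x _ ?; rewrite conjVg; exact: gen_V.
Qed.

(** Both parts are proved together: closure under products at [k.+1] uses stability under
    conjugation at [k]. *)
Lemma upper_centralP k :
  subgroup (@upper_central G k) /\
  (forall x y, upper_central k x -> upper_central k (x ^ y)).
Proof.
elim: k => [|k [[K1 KM KV] KJ]] /=.
  split; first by split=> // [x y|x] /= ->; rewrite ?invg1// => ->; rewrite mulg1.
  by move=> x y -> ; rewrite conj1g.
have H1 : forall x y, upper_central k.+1 x -> upper_central k.+1 (x ^ y).
  move=> x y xK z /=; rewrite -[z](conjgKV y) -conjRg.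
  by apply: KJ; exact: xK.
split=> //; split=> [y|x y xK yK z|x xK z] /=.
- by rewrite comm1g.
- have -> : [~ x * y, z] = [~ x, z] ^ y * [~ y, z].
    by rewrite /commg /conjg !gnorm.
  by apply: KM; [apply: KJ; exact: xK|exact: yK].
- have -> : [~ x^-1, z] = ([~ x, z] ^ (x^-1))^-1.
    by rewrite /commg /conjg !gnorm.
  by apply/KV/KJ/xK.
Qed.

Lemma upper_central_subgroup k : subgroup (@upper_central G k).
Proof. by case: (upper_centralP k). Qed.

Lemma upper_centralJ k x y : upper_central k x -> @upper_central G k (x ^ y).
Proof. by case: (upper_centralP k) => _; exact. Qed.

Lemma upper_centralRr k x y :
  upper_central k.+1 y -> @upper_central G k [~ x, y].
Proof.
move=> /(_ x); case: (upper_central_subgroup k) => _ _ KV.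
by move=> /KV; rewrite invgR.
Qed.

Section Congruence.
Variables (Q K : set G).
Hypotheses (sQ : subgroup Q) (sK : subgroup K) (nK : normalized K Q).

Definition cong x y := K (x^-1 * y).

Lemma cong_refl x : cong x x.
Proof. by rewrite /cong mulVg; case: sK. Qed.

Lemma cong_sym x y : cong x y -> cong y x.
Proof. by case: sK => _ _ KV /KV; rewrite /cong invgM invgK. Qed.

Lemma cong_trans y x z : cong x y -> cong y z -> cong x z.
Proof.
by case: sK => _ KM _ xy yz; have := KM _ _ xy yz; rewrite /cong !gnorm.
Qed.

Lemma congM x x' y y' : Q y -> cong x x' -> cong y y' ->
  cong (x * y) (x' * y').
Proof.
case: sK => _ KM _ Qy xx' yy'; have := KM _ _ (nK xx' Qy) yy'.
by rewrite /cong /conjg !gnorm.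
Qed.

Lemma congX x x' n : Q x -> cong x x' -> cong (x ^+ n) (x' ^+ n).
Proof.
move=> Qx xx'; elim: n => [|n IH]; first exact: cong_refl.
by rewrite !expgS; apply: congM => //; exact: subgroupX.
Qed.

Variable C : set G.
Hypotheses (sC : subgroup C) (CQ : C `<=` Q)
  (cC : forall x y, C x -> Q y -> K [~ x, y]).

Lemma cong_comm x y : C x -> Q y -> cong (y * x) (x * y).
Proof. by move=> Cx Qy; have := cC Cx Qy; rewrite /cong /commg /conjg !gnorm. Qed.

(** Modulo [K] the elements of [C] are central in [Q], so [x] can be moved past [y]. *)
Lemma cong_expM x y n : C x -> Q y -> cong ((x * y) ^+ n) (x ^+ n * y ^+ n).
Proof.
move=> Cx Qy; have Qx := CQ Cx; case: (sQ) => _ QM _.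
elim: n => [|n IH]; first by rewrite !expg0 mulg1; exact: cong_refl.
rewrite expgS; apply: (cong_trans (y := (x * y) * (x ^+ n * y ^+ n))).
  by apply: congM => //; [apply: subgroupX => //; exact: QM|exact: cong_refl].
have -> : x ^+ n.+1 * y ^+ n.+1 = x * ((x ^+ n * y) * y ^+ n).
  by rewrite !expgS !mulgA -expgS expgSr.
have -> : x * y * (x ^+ n * y ^+ n) = x * ((y * x ^+ n) * y ^+ n).
  by rewrite !mulgA.
apply: congM; [|exact: cong_refl|].
  by apply: (QM); [apply: (QM) => //|]; exact: subgroupX.
apply: congM; [exact: subgroupX| |exact: cong_refl].
by apply: cong_comm => //; exact: subgroupX.
Qed.

End Congruence.

(** * Powers in a subgroup enlarged by a root of one of its elements *)

Section Isolator.
Variables (P : set G) (g : G) (m : nat).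
Hypotheses (sP : subgroup P) (Pg : P (g ^+ m.+1)).

Let Q := gen (P `|` [set g]).

Fixpoint lcs k := if k is k'.+1 then
  gen [set w | exists2 q, Q q & exists2 v, lcs k' v & w = [~ q, v]] else Q.

Let sQ : subgroup Q. Proof. exact: gen_subgroup. Qed.

Lemma lcs_subgroup k : subgroup (lcs k).
Proof. by case: k => [|k]; exact: gen_subgroup. Qed.

Lemma lcs_sub k : lcs k `<=` Q.
Proof.
elim: k => //= k IH; apply: gen_sub => // w [q Qq [v /IH Qv ->]].
exact: subgroupR.
Qed.

Lemma lcs_normal k : normalized (lcs k) Q.
Proof.
have [_ QM QV] := sQ; have QJ x y : Q x -> Q y -> Q (x ^ y).
  by move=> Qx Qy; apply: (QM _ _ (QV _ Qy)); exact: QM.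
elim: k => [|k IH] /=; first by move=> x y; exact: QJ.
apply: gen_normalized => w y [q Qq [v Lv ->]] Qy; rewrite conjRg.
by apply: gen_mem; exists (q ^ y); [exact: QJ|exists (v ^ y) => //; exact: IH].
Qed.

Lemma lcs_commr k q v : Q q -> lcs k v -> lcs k.+1 [~ q, v].
Proof. by move=> Qq Lv; apply: gen_mem; exists q => //; exists v. Qed.

Lemma lcs_comml k q v : Q q -> lcs k v -> lcs k.+1 [~ v, q].
Proof. by move=> Qq Lv; rewrite -invgR; apply: gen_V; exact: lcs_commr. Qed.

Lemma lcs_upper c k : upper_central c = [set: G] ->
  lcs k `<=` upper_central (c - k).
Proof.
move=> Zc; elim: k => [|k IH] /=; first by rewrite subn0 Zc.
apply: gen_sub; first exact: upper_central_subgroup.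
move=> w [q _ [v /IH Lv ->]]; case E : (c - k)%N Lv => [|j].
  rewrite (_ : (c - k.+1 = 0)%N); last by lia.
  by move=> /= ->; rewrite commg1.
by rewrite (_ : (c - k.+1 = j)%N); [exact: upper_centralRr|lia].
Qed.

Let commgMl (x y z : G) : [~ x * y, z] = [~ x, z] ^ y * [~ y, z].
Proof. by rewrite /commg /conjg !gnorm. Qed.

Let commgMr (x y z : G) : [~ z, x * y] = [~ z, y] * [~ z, x] ^ y.
Proof. by rewrite /commg /conjg !gnorm. Qed.

Let cM k x x' y y' : Q y -> cong (lcs k) x x' -> cong (lcs k) y y' ->
  cong (lcs k) (x * y) (x' * y').
Proof. by apply: (@congM Q); [exact: lcs_subgroup|exact: lcs_normal]. Qed.

Let cX k x x' n : Q x -> cong (lcs k) x x' -> cong (lcs k) (x ^+ n) (x' ^+ n).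
Proof.
by apply: (@congX Q) => //; [exact: lcs_subgroup|exact: lcs_normal].
Qed.

Let cE k x y n : lcs k x -> Q y ->
  cong (lcs k.+1) ((x * y) ^+ n) (x ^+ n * y ^+ n).
Proof.
apply: (@cong_expM Q (lcs k.+1)) => //;
  [exact: lcs_subgroup|exact: lcs_normal|exact: lcs_subgroup|exact: lcs_sub|].
by move=> a b La Qb; exact: lcs_comml.
Qed.

Let cJ k x y : lcs k x -> Q y -> cong (lcs k.+1) x (x ^ y).
Proof. by move=> Lx Qy; have := lcs_comml Qy Lx; rewrite /cong /commg. Qed.

Let cR k x : cong (lcs k) x x.
Proof. exact: cong_refl (lcs_subgroup _) _. Qed.

(** The graded form of the claim: in the abelian quotient [lcs k / lcs k.+1], a positive power of
    [w] comes from [P]. *)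
Let powset k w := exists l, exists2 p, (P `&` lcs k) p &
  cong (lcs k.+1) (w ^+ l.+1) p.

Let powsetM k x y : lcs k x -> lcs k y -> powset k x -> powset k y ->
  powset k (x * y).
Proof.
move=> Lx Ly [l [p [Pp Lp] xp]] [l' [p' [Pp' Lp'] yp']].
have Qx := lcs_sub Lx; have Qy := lcs_sub Ly.
exists (l * l' + l + l')%N.
exists (p ^+ l'.+1 * p' ^+ l.+1).
  split; case: (lcs_subgroup k) => ? LM ?; case: sP => _ PM _.
    by apply: (PM); exact: subgroupX.
  by apply: LM; apply: subgroupX => //; exact: lcs_subgroup.
rewrite (_ : (l * l' + l + l').+1 = (l.+1 * l'.+1)%N); last by lia.
apply: (cong_trans (lcs_subgroup k.+1)).
  exact: cE.
apply: cM; [exact: subgroupX| |].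
  by rewrite expgnA; apply: cX => //; exact: subgroupX.
by rewrite mulnC expgnA; apply: cX => //; exact: subgroupX.
Qed.

Let powset1 k : powset k 1.
Proof.
exists 0%N, 1; last by rewrite expg1; exact: cR.
by split; [case: sP|case: (lcs_subgroup k)].
Qed.

Let powsetV k x : lcs k x -> powset k x -> powset k x^-1.
Proof.
move=> Lx [l [p [Pp Lp] xp]]; exists l, p^-1.
  by split; [case: sP => _ _; exact|case: (lcs_subgroup k) => _ _; exact].
rewrite expVgn /cong invgK.
have Qx := lcs_sub Lx; have Qp := lcs_sub Lp.
have [_ QM QV] := sQ.
have := lcs_normal (cong_sym (lcs_subgroup _) xp) (QV _ Qp).
by rewrite /conjg !gnorm.
Qed.

Let powset_cong k x y : lcs k x -> cong (lcs k.+1) x y -> powset k y ->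
  powset k x.
Proof.
move=> Lx xy [l [p Pp yp]]; exists l, p => //.
apply: (cong_trans (lcs_subgroup k.+1)) yp.
by apply: cX => //; exact: lcs_sub Lx.
Qed.

Let powset_root k x n : lcs k x -> powset k (x ^+ n.+1) -> powset k x.
Proof.
move=> Lx [l [p Pp xp]]; exists (n * l + n + l)%N, p => //.
by rewrite (_ : (n * l + n + l).+1 = (n.+1 * l.+1)%N) ?expgnA//; lia.
Qed.

Let commXl k x y n : Q x -> lcs k y ->
  cong (lcs k.+2) ([~ x, y] ^+ n) [~ x ^+ n, y].
Proof.
move=> Qx Ly; elim: n => [|n IH].
  by rewrite !expg0 comm1g; exact: cR.
have LR := lcs_commr Qx Ly; have QR := lcs_sub LR.
rewrite expgS [in X in cong _ _ X]expgS commgMl.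
apply: cM; [exact: subgroupX| |done].
by apply: cJ => //; exact: subgroupX.
Qed.

Let commXr k x y n : Q x -> lcs k y ->
  cong (lcs k.+2) ([~ x, y] ^+ n) [~ x, y ^+ n].
Proof.
move=> Qx Ly; elim: n => [|n IH].
  by rewrite !expg0 commg1; exact: cR.
have LR := lcs_commr Qx Ly; have QR := lcs_sub LR; have Qy := lcs_sub Ly.
rewrite expgSr [in X in cong _ _ X]expgS commgMr.
apply: cM; [done|done|].
by apply: cJ => //; exact: subgroupX.
Qed.

(** The commutator is bilinear modulo the next term of the series, so [q] may be taken among the
    generators. For [q = g], the power [m.+1] turns [[~ g, p]] into a commutator of two elements of
    [P]. *)
Let powset_comm k q p : P p -> lcs k p -> Q q -> powset k.+1 [~ q, p].
Proof.
move=> Pp Lp; elim=> {q}.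
- move=> q [Pq|->].
    exists 0%N, [~ q, p]; last by rewrite expg1; exact: cR.
    split; first exact: subgroupR.
    by apply: lcs_commr => //; apply: gen_mem; left.
  have Qg : Q g by apply: gen_mem; right.
  apply: (@powset_root _ _ m); first exact: lcs_commr.
  apply: powset_cong (commXl _ Qg Lp) _.
    by apply: subgroupX; [exact: lcs_subgroup|exact: lcs_commr].
  exists 0%N, [~ g ^+ m.+1, p]; last by rewrite expg1; exact: cR.
  split; first exact: subgroupR.
  by apply: lcs_commr => //; exact: subgroupX.
- by rewrite comm1g; exact: powset1.
- move=> x y Qx IHx Qy IHy; rewrite commgMl.
  have Lx := lcs_commr Qx Lp; have Ly := lcs_commr Qy Lp.
  have LxJ := lcs_normal Lx Qy.
  apply: powsetM => //; apply: powset_cong IHx => //.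
  by apply: cong_sym; [exact: lcs_subgroup|exact: cJ].
- move=> x Qx IHx; have [_ _ QV] := sQ.
  have -> : [~ x^-1, p] = ([~ x, p] ^ (x^-1))^-1.
    by rewrite /commg /conjg !gnorm.
  have Lx := lcs_commr Qx Lp; have LxJ := lcs_normal Lx (QV _ Qx).
  apply: powsetV => //; apply: powset_cong IHx => //.
  by apply: cong_sym; [exact: lcs_subgroup|apply: cJ => //; exact: QV].
Qed.

(** A generator [[~ q, v]] of [lcs k.+1] has a power congruent to [[~ q, v ^+ l.+1]], and by
    induction [v ^+ l.+1] can be replaced by an element of [P]. *)
Let powset_all k w : lcs k w -> powset k w.
Proof.
elim: k w => [|k IH] w.
  move=> Lw; elim: (Lw) => {w Lw}.
  - move=> w [Pw|->].
      exists 0%N, w; last by rewrite expg1; exact: cR.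
      by split=> //; apply: gen_mem; left.
    exists m, (g ^+ m.+1); last exact: cR.
    by split => //; apply: subgroupX => //; apply: gen_mem; right.
  - exact: powset1.
  - by move=> x y ? ? ? ?; exact: powsetM.
  - by move=> x ? ?; exact: powsetV.
elim=> {w} /=.
- move=> w [q Qq [v Lv ->]]; have [l [p [Pp Lp] vp]] := IH _ Lv.
  apply: (@powset_root _ _ l); first exact: lcs_commr.
  apply: powset_cong (commXr l.+1 Qq Lv) _.
    by apply: subgroupX; [exact: lcs_subgroup|exact: lcs_commr].
  apply: powset_cong _ (powset_comm Pp Lp Qq).
    by apply: lcs_commr => //; apply: subgroupX => //; exact: lcs_subgroup.
  have -> : p = v ^+ l.+1 * ((v ^+ l.+1)^-1 * p) by rewrite mulVKg.
  have Qv := lcs_sub Lv.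
  rewrite commgMr -[X in cong _ X]mul1g.
  apply: cM.
  + apply: subgroupR => //; exact: subgroupX.
  + by rewrite /cong invg1 mul1g; exact: lcs_commr.
  + apply: cJ; last exact: lcs_sub vp.
    by apply: lcs_commr => //; apply: subgroupX => //; exact: lcs_subgroup.
- exact: powset1.
- by move=> x y ? ? ? ?; exact: powsetM.
- by move=> x ? ?; exact: powsetV.
Qed.

(** The graded statements are assembled by descending the lower central series of [Q]: each step
    removes the error in one layer at the price of a further power. *)
Lemma power_in_subgroup_adjoin x : nilpotent_group G -> Q x ->
  exists l, P (x ^+ l.+1).
Proof.
move=> [c Zc] Qx.
have [l [p Pp]] : exists l, exists2 p, P p & cong (lcs c) (x ^+ l.+1) p.
  elim: c {Zc} => [|c [l [p Pp xp]]].
    exists 0%N, 1; first by case: sP.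
    by rewrite /cong mulg1; case: sQ => _ _; apply; exact: subgroupX.
  have Qp : Q p by apply: gen_mem; left.
  have [_ QM QV] := sQ; have [_ PM PV] := sP; have [_ LM LV] := lcs_subgroup c.
  (* This is [x ^+ l.+1 / p], the error left in [lcs c], so that [w * p = x ^+ l.+1]. *)
  set w := ((x ^+ l.+1)^-1 * p)^-1 ^ p^-1.
  have Lw : lcs c w by apply: lcs_normal; [exact: LV|exact: QV].
  have [k [p' [Pp' Lp'] wp']] := powset_all Lw.
  exists (l * k + l + k)%N, (p' * p ^+ k.+1).
    by apply: PM => //; exact: subgroupX.
  have -> : x ^+ (l * k + l + k).+1 = (w * p) ^+ k.+1.
    rewrite (_ : (l * k + l + k).+1 = (l.+1 * k.+1)%N) ?expgnA; last by lia.
    by congr (_ ^+ _); rewrite /w /conjg !gnorm.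
  apply: (cong_trans (lcs_subgroup c.+1)).
    exact: cE.
  by apply: cM; [exact: subgroupX| |exact: cR].
move=> /(lcs_upper Zc); rewrite subnn /= => e; exists l.
by move: (Pp); rewrite (_ : p = x ^+ l.+1)//; apply: (@mulgI _ (x ^+ l.+1)^-1); rewrite e mulVg.
Qed.

End Isolator.

(** For products, [x] is adjoined to [P] and then [y] to the result; a power of [x * y] descends
    through both adjunctions. *)
Lemma isolator_subgroup P : nilpotent_group G -> subgroup P ->
  subgroup [set x | exists l, P (x ^+ l.+1)].
Proof.
move=> nG sP; have [P1 PM PV] := sP; split=> /=.
- by exists 0%N.
- move=> x y [m Px] [n Py]; pose Q := gen (P `|` [set x]).
  have sQ : subgroup Q by exact: gen_subgroup.
  have Qy : Q (y ^+ n.+1) by apply: gen_mem; left.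
  have [l Ql] : exists l, Q ((x * y) ^+ l.+1).
    apply: (power_in_subgroup_adjoin sQ Qy nG); apply: gen_M.
      by apply: gen_mem; left; apply: gen_mem; right.
    by apply: gen_mem; right.
  have [k Pk] := power_in_subgroup_adjoin sP Px nG Ql.
  exists (l * k + l + k)%N.
  by rewrite (_ : (l * k + l + k).+1 = (l.+1 * k.+1)%N) ?expgnA//; lia.
- by move=> x [l Px]; exists l; rewrite expVgn; exact: PV.
Qed.

(* Built from the bottom: each factor is central and generated by [x]. *)
Inductive central_series (D : set G) : set G -> Prop :=
| central_series1 : central_series D [set 1]
| central_series_adjoin E x : central_series D E -> D x ->
    (forall d y, D d -> gen (E `|` [set x]) y -> E [~ d, y]) ->
    central_series D (gen (E `|` [set x])).

Lemma central_series_sub (D E : set G) : subgroup D -> central_series D E ->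
  [/\ subgroup E, E `<=` D & normalized E D].
Proof.
move=> sD; have [D1 DM DV] := sD; elim=> {E}.
  split=> [|x ->//|x y -> _]; last by rewrite conj1g.
  by split=> // [x y|x] /= ->; rewrite ?invg1// => ->; rewrite mulg1.
move=> E x _ [sE ED nE] Dx cE; split; first exact: gen_subgroup.
  by apply: gen_sub => // y [/ED//|->].
move=> y d gy Dd; have -> : y ^ d = y * [~ d, y]^-1.
  by rewrite /commg /conjg !gnorm.
apply: gen_M => //; apply: gen_V; apply: gen_mem; left.
exact: cE.
Qed.

(** The iterated commutators of the generators are adjoined by decreasing weight; a commutator of
    one of them with a generator has already been adjoined. *)
Lemma fg_central_series (s : seq G) : nilpotent_group G ->
  central_series (gen [set` s]) (gen [set` s]).
Proof.
move=> [c Zc]; pose D := gen [set` s].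
have sD : subgroup D by exact: gen_subgroup.
have [D1 DM DV] := sD.
pose L := fix L k := if k is k'.+1 then [seq [~ a, b] | a <- s, b <- L k']
  else s.
have LD k x : x \in L k -> D x.
  elim: k x => [|k IH] x /=; first by move=> xs; exact: gen_mem.
  move=> /allpairsP[[a b] [/= sa /IH Db ->]].
  by apply: subgroupR => //; exact: gen_mem.
have LZ k x : x \in L k -> upper_central (c - k) x.
  elim: k x => [|k IH] x /=; first by rewrite subn0 Zc.
  move=> /allpairsP[[a b] [/= sa /IH Zb ->]].
  case E : (c - k)%N Zb => [|j].
    rewrite (_ : (c - k.+1 = 0)%N); last by lia.
    by move=> /= ->; rewrite commg1.
  by rewrite (_ : (c - k.+1 = j)%N); [exact: upper_centralRr|lia].
(* It is enough to test centrality against the generators [s], since the subgroup built so far is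
   normal in [D]. *)
have adjoin l x : D x -> (forall a, a \in s -> gen [set` l] [~ a, x]) ->
    central_series D (gen [set` l]) -> central_series D (gen [set` x :: l]).
  move=> Dx cx cl; have [sE ED nE] := central_series_sub sD cl.
  set E := gen [set` l] in cx cl sE ED nE *.
  have [E1 EM EV] := sE.
  have -> : gen [set` x :: l] = gen (E `|` [set x]).
    apply/seteqP; split; apply: gen_sub; try exact: gen_subgroup.
      move=> y; rewrite /= inE => /orP[/eqP->|yl]; apply: gen_mem; first by right.
      by left; exact: gen_mem.
    move=> y [|->]; last by apply: gen_mem; rewrite /= mem_head.
    apply: gen_sub => [|z zl]; first exact: gen_subgroup.
    by apply: gen_mem; rewrite /= inE; apply/orP; right.
  apply: central_series_adjoin => // d y Dd gy.
  have cDx d' : D d' -> E [~ d', x].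
    move=> Dd'; have : (D `&` [set a | E [~ a, x]]) d'; last by case.
    apply: gen_sub Dd'; last by move=> a sa; split; [exact: gen_mem|exact: cx].
    split.
    - by split=> //=; rewrite comm1g.
    - move=> a b [Da Ea] [Db Eb]; split; first exact: DM.
      have /= -> : [~ a * b, x] = [~ a, x] ^ b * [~ b, x].
        by rewrite /commg /conjg !gnorm.
      by apply: EM => //; exact: nE.
    - move=> a [Da Ea]; split; first exact: DV.
      have /= -> : [~ a^-1, x] = ([~ a, x] ^ (a^-1))^-1.
        by rewrite /commg /conjg !gnorm.
      by apply/EV/nE => //; exact: DV.
  have : (D `&` [set y | forall d, D d -> E [~ d, y]]) y; last by case=> _; exact.
  apply: gen_sub gy; last first.
    move=> z [Ez|->]; split=> // [|d' Dd']; first exact: ED.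
    have -> : [~ d', z] = (z ^ d')^-1 * z by rewrite /commg /conjg !gnorm.
    by apply: EM => //; apply: EV; exact: nE.
  split.
  - by split=> // d'; rewrite commg1.
  - move=> a b [Da Ea] [Db Eb]; split; first exact: DM.
    move=> d' Dd'; have -> : [~ d', a * b] = [~ d', b] * [~ d', a] ^ b.
      by rewrite /commg /conjg !gnorm.
    by apply: EM; [exact: Eb|apply: nE => //; exact: Ea].
  - move=> a [Da Ea]; split; first exact: DV.
    move=> d' Dd'; have -> : [~ d', a^-1] = ([~ d', a] ^ (a^-1))^-1.
      by rewrite /commg /conjg !gnorm.
    by apply/EV/nE; [exact: Ea|exact: DV].
have build k j : (k + j = c)%N ->
    central_series D (gen [set` flatten [seq L i | i <- iota k j]]).
  elim: j k => [|j IH] k kj /=.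
    rewrite (_ : gen _ = [set 1]); first exact: central_series1.
    apply/seteqP; split=> [|x ->]; last exact: gen_1.
    apply: gen_sub => //; split=> // [x y|x] /= ->; rewrite ?invg1// => ->.
    by rewrite mulg1.
  set r := flatten _; have cr : central_series D (gen [set` r]).
    by apply: IH; lia.
  have Lr a b : a \in s -> b \in L k -> gen [set` r] [~ a, b].
    move=> sa Lb; have Lab : [~ a, b] \in L k.+1 by apply/allpairsP; exists (a, b).
    case: (posnP j) => j0; last first.
      by apply: gen_mem; rewrite /r -(prednK j0) /= mem_cat Lab.
    have := LZ _ _ Lab; rewrite (_ : (c - k.+1 = 0)%N); last by lia.
    by move=> /= ->; exact: gen_1.
  (* The trivial inclusion is kept so that the induction on the first list remembers that its
     entries have weight index [k]. *)
  have : {subset L k <= L k} by [].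
  elim: {1 3}(L k) => //= x l IHl xl; apply: adjoin.
  - by apply: (LD k); apply: xl; exact: mem_head.
  - move=> a sa; apply: (gen_sub (S := [set` r])); first exact: gen_subgroup.
      by move=> y yr; apply: gen_mem; rewrite /= mem_cat; apply/orP; right.
    by apply: Lr => //; apply: xl; exact: mem_head.
  - by apply: IHl => y yl; apply: xl; rewrite inE yl orbT.
have := build 0%N c (add0n _); set r := flatten _.
suff -> : gen [set` r] = D by [].
apply/seteqP; split; apply: gen_sub; try exact: gen_subgroup.
  by move=> x /flattenP[_ /mapP[k _ ->]]; exact: LD.
case: c => [|c] in Zc LZ build r *.
  move=> x _; have : upper_central 0 x by rewrite Zc.
  by move=> /= ->; exact: gen_1.
by move=> x xs; apply: gen_mem; rewrite /r /= mem_cat; apply/orP; left.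
Qed.

End Subgroups.

(** * Extension of homomorphisms to the real points *)

Section BoundedHomomorphisms.
Variables (R : realType) (G : groupType).
Local Open Scope group_scope.
Implicit Types (A B C D H K : set G) (f q t : G -> R) (x y z : G).

(** Boundedness is axiomatized so that the extension theorem is purely algebraic; it is used for
    subsets of compact sets. *)
Definition bornology (bdd : set G -> Prop) :=
  [/\ forall A B, A `<=` B -> bdd B -> bdd A,
      forall x, bdd [set x],
      forall A, bdd A -> bdd [set x^-1 | x in A] &
      forall A B, bdd A -> bdd B -> bdd [set x * y | x in A & y in B]].

Definition hom_on H f := forall x y, H x -> H y -> f (x * y) = (f x + f y)%R.

Definition locally_bounded (bdd : set G -> Prop) H f :=
  forall A, bdd A -> exists M : R, forall x, H x -> A x -> `|f x|%R <= M.

Lemma hom_on1 H f : subgroup H -> hom_on H f -> f 1 = 0%R.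
Proof. by move=> [H1 _ _] hf; have := hf _ _ H1 H1; rewrite mulg1; lra. Qed.

Lemma hom_onV H f x : subgroup H -> hom_on H f -> H x -> f x^-1 = (- f x)%R.
Proof.
move=> sH hf Hx; have := hom_on1 sH hf; case: sH => _ _ HV.
by rewrite -(mulgV x) hf//; [lra|exact: HV].
Qed.

Lemma hom_onX H f x n : subgroup H -> hom_on H f -> H x ->
  f (x ^+ n) = (n%:R * f x)%R.
Proof.
move=> sH hf Hx; elim: n => [|n IH]; first by rewrite expg0 (hom_on1 sH hf) mul0r.
by rewrite expgS hf//; [rewrite IH -natr1; lra|exact: subgroupX].
Qed.

Lemma hom_onJ H f x y : subgroup H -> hom_on H f -> H x -> H y ->
  f (x ^ y) = f x.
Proof.
move=> sH hf Hx Hy; have [_ HM HV] := sH.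
rewrite /conjg hf//; [|exact: HV|exact: HM].
by rewrite hf// (hom_onV sH hf Hy); lra.
Qed.

Lemma bounded_multiples_eq0 (a M : R) : (forall n, `|n%:R * a| <= M)%R ->
  a = 0%R.
Proof.
move=> aM; apply/eqP; rewrite -normr_le0 leNgt; apply/negP => a0.
have [n Mn] : exists n : nat, (M / `|a| < n%:R)%R.
  by exists (Num.truncn (M / `|a|)).+1; exact: truncnS_gt.
have := aM n; rewrite normrM normr_nat; move: Mn; rewrite ltr_pdivrMr//; lra.
Qed.

(** Iterating the doubling multiplies [d u] by every power of 2, which the common bound [M] forbids
    unless [d u = 0]. *)
Lemma halving_eq0 (T : Type) (P : T -> Prop) (d : T -> R) (M : R) :
  (forall u, P u -> `|d u| <= M)%R ->
  (forall u, P u -> exists2 v, P v & d v = 2 * d u)%R ->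
  forall u, P u -> d u = 0%R.
Proof.
move=> dM d2 x Px; apply: (@bounded_multiples_eq0 _ M) => n.
have [y Py dy] : exists2 y, P y & d y = ((2 ^+ n)%R * d x)%R.
  elim: n => [|n [y Py dy]]; first by exists x => //; rewrite expr0 mul1r.
  by have [z Pz dz] := d2 _ Py; exists z => //; rewrite dz dy exprS mulrA.
apply: le_trans (dM _ Py); rewrite dy !normrM ler_wpM2r//.
rewrite !ger0_norm ?exprn_ge0//.
by rewrite -natrX ler_nat ltnW// ltn_expl.
Qed.

Lemma bounded_hom_eq0 H f (M : R) : subgroup H -> hom_on H f ->
  (forall x, H x -> `|f x| <= M)%R -> forall x, H x -> f x = 0%R.
Proof.
move=> sH hf fM x Hx; apply: (@bounded_multiples_eq0 _ M) => n.
by rewrite -(hom_onX n sH hf Hx); apply: (fM); exact: subgroupX.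
Qed.

(* A bounded polynomial in [m] is constant: apply this to [f (h ^ (x ^+ m))]. *)
Lemma conj_invariant H f x : nilpotent_group G -> subgroup H -> hom_on H f ->
  (forall h, H h -> H (h ^ x)) ->
  (forall h, H h -> exists M, forall m, `|f (h ^ (x ^+ m))%g| <= M)%R ->
  forall h, H h -> f (h ^ x) = f h.
Proof.
move=> [c Zc] sH hf Hx fM h Hh; have [H1 HM HV] := sH.
have HX m y : H y -> H (y ^ (x ^+ m)).
  by elim: m y => [|m IH] y Hy; rewrite ?expg0 ?conjg1// expgSr conjgM; exact/Hx/IH.
have : upper_central c h by rewrite Zc.
elim: c {Zc} h Hh => [|c IH] h Hh; first by move=> /= ->; rewrite conj1g.
move=> Zh; pose h' := [~ h, x].
have Hh' : H h' by apply: (HM); [exact: HV|exact: Hx].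
have fh' m : f (h' ^ (x ^+ m)) = f h'.
  elim: m => [|m IHm]; first by rewrite expg0 conjg1.
  rewrite expgSr conjgM IH//; first exact: HX.
  by apply: upper_centralJ; exact: Zh.
have fh m : f (h ^ (x ^+ m)) = (f h + m%:R * f h')%R.
  elim: m => [|m IHm]; first by rewrite expg0 conjg1 mul0r addr0.
  have -> : h ^ (x ^+ m.+1) = h ^ (x ^+ m) * h' ^ (x ^+ m).
    by rewrite -conjMg expgS conjgM /h' /commg mulVKg.
  by rewrite hf ?IHm ?fh' -?natr1; [lra|exact: HX|exact: HX].
have [M fhM] := fM _ Hh.
have f0 : f h' = 0%R.
  apply: (@bounded_multiples_eq0 _ (M + `|f h|)%R) => m.
  rewrite (_ : m%:R * f h' = f (h ^ (x ^+ m))%g - f h)%R; last by rewrite fh; lra.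
  by rewrite (le_trans (ler_normB _ _))// lerD2r.
by have := fh 1%N; rewrite expg1 f0 mulr0 addr0.
Qed.


(** Writing [x ^+ m] as [k * d] with [k] in [K] and [d] in [D] removes [d] and keeps
    [f (h ^ (x ^+ m))] bounded in [m], as [conj_invariant] requires. *)
Lemma cobounded_invariant bdd H H' D K f : nilpotent_group G ->
  bornology bdd -> subgroup H -> subgroup H' -> normalized H H' ->
  subgroup D -> D `<=` H' -> bdd K ->
  (forall x, H' x -> exists2 d, D d & K (x / d)) ->
  hom_on H f ->
  locally_bounded bdd H f ->
  (forall h d, H h -> D d -> f (h ^ d) = f h) ->
  forall h x, H h -> H' x -> f (h ^ x) = f h.
Proof.
move=> nG [bS b1 bV bM] sH sH' nH sD DH' bK KD hf bf fD h x Hh H'x.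
have [_ H'M H'V] := sH'.
apply: (conj_invariant nG sH hf) => // [y Hy|y Hy]; first exact: nH.
have [|M fM] := bf [set u * v | u in [set u^-1 | u in K] & v in
    [set u * v | u in [set y] & v in K]].
  by apply: (bM); [exact: bV|exact: bM].
exists M => m; have H'xm : H' (x ^+ m) by exact: subgroupX.
have [d Dd Kd] := KD _ H'xm.
have H'd : H' (x ^+ m / d) by apply: (H'M) => //; apply: (H'V); exact: DH'.
rewrite (_ : x ^+ m = (x ^+ m / d) * d); last by rewrite mulgVK.
rewrite conjgM fD//; last exact: nH.
apply: (fM); first exact: nH.
exists (x ^+ m / d)^-1; first by exists (x ^+ m / d).
by exists (y * (x ^+ m / d)) => //; exists y => //; exists (x ^+ m / d).
Qed.

(** The homomorphism is the limit of [q (x ^+ (2 ^ n)) / 2 ^+ n]. By construction it doubles under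
    squaring, and every further identity reduces to the vanishing of a bounded defect that
    doubles. *)
Lemma homogenize H C q (M : R) : subgroup H -> C `<=` H ->
  (forall x y, C x -> C y -> C (x * y)) -> normalized C H ->
  (forall x y, H x -> H y -> C [~ x, y]) ->
  (forall x y, H x -> H y -> `|q (x * y)%g - q x - q y| <= M)%R ->
  (forall c, C c -> `|q c| <= M)%R ->
  exists2 l : G -> R, hom_on H l & forall x, H x -> (`|l x - q x| <= M)%R.
Proof.
move=> sH CH CM nC cC qM qC; have [H1 HM HV] := sH.
have M0 : (0 <= M)%R by apply: le_trans (qM _ _ H1 H1).
have HX n x : H x -> H (x ^+ n) by exact: subgroupX.
pose a x n := (q (x ^+ (2 ^ n)%N)%g / 2 ^+ n)%R.
have p2 n : (0 < 2 ^+ n :> R)%R by rewrite exprn_gt0.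
have aS x n : H x -> (`|a x n.+1 - a x n| <= M / 2 ^+ n.+1)%R.
  move=> Hx; rewrite /a exprS expnS mul2n -addnn expgnDr.
  have := qM _ _ (HX (2 ^ n)%N _ Hx) (HX (2 ^ n)%N _ Hx).
  set u := q (_ * _); set v := q _ => uv.
  rewrite (_ : _ - _ = (u - v - v) / (2 * 2 ^+ n))%R; last first.
    by field; rewrite gt_eqF.
  rewrite normrM normfV [X in (_ / X)%R]gtr0_norm ?mulr_gt0//.
  by rewrite ler_wpM2r// invr_ge0 mulr_ge0// ltW.
(* The sequence [a x n - M / 2 ^+ n] increases and [a x n + M / 2 ^+ n] decreases, so the supremum
   of the first is the limit and comes with an explicit error. *)
pose b x n := (a x n - M / 2 ^+ n)%R.
have eM n : (M / 2 ^+ n.+1 = (M / 2 ^+ n) / 2)%R.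
  by rewrite exprS; field; rewrite gt_eqF.
have bS x n : H x -> (b x n <= b x n.+1)%R.
  by move=> Hx; have := aS x n Hx; rewrite /b eM ler_norml => /andP[]; lra.
have cS x n : H x -> (a x n.+1 + M / 2 ^+ n.+1 <= a x n + M / 2 ^+ n)%R.
  by move=> Hx; have := aS x n Hx; rewrite eM ler_norml => /andP[]; lra.
have b_le x m n : H x -> (b x m <= a x n + M / 2 ^+ n)%R.
  move=> Hx; have bmono i j : (b x i <= b x (i + j)%N)%R.
    by elim: j => [|j IH]; rewrite ?addn0// addnS (le_trans IH)// bS.
  have cmono i j : (a x (i + j)%N + M / 2 ^+ (i + j) <= a x i + M / 2 ^+ i)%R.
    by elim: j => [|j IH]; rewrite ?addn0// addnS (le_trans _ IH)// cS.
  apply: le_trans (bmono m n) _; apply: le_trans (cmono n m).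
  rewrite addnC /b; have : (0 <= M / 2 ^+ (n + m))%R by rewrite divr_ge0// ltW.
  by lra.
pose l x := sup [set b x n | n in [set: nat]].
have la x n : H x -> (`|l x - a x n| <= M / 2 ^+ n)%R.
  move=> Hx; have hs : has_sup [set b x n | n in [set: nat]].
    split; first by exists (b x 0%N), 0%N.
    by exists (a x 0%N + M / 2 ^+ 0)%R => _ [m _ <-]; exact: b_le.
  have l1 : (b x n <= l x)%R by apply: ub_le_sup; [case: hs|exists n].
  have l2 : (l x <= a x n + M / 2 ^+ n)%R.
    by apply: ge_sup; [case: hs|move=> _ [m _ <-]; exact: b_le].
  by rewrite ler_norml; move: l1; rewrite /b; lra.
have lq x : H x -> (`|l x - q x| <= M)%R.
  by move=> Hx; have := la x 0%N Hx; rewrite /a expn0 expg1 expr0 !divr1.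
have small (u : R) : (forall n, `|u| <= M / 2 ^+ n * 4)%R -> u = 0%R.
  move=> hu; apply: (@halving_eq0 _ (fun v => exists n, v = 2 ^+ n * u)%R id (M * 4)%R).
  - move=> _ [n ->] /=; rewrite normrM (ger0_norm (ltW (p2 n))).
    by have := hu n; rewrite mulrAC ler_pdivlMr// mulrC.
  - by move=> _ [n ->] /=; exists (2 ^+ n.+1 * u)%R; [exists n.+1|rewrite exprS mulrA].
  - by exists 0%N; rewrite expr0 mul1r.
have l2 x : H x -> l (x * x) = (2 * l x)%R.
  move=> Hx; apply/eqP; rewrite -subr_eq0; apply/eqP; apply: small => n.
  have aE : a (x * x)%g n = (2 * a x n.+1)%R.
    rewrite /a -[x * x]/(x ^+ 2) -expgnA -expnS exprS.
    by field; rewrite gt_eqF.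
  have := la (x * x) n (HM _ _ Hx Hx); have := la x n.+1 Hx.
  rewrite aE eM !ler_norml => /andP[? ?] /andP[? ?].
  have : (0 <= M / 2 ^+ n)%R by rewrite divr_ge0// ltW.
  by move=> ?; apply/andP; split; lra.
(* Squaring replaces [(x, e)] by [(x * x, e ^ x * e)], whose second entry is again in [C], and
   doubles the defect. *)
have lC z c : H z -> C c -> l (z * c) = l z.
  move=> Hz Cc; apply/eqP; rewrite -subr_eq0; apply/eqP.
  pose d (u : G * G) := (l (u.1 * u.2)%g - l u.1)%R.
  apply: (@halving_eq0 _ (fun u : G * G => H u.1 /\ C u.2) d (4 * M)%R _ _ (z, c)) => //.
    move=> [x e] /= [Hx Ce]; have He := CH _ Ce.
    rewrite /d/=; have := lq _ (HM _ _ Hx He); have := lq _ Hx; have := qC _ Ce.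
    have := qM _ _ Hx He; rewrite !ler_norml.
    by move=> /andP[? ?] /andP[? ?] /andP[? ?] /andP[? ?]; apply/andP; split; lra.
  move=> [x e] /= [Hx Ce]; have He := CH _ Ce.
  exists (x * x, e ^ x * e) => /=.
    by split; [exact: HM|apply: (CM) => //; exact: nC].
  rewrite /d/= (_ : x * x * (e ^ x * e) = (x * e) * (x * e)).
    by rewrite !l2//; [lra|exact: HM].
  by rewrite /conjg !gnorm.
exists l => // x y Hx Hy.
apply/eqP; rewrite -subr_eq0 opprD addrA; apply/eqP.
pose d (u : G * G) := (l (u.1 * u.2)%g - l u.1 - l u.2)%R.
apply: (@halving_eq0 _ (fun u : G * G => H u.1 /\ H u.2) d (4 * M)%R _ _ (x, y)) => //.
  move=> [u v] /= [Hu Hv]; rewrite /d/=.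
  have := lq _ (HM _ _ Hu Hv); have := lq _ Hu; have := lq _ Hv.
  have := qM _ _ Hu Hv; rewrite !ler_norml.
  by move=> /andP[? ?] /andP[? ?] /andP[? ?] /andP[? ?]; apply/andP; split; lra.
(* The square of [u * v] differs from [u * u * (v * v)] by a conjugate of a commutator, which lies
   in [C] and is invisible to [l]. *)
move=> [u v] /= [Hu Hv]; exists (u * u, v * v) => /=; first by split; exact: HM.
rewrite /d /= !l2//; have -> : l (u * u * (v * v)) = (2 * l (u * v)%g)%R.
  rewrite -l2; last exact: HM.
  rewrite (_ : u * v * (u * v) = u * u * (v * v) * [~ v, u] ^ v).
    rewrite (lC (u * u * (v * v)))//; first by apply: (HM); exact: (HM).
    by apply: nC => //; exact: cC.
  by rewrite /commg /conjg !gnorm.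
by lra.
Qed.


(** The quasi-homomorphism to homogenize is [f (dd x)], with [dd x] in [D] close to [x]. On [H] the
    result differs from [f] by a bounded homomorphism, that is by zero. *)
Lemma extend_hom_step bdd H H' D K f : nilpotent_group G ->
  bornology bdd -> subgroup H -> subgroup H' -> H `<=` H' ->
  (forall x y, H' x -> H' y -> H [~ x, y]) ->
  subgroup D -> D `<=` H -> bdd K ->
  (forall x, H' x -> exists2 d, D d & K (x / d)) ->
  hom_on H f ->
  locally_bounded bdd H f ->
  exists t, [/\ hom_on H' t,
    locally_bounded bdd H' t &
    forall x, H x -> t x = f x].
Proof.
move=> nG bb sH sH' HH' cH sD DH bK KD hf bf; have [bS b1 bV bM] := bb.
have [H1 HM HV] := sH; have [H'1 H'M H'V] := sH'; have [D1 DM DV] := sD.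
have DH' x : D x -> H' x by move=> /DH /HH'.
have nH : normalized H H'.
  move=> x y Hx H'y; rewrite (_ : x ^ y = x * [~ x, y]); last by rewrite /commg mulVKg.
  by apply: (HM) => //; apply: cH => //; exact: HH'.
have fJ h x : H h -> H' x -> f (h ^ x) = f h.
  move=> Hh H'x.
  apply: (cobounded_invariant nG bb sH sH' nH sD DH' bK KD hf bf) => //.
  by move=> y d Hy Dd; apply: (hom_onJ sH hf) => //; exact: DH.
have f1 := hom_on1 sH hf.
have fVm h x : H h -> H' x -> f [~ h, x] = 0%R.
  move=> Hh H'x; rewrite /commg hf ?fJ ?(hom_onV sH hf)//; first by lra.
    exact: HV.
  exact: nH.
(* The map [[~ x ^+ m, y] |-> f] is linear in [m], yet bounded because [x ^+ m] is bounded modulo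
   [D]. *)
have fR x y : H' x -> H' y -> f [~ x, y] = 0%R.
  move=> H'x H'y; have [|M fM] := bf [set u * v | u in [set u * v |
      u in [set u^-1 | u in K] & v in [set y^-1]] & v in [set u * v | u in K & v in [set y]]].
    by apply: (bM); apply: (bM) => //; exact: bV.
  apply: (@bounded_multiples_eq0 _ M) => m.
  have fX n z : H' z -> f [~ z ^+ n, y] = (n%:R * f [~ z, y])%R.
    move=> H'z; elim: n => [|n IH]; first by rewrite expg0 comm1g f1 mul0r.
    have -> : [~ z ^+ n.+1, y] = [~ z, y] ^ (z ^+ n) * [~ z ^+ n, y].
      by rewrite expgS /commg /conjg !gnorm.
    have H'zn : H' (z ^+ n) by exact: subgroupX.
    rewrite hf; [|by apply: nH => //; exact: cH|exact: cH].
    by rewrite fJ// ?IH -?natr1; [lra|exact: cH].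
  rewrite -fX//; have H'xm : H' (x ^+ m) by exact: subgroupX.
  have [d Dd Kd] := KD _ H'xm; set k := x ^+ m / d in Kd.
  have H'k : H' k by apply: (H'M) => //; apply: (H'V); exact: DH'.
  have -> : [~ x ^+ m, y] = [~ k, y] ^ d * [~ d, y].
    by rewrite /k /commg /conjg !gnorm.
  rewrite hf; [|by apply: nH; [exact: cH|exact: DH']|by apply: cH => //; exact: DH'].
  rewrite fVm ?addr0//; last exact: DH.
  rewrite fJ; [|exact: cH|exact: DH']; apply: fM; first exact: cH.
  exists (k^-1 * y^-1); first by exists k^-1; [exists k|exists y^-1].
  by exists (k * y); [exists k => //; exists y|rewrite /commg /conjg !gnorm].
pose dd x := if pselect (exists2 d, D d & K (x / d)) is left e
  then projT1 (cid2 e) else 1.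
have ddP x : H' x -> D (dd x) /\ K (x / dd x).
  rewrite /dd => /KD KDx; case: pselect => // e; by case: cid2.
pose C : set G := [set c | H c /\ f c = 0%R].
have [|M1 fM1] := bf [set u * v | u in [set u^-1 | u in K] & v in
    [set u * v | u in K & v in K]].
  by apply: (bM); [exact: bV|exact: bM].
have [M2 fM2] := bf _ bK.
have qf h : H h -> (`|f (dd h) - f h| <= M2)%R.
  move=> Hh; have [Dd Kd] := ddP _ (HH' _ Hh); have Hd := DH _ Dd.
  have Hk : H (h / dd h) by apply: (HM) => //; exact: HV.
  have -> : f h = (f (h / dd h)%g + f (dd h))%R by rewrite -hf// mulgVK.
  by rewrite opprD addrCA subrr addr0 normrN; exact: fM2.
pose M := Num.max M1 M2.
have [|||||| t ht tM] := @homogenize H' C (f \o dd) M sH'.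
- by move=> x [/HH'].
- move=> x y [Hx fx] [Hy fy]; split; first exact: HM.
  by rewrite hf// fx fy addr0.
- by move=> x y [Hx fx] H'y; split; [exact: nH|rewrite fJ].
- by move=> x y H'x H'y; split; [exact: cH|exact: fR].
- move=> x y H'x H'y /=.
  have [Dx Kx] := ddP _ H'x; have [Dy Ky] := ddP _ H'y.
  have [Dxy Kxy] := ddP _ (H'M _ _ H'x H'y).
  set a := dd x in Dx Kx *; set b := dd y in Dy Ky *; set c := dd _ in Dxy Kxy *.
  have Ha := DH _ Dx; have Hb := DH _ Dy; have Hc := DH _ Dxy.
  pose k := y / b.
  have H'k : H' k by apply: (H'M) => //; apply: (H'V); exact: DH'.
  (* This element is built from three points of [K], hence bounded, and its [f]-value is the
     additivity defect of [f (dd x)]. *)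
  pose g := (x * y / c)^-1 * ((x / a) * (y / b)).
  have gE : g = c * b^-1 * (a^-1 ^ k).
    by rewrite /g /k /conjg !gnorm.
  have Haak : H (a^-1 ^ k) by apply: nH => //; exact: HV.
  have Hg : H g by rewrite gE; apply: (HM) => //; apply: (HM) => //; exact: HV.
  have fg : f g = (f c - f b - f a)%R.
    have Hb' : H b^-1 by exact: HV.
    have Ha' : H a^-1 by exact: HV.
    have Hcb : H (c * b^-1) by exact: HM.
    by rewrite gE (hf _ _ Hcb Haak) (hf _ _ Hc Hb') fJ// !(hom_onV sH hf).
  have : (`|f g| <= M1)%R.
    apply: fM1 => //; exists (x * y / c)^-1; first by exists (x * y / c).
    by exists ((x / a) * (y / b)) => //; exists (x / a) => //; exists (y / b).
  rewrite fg (_ : f c - f b - f a = f c - f a - f b)%R; last by lra.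
  by move=> /le_trans; apply; rewrite le_max lexx.
- move=> c [Hc fc] /=; have := qf _ Hc; rewrite fc subr0 => /le_trans; apply.
  by rewrite le_max lexx orbT.
- have tf x : H x -> t x = f x.
    move=> Hx; apply/eqP; rewrite -subr_eq0; apply/eqP.
    apply: (@bounded_hom_eq0 H (fun x => t x - f x)%R (M + M2)%R) => //.
      move=> u v Hu Hv; rewrite hf// ht; [lra|exact: HH'|exact: HH'].
    move=> u Hu; have := tM _ (HH' _ Hu); have := qf _ Hu => /=.
    by rewrite !ler_norml => /andP[? ?] /andP[? ?]; apply/andP; split; lra.
  exists t; split => // A bA.
  have [|M3 fM3] := bf [set u * v | u in [set u^-1 | u in K] & v in A].
    by apply: (bM) => //; exact: bV.
  exists (M + M3)%R => x H'x Ax; have [Dx Kx] := ddP _ H'x.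
  have := tM _ H'x => /=.
  have : (`|f (dd x)| <= M3)%R.
    apply: fM3; first exact: DH.
    exists (x / dd x)^-1; first by exists (x / dd x).
    by exists x => //; rewrite invgM invgK mulgVK.
  rewrite !ler_norml => /andP[? ?] /andP[? ?]; apply/andP; split; lra.
Qed.

(** The extension climbs through the groups [H i], the products of [D] with the upper central
    subgroups of [G] cut by [B]; commutators of [H i.+1] fall into [H i]. *)
Lemma extend_hom bdd B D K f : nilpotent_group G ->
  bornology bdd -> subgroup B -> subgroup D -> D `<=` B -> bdd K ->
  (forall x, B x -> exists2 d, D d & K (x / d)) ->
  hom_on D f ->
  locally_bounded bdd D f ->
  exists t, [/\ hom_on B t,
    locally_bounded bdd B t &
    forall x, D x -> t x = f x].
Proof.
move=> nG bb sB sD DB bK KD hf bf; have [c Zc] := nG.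
have [B1 BM BV] := sB; have [D1 DM DV] := sD.
pose H i := [set x | exists2 d, D d & (upper_central i `&` B) (x / d)].
have ZB i : subgroup (upper_central i `&` B).
  by apply: subgroupI => //; exact: upper_central_subgroup.
have ZJ i x y : (upper_central i `&` B) x -> B y -> (upper_central i `&` B) (x ^ y).
  move=> [Zx Bx] By; split; first exact: upper_centralJ.
  by apply: (BM); [exact: BV|exact: BM].
have HB i : H i `<=` B.
  by move=> x [d /DB Bd [_ Bx]]; rewrite -[x](mulgVK d); exact: BM.
have sH i : subgroup (H i).
  have [Z1 ZM ZV] := ZB i; split.
  - by exists 1 => //; rewrite divg1.
  - move=> x y [d Dd Zx] [e De Zy]; exists (d * e); first exact: DM.
    have -> : x * y / (d * e) = (x / d) * ((y / e) ^ d^-1).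
      by rewrite /conjg !gnorm.
    by apply: (ZM) => //; apply: ZJ => //; apply: BV; exact: DB.
  - move=> x [d Dd Zx]; exists d^-1; first exact: DV.
    have -> : x^-1 / d^-1 = ((x / d)^-1) ^ d by rewrite /conjg !gnorm.
    by apply: ZJ; [exact: ZV|exact: DB].
have DH i : D `<=` H i.
  by move=> d Dd; exists d; rewrite ?mulgV//; case: (ZB i).
have HZ i x : (upper_central i `&` B) x -> H i x.
  by move=> Zx; exists 1 => //; rewrite divg1.
have [t [ht bt tf]] : exists t, [/\ hom_on (H c) t,
    locally_bounded bdd (H c) t &
    forall x, D x -> t x = f x].
  elim: c {Zc} => [|i [t [ht bt tf]]].
    have H0 x : H 0 x -> D x.
      by move=> [d Dd [/= e _]]; rewrite -[x](mulgVK d) e mul1g.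
    exists f; split => // [x y /H0 Dx /H0 Dy|A bA]; first exact: hf.
    by have [M fM] := bf _ bA; exists M => x /H0; exact: fM.
  have HS : H i `<=` H i.+1.
    move=> x [d Dd [Zx Bx]]; exists d => //; split=> // y.
    have [_ ZM ZV] := upper_central_subgroup G i.
    by apply: (ZM); [exact: ZV|exact: upper_centralJ].
  have Hc x y : H i.+1 x -> H i.+1 y -> H i [~ x, y].
    move=> [d Dd [Zx Bx]] [e De [Zy By]].
    set x' := x / d in Zx Bx; set y' := y / e in Zy By.
    have [Z1 ZM ZV] := ZB i; have [_ HM HV] := sH i.
    have -> : x = x' * d by rewrite /x' mulgVK.
    have -> : y = y' * e by rewrite /y' mulgVK.
    have -> : [~ x' * d, y' * e] = [~ x', y' * e] ^ d * ([~ d, e] * [~ d, y'] ^ e).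
      by rewrite /commg /conjg !gnorm.
    have Bd := DB _ Dd; have Be := DB _ De.
    apply: (HM).
      apply: HZ; apply: ZJ => //; split; first exact: Zx.
      by apply: subgroupR => //; exact: BM.
    apply: (HM); first by apply: DH; exact: subgroupR.
    apply: HZ; apply: ZJ => //; split; first exact: upper_centralRr.
    exact: subgroupR.
  have KDH x : H i.+1 x -> exists2 d, D d & K (x / d) by move=> /HB /KD.
  have [s [hs bs sf]] :=
    extend_hom_step nG bb (sH i) (sH i.+1) HS Hc sD (@DH i) bK KDH ht bt.
  by exists s; split=> // x Dx; rewrite sf ?tf//; exact: DH.
have BH x : B x -> H c x by move=> Bx; apply: HZ; rewrite Zc.
exists t; split=> // [x y /BH Hx /BH Hy|A bA]; first exact: ht.
by have [M tM] := bt _ bA; exists M => x /BH; exact: tM.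
Qed.

End BoundedHomomorphisms.

(** * Topological groups *)

(** Compactness is applied to the filter of large sets with property [P]: some such set contains
    every point of [K]. *)
Lemma compact_induction (T : topologicalType) (K : set T) (P : set T -> Prop) :
  compact K -> P set0 -> (forall A B, A `<=` B -> P B -> P A) ->
  (forall A B, P A -> P B -> P (A `|` B)) ->
  (forall x, K x -> exists2 U, nbhs x U & P U) -> P K.
Proof.
move=> /compact_near_coveringP cK P0 PS PU PK.
pose F : set_system (set T) :=
  filter_from P (fun A0 => [set A | P A /\ A0 `<=` A]).
have FF : Filter F.
  apply: filter_from_filter; first by exists set0.
  move=> A B PA PB; exists (A `|` B); first exact: PU.
  by move=> C [PC ABC]; split; split=> // x ?; apply: ABC; [left|right].
suff [A PA AK] : F (fun A => K `<=` A).
  by apply: (PS _ A) => //; apply: AK; split.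
apply: (cK _ F (fun A x => A x)) => x Kx.
have [U xU PU0] := PK _ Kx; exists (U, [set A | P A /\ U `<=` A]) => /=.
  by split => //; exists U.
by move=> [y A] /= [Uy [_ UA]]; exact: UA.
Qed.

Section TopologicalGroups.
Variable N : TopologicalGroup.type.
Local Open Scope group_scope.
Implicit Types (A B D K U V W : set N) (x y z : N).

Definition in_compact A := exists2 K, compact K & A `<=` K.

Lemma in_compact_bornology : bornology in_compact.
Proof.
split.
- by move=> A B AB [K cK BK]; exists K => //; exact: subset_trans BK.
- by move=> x; exists [set x] => //; exact: compact_set1.
- move=> A [K cK AK]; exists [set x^-1 | x in K].
    apply: continuous_compact => //; apply: continuous_subspaceT.
    exact: continuous_invg.
  by move=> _ [x /AK Kx <-]; exists x.
- move=> A B [K cK AK] [L cL BL].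
  exists [set p.1 * p.2 | p in K `*` L].
    apply: continuous_compact; last exact: compact_setX.
    by apply: continuous_subspaceT; exact: continuous_mulg.
  by move=> _ [x /AK Kx [y /BL Ly <-]]; exists (x, y).
Qed.

Lemma finite_in_compact A : finite_set A -> in_compact A.
Proof. by move=> /finite_compact cA; exists A. Qed.

Lemma nbhs_mulg x y W : nbhs (x * y) W ->
  exists2 U, nbhs x U & exists2 V, nbhs y V &
    forall u v, U u -> V v -> W (u * v).
Proof.
move=> /(@continuous_mulg N (x, y))[[U V] /= [Ux Vy] UVW].
by exists U => //; exists V => // u v Uu Vv; exact: (UVW (u, v)).
Qed.

Lemma nbhs_invg x W : nbhs x^-1 W -> nbhs x [set y | W y^-1].
Proof. by move=> /(@continuous_invg N x). Qed.

Lemma cvg_mulg (T : Type) (F : set_system T) (FF : Filter F) (f g : T -> N) x y :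
  f @ F --> x -> g @ F --> y -> (fun t => f t * g t) @ F --> x * y.
Proof.
move=> fx gy; apply: (@cvg_comp _ _ _ (fun t => (f t, g t)) (fun p => p.1 * p.2) _
  (nbhs (x, y))); first exact: cvg_pair fx gy.
exact: (@continuous_mulg N (x, y)).
Qed.

Lemma cvg_invg (T : Type) (F : set_system T) (FF : Filter F) (f : T -> N) x :
  f @ F --> x -> (fun t => (f t)^-1) @ F --> x^-1.
Proof. by move=> fx; apply: cvg_comp fx _; exact: (@continuous_invg N x). Qed.

Lemma continuous_fmul (T : topologicalType) (f g : T -> N) :
  continuous f -> continuous g -> continuous (fun t => f t * g t).
Proof. by move=> cf cg t; apply: cvg_mulg; [exact: cf|exact: cg]. Qed.

Lemma continuous_finv (T : topologicalType) (f : T -> N) :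
  continuous f -> continuous (fun t => (f t)^-1).
Proof. by move=> cf t; apply: cvg_invg; exact: cf. Qed.

Lemma nbhs_translate x U : nbhs 1 U <-> nbhs x [set y | U (x^-1 * y)].
Proof.
split=> [U1|].
  have c : (fun y => x^-1 * y) @ x --> x^-1 * x.
    by apply: cvg_mulg; [exact: cvg_cst|exact: cvg_id].
  by have /c : nbhs (x^-1 * x) U by rewrite mulVg.
move=> Ux.
have c : (fun y => x * y) @ (1 : N) --> x * 1.
  by apply: cvg_mulg; [exact: cvg_cst|exact: cvg_id].
have /c h : nbhs (x * 1) [set y | U (x^-1 * y)] by rewrite mulg1.
by apply: (@filterS _ (nbhs 1) _ _ _ _ h) => y /=; rewrite mulKg.
Qed.

Lemma open_translate x U : open U -> open [set x * u | u in U].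
Proof.
move=> oU; rewrite openE => _ [u Uu <-]; rewrite /interior.
have c : (fun y => x^-1 * y) @ (x * u) --> x^-1 * (x * u).
  by apply: cvg_mulg; [exact: cvg_cst|exact: cvg_id].
have /c h : nbhs (x^-1 * (x * u)) U by rewrite mulKg; exact: open_nbhs_nbhs.
by apply: (@filterS _ (nbhs (x * u)) _ _ _ _ h) => y /= Uy; exists (x^-1 * y) => //; rewrite mulVKg.
Qed.

Lemma open_translater x U : open U -> open [set u * x | u in U].
Proof.
move=> oU; rewrite openE => _ [u Uu <-]; rewrite /interior.
have c : (fun y => y * x^-1) @ (u * x) --> u * x * x^-1.
  by apply: cvg_mulg; [exact: cvg_id|exact: cvg_cst].
have /c h : nbhs (u * x * x^-1) U by rewrite mulgK; exact: open_nbhs_nbhs.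
by apply: (@filterS _ (nbhs (u * x)) _ _ _ _ h) => y /= Uy; exists (y * x^-1) => //; rewrite mulgVK.
Qed.

Lemma nbhs_divide U : nbhs 1 U -> exists2 V, open_nbhs 1 V &
  forall x y, V x -> V y -> U (x^-1 * y).
Proof.
move=> U1; have := @nbhs_mulg 1^-1 1 U; rewrite invg1 mul1g => /(_ U1).
move=> [A A1 [B B1 ABU]].
have A1' : nbhs 1 [set x | A x^-1] by apply: nbhs_invg; rewrite invg1.
have : nbhs 1 ([set x | A x^-1] `&` B) by exact: filterI.
rewrite nbhsE /= => -[V oV VAB].
exists V => // x y /VAB Vx /VAB Vy; case: Vx => Ax _; case: Vy => _ By.
exact: ABU.
Qed.

Section Discrete.
Variable D : set N.
Hypotheses (sD : subgroup D) (iD : D `<=` isolated D).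

Lemma discrete_nbhs : exists2 U, open_nbhs 1 U &
  forall d, D d -> U d -> d = 1.
Proof.
have [D1 _ _] := sD; have [_ [V V1 VD]] := iD D1.
move: V1; rewrite nbhsE /= => -[U oU UV]; exists U => // d Dd Ud.
have : (V `&` D) d by split => //; exact: UV.
by rewrite VD.
Qed.

(** Each point has a neighbourhood, a translate of a small [V], with at most one element of [D]: two
    of them would differ by a nontrivial element of [D] near 1. *)
Lemma discrete_bounded_finite A : in_compact A -> finite_set (D `&` A).
Proof.
have [D1 DM DV] := sD; have [U0 oU0 U0D] := discrete_nbhs.
have [V oV VU] := nbhs_divide (open_nbhs_nbhs oU0).
move=> [K cK AK].
apply: (@sub_finite_set _ _ (D `&` K)); first exact: setIS.
apply: (@compact_induction _ K (fun B => finite_set (D `&` B)) cK).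
- by rewrite setI0.
- by move=> B C BC; apply: sub_finite_set; exact: setIS.
- by move=> B C fB fC; rewrite setIUr finite_setU.
move=> x _; exists [set y | V (x^-1 * y)].
  by apply/nbhs_translate; exact: open_nbhs_nbhs.
have [[d [Dd Vd]]|nD] := pselect (exists d, (D `&` [set y | V (x^-1 * y)]) d).
  apply: (@sub_finite_set _ _ [set d]); last exact: finite_set1.
  move=> e [De Ve] /=; suff : d^-1 * e = 1 by move=> /mulg1_eq; rewrite invgK.
  apply: U0D; first by apply: DM => //; exact: DV.
  by have := VU _ _ Vd Ve; rewrite !gnorm.
apply: (@sub_finite_set _ _ set0); last exact: finite_set0.
by move=> e De; apply: nD; exists e.
Qed.

(* The elements [d] of [D] with [d K] meeting a compact neighbourhood of [K]
   generate an open, hence full, subgroup. *)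
Lemma connected_cocompact_fg U K : connected [set: N] -> nbhs 1 U -> in_compact U ->
  in_compact K -> (forall x, exists2 d, D d & K (x / d)) ->
  exists s : seq N, D = gen [set` s].
Proof.
move=> cN nU bU bK KD; have [D1 DM DV] := sD.
have [bS b1 bV bM] := in_compact_bornology.
pose A := [set x * y | x in [set x^-1 | x in K] & y in [set u * v | u in U & v in K]].
have /finite_seqP[s sE] : finite_set ((D `&` A) `|` (D `&` K)).
  rewrite finite_setU; split; apply: discrete_bounded_finite => //.
  by apply: (bM); [exact: bV|exact: bM].
exists s; set H := gen [set` s].
have sH : subgroup H by exact: gen_subgroup.
have [H1 HM HV] := sH.
have HD : H `<=` D by apply: gen_sub => //; rewrite -sE => x [[]|[]].
pose KH := [set x | exists2 d, H d & K (x / d)].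
have UKH u x : U u -> KH x -> KH (u * x).
  move=> Uu [h Hh Kxh]; have [d Dd Kd] := KD (u * x).
  exists d => //; rewrite -[d](mulgVK h); apply: (HM) => //.
  apply: gen_mem; rewrite -sE; left; split; first by apply: DM => //; apply: DV; exact: HD.
  exists (u * x / d)^-1; first by exists (u * x / d).
  exists (u * (x / h)); first by exists u => //; exists (x / h).
  by rewrite !gnorm.
(* The condition on [u^-1] lets the same argument show that the complement of [KH] is open. *)
have oKH (P : set N) : (forall u x, U u -> U u^-1 -> P x -> P (u * x)) -> open P.
  move=> UP; rewrite openE => x Px; rewrite /interior.
  have c : (fun y => y / x) @ x --> x / x.
    by apply: cvg_mulg; [exact: cvg_id|exact: cvg_cst].
  have nU' : nbhs (x / x) [set u | U u /\ U u^-1].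
    by rewrite mulgV; apply: filterI => //; apply: nbhs_invg; rewrite invg1.
  apply: (@filterS _ (nbhs x) _ _ _ _ (c _ nU')) => y [Uy Uy']; rewrite -[y](mulgVK x); exact: UP.
have KHT : KH = [set: N].
  apply: cN; rewrite ?setTI.
  - have [d Dd Kd] := KD 1; exists (1 / d), 1 => //; by rewrite divg1.
  - exists KH; rewrite ?setTI//; apply: oKH => u x Uu _; exact: UKH.
  - exists KH; rewrite ?setTI// -[KH]setCK; apply: open_closedC.
    apply: oKH => u x _ Uu nx Kux; apply: nx.
    by rewrite -[x](mulKg u); exact: UKH.
apply/seteqP; split => // d Dd.
have : KH d by rewrite KHT.
move=> [h Hh Kdh]; rewrite -[d](mulgVK h); apply: (HM) => //.
apply: gen_mem; rewrite -sE; right; split => //; apply: DM => //.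
by apply: DV; exact: HD.
Qed.

End Discrete.
End TopologicalGroups.

(** * Sections of homomorphisms to the line *)

Section Sections.
Variables (R : realType) (N : TopologicalGroup.type).
Local Open Scope group_scope.
Implicit Types (B D U V W : set N) (x y z : N) (t : N -> R).

Definition small_near1 B t := forall e : R, (0 < e)%R ->
  \forall x \near (1 : N), B x -> (`|t x| < e)%R.

Lemma continuous_natexp n : continuous (fun x : N => x ^+ n).
Proof.
elim: n => [|n IH].
  by under eq_fun do rewrite expg0; exact: cst_continuous.
under eq_fun do rewrite expgS; apply: continuous_fmul => // x; exact: cvg_id.
Qed.

(** If [x] is so close to 1 that [x ^+ n] is still in [U], then [n] times [t x] is bounded by
    [M]. *)
Lemma locally_bounded_small B U t : subgroup B -> hom_on B t ->
  nbhs 1 U -> in_compact U -> locally_bounded (@in_compact N) B t ->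
  small_near1 B t.
Proof.
move=> sB ht nU bU bt e e0; have [M tM] := bt _ bU.
pose n := (Num.truncn (M / e)).+1.
have Mn : (M < n%:R * e)%R by rewrite -ltr_pdivrMr// truncnS_gt.
have /(@continuous_natexp n 1) h : nbhs (1 ^+ n : N) U by rewrite expg1n.
apply: (@filterS _ (nbhs 1) _ _ _ _ h) => x /= Ux Bx.
have := tM _ (subgroupX n sB Bx) Ux; rewrite (hom_onX _ sB ht Bx) normrM.
rewrite normr_nat => /le_lt_trans /(_ Mn); rewrite ltr_pM2l// ltr0n.
Qed.

Lemma small_continuous (T : topologicalType) B t (p : T -> N) :
  subgroup B -> hom_on B t -> small_near1 B t ->
  continuous p -> (forall s, B (p s)) -> continuous (t \o p).
Proof.
move=> sB ht tB cp Bp s; have [_ BM BV] := sB.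
apply/cvgrPdist_lt => e e0.
have c : (fun s' => (p s)^-1 * p s') @ s --> (p s)^-1 * p s.
  by apply: cvg_mulg; [exact: cvg_cst|exact: cp].
have /c h : nbhs ((p s)^-1 * p s) [set x | B x -> (`|t x| < e)%R].
  by rewrite mulVg; exact: tB.
apply: (@filterS _ (nbhs s) _ _ _ _ h) => s' /= te.
have Bs := BV _ (Bp s); have := te (BM _ _ Bs (Bp s')).
by rewrite ht// (hom_onV sB ht)// addrC distrC.
Qed.

(* [sigma s] is the limit of [y k ^+ floor (2 ^ k * s)], where [y k] is a
   [2 ^ k]-th root of [x]: an arc of a
   one-parameter subgroup, obtained without exponential map. *)
Definition binary_curve x (sigma : R -> N) := continuous sigma /\
  exists y : nat -> N, [/\ y 0%N = x, forall k, y k.+1 * y k.+1 = y k &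
    forall s : R, (0 <= s <= 1)%R ->
      (fun k => y k ^+ Num.truncn (2 ^+ k * s)%R) @ \oo --> sigma s].

Definition path_connected1 B := forall x, B x -> exists p : R -> N,
  [/\ continuous p, p 0%R = 1, p 1%R = x & forall s, B (p s)].

Definition root_closed B := forall y : N, B (y * y) -> B y.

(** Only a continuous right inverse of [t] is asked for, not a homomorphism, so arcs can simply be
    multiplied end to end. *)
Definition hom_section B t (a : R -> N) :=
  [/\ continuous a, forall s, B (a s), forall s, t (a s) = s & a 0%R = 1].

Section Existence.
Hypothesis hN : hausdorff_space N.
Variables (B : set N) (t : N -> R).
Hypotheses (sB : subgroup B) (cB : closed B) (rB : root_closed B)
  (pB : path_connected1 B) (ht : hom_on B t) (tB : small_near1 B t).

Let t1 : t 1 = 0%R. Proof. exact: hom_on1 sB ht. Qed.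

(** If [t] vanished on [B] near 1, it would be locally constant along a path in [B] from 1 to [x],
    hence constant. *)
Lemma hom_nonzero_near1 W x : nbhs 1 W -> B x -> t x <> 0%R ->
  exists2 z, W z & B z /\ t z <> 0%R.
Proof.
move=> W1 Bx tx; apply: contrapT => tW; apply: tx.
have [p [cp p0 p1 Bp]] := pB Bx; have [_ BM BV] := sB.
rewrite -p1 -t1 -p0; apply/esym.
apply: (is_derive_0_is_cst (f := t \o p)) => s.
apply: (@near_eq_is_derive _ _ _ (cst (t (p s)))).
have c : (fun s' => (p s)^-1 * p s') @ s --> (p s)^-1 * p s.
  by apply: cvg_mulg; [exact: cvg_cst|exact: cp].
have /c h : nbhs ((p s)^-1 * p s) W by rewrite mulVg.
apply: (@filterS _ (nbhs s) _ _ _ _ h) => s' /= Ws.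
have Bs := BV _ (Bp s).
have : t ((p s)^-1 * p s') = 0%R.
  by apply: contrapT => ne; apply: tW; exists ((p s)^-1 * p s') => //; split=> //; exact: BM.
by rewrite ht// (hom_onV sB ht)//; lra.
Qed.

(** The roots [y k] stay in the root-closed [B] with [t (y k) = t x / 2 ^+ k]; the limit stays in
    the closed [B], and [floor (2 ^ k * s) / 2 ^ k] tends to [s]. *)
Lemma binary_curve_hom x sigma : B x -> binary_curve x sigma ->
  forall s : R, (0 <= s <= 1)%R -> B (sigma s) /\ t (sigma s) = (s * t x)%R.
Proof.
move=> Bx [_ [y [y0 y2 ys]]] s s01; have [B1 BM BV] := sB.
have By k : B (y k) by elim: k => [|k IH]; [rewrite y0|apply: rB; rewrite y2].
have ty k : (t (y k) = t x / 2 ^+ k)%R.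
  elim: k => [|k IH]; first by rewrite y0 expr0 divr1.
  have := ht (By k.+1) (By k.+1); rewrite y2 IH exprS invfM mulrA.
  by set u := (t x)%R; set v := (2 ^+ k)^-1%R; lra.
have Bs : B (sigma s).
  apply: (@closed_cvg _ _ _ _ _ B cB _ _ (ys _ s01)).
    by near=> k; exact: subgroupX.
split=> //; apply/eqP; rewrite -subr_eq0 -normr_le0; apply/ler_addgt0Pl => e e0.
rewrite addr0.
have e2 : (0 < e / 2)%R by rewrite divr_gt0.
have c : (fun k => (sigma s)^-1 * y k ^+ Num.truncn (2 ^+ k * s)%R) @ \oo --> 
    (sigma s)^-1 * sigma s.
  by apply: cvg_mulg; [exact: cvg_cst|exact: ys].
have /c h : nbhs ((sigma s)^-1 * sigma s) [set x | B x -> (`|t x| < e / 2)%R].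
  by rewrite mulVg; exact: tB.
have h2 : \forall k \near \oo, (`|t x| < e / 2 * 2 ^+ k)%R.
  near=> k; pose n := (Num.truncn (`|t x| / (e / 2))).+1.
  have nk : (n <= k)%N by near: k; exact: nbhs_infty_ge.
  have : (`|t x| < e / 2 * n%:R)%R by rewrite mulrC -ltr_pdivrMr// truncnS_gt.
  move=> /lt_le_trans; apply; rewrite ler_pM2l// -natrX ler_nat.
  by rewrite (leq_trans nk)// ltnW// ltn_expl.
have [k [/= hk h2k]] := @filter_ex _ \oo _ _ (@filterI _ \oo _ _ _ h h2).
have Bk : B (y k ^+ Num.truncn (2 ^+ k * s)%R) by exact: subgroupX.
have := hk (BM _ _ (BV _ Bs) Bk).
rewrite ht//; last exact: BV.
rewrite (hom_onV sB ht)// (hom_onX _ sB ht)// ty.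
have p2 : (0 < 2 ^+ k :> R)%R by rewrite exprn_gt0.
have : (0 <= 2 ^+ k * s)%R by case/andP: s01 => s0 _; rewrite mulr_ge0 ?(ltW p2).
move=> /truncn_itv; set n := Num.truncn _ => /andP[n1 n2].
have -> : (n%:R * (t x / 2 ^+ k) = (n%:R / 2 ^+ k) * t x)%R.
  by field; rewrite gt_eqF.
set r := (n%:R / 2 ^+ k)%R => hr.
have rs : (`|r - s| <= (2 ^+ k)^-1)%R.
  rewrite ler_norml lerBrDr lerBlDr /r; apply/andP; split.
    rewrite ler_pdivlMr// mulrDl mulNr mulVf ?gt_eqF//.
    by move: n2; rewrite -natr1; lra.
  rewrite ler_pdivrMr// mulrDl mulVf ?gt_eqF//; lra.
have rst : (`|(r - s) * t x| <= e / 2)%R.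
  rewrite normrM; apply: le_trans (ler_wpM2r (normr_ge0 _) rs) _.
  by rewrite mulrC ler_pdivrMr// ltW.
apply: ltW; rewrite (_ : t (sigma s) - s * t x =
  (r - s) * t x - (- t (sigma s) + r * t x))%R; last by lra.
by apply: le_lt_trans (ler_normB _ _) _; lra.
Unshelve. all: by end_near. Qed.

Let clip (K u : R) : R :=
  if (u <= 0)%R then 0%R else if (u <= K)%R then u else K.
Let clamp := clip 1%R.

Let continuous_clamp : continuous clamp.
Proof.
apply: continuous_if => [u||u|u ->]; [exact: cvg_id|exact: cst_continuous| |].
  apply: continuous_if => [v|v|v|v ->//];
    [exact: cvg_id|exact: cvg_id|exact: cst_continuous].
by rewrite ler01.
Qed.

Let clamp01 u : (0 <= clamp u <= 1)%R.
Proof. by rewrite /clamp /clip; case: (leP u 0%R) => ?; case: (leP u 1%R) => ?; lra. Qed.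

Let clamp0 u : (u <= 0)%R -> clamp u = 0%R.
Proof. by rewrite /clamp /clip => ->. Qed.

Section Global.
Variables (x : N) (sigma : R -> N).
Hypotheses (Bx : B x) (tx : t x <> 0%R) (cs : binary_curve x sigma).

Let sigma0 : sigma 0%R = 1.
Proof.
have [_ [y [_ _ ys]]] := cs; apply: (@cvg_unique _ hN (fmap (fun=> 1) \oo)).
  have := ys 0%R; rewrite lexx ler01 => /(_ isT).
  by apply: cvg_trans; apply: near_eq_cvg; near=> k; rewrite mulr0 truncn0.
exact: cvg_cst.
Unshelve. all: by end_near. Qed.

(** [K] copies of the arc run one after the other: as [u] goes from 0 to [K], the value of [t] goes
    from 0 to [K] times [t x]. *)
Fixpoint sigma_prod K u : N :=
  if K is K'.+1 then sigma_prod K' u * sigma (clamp (u - K'%:R)%R) else 1.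

Let sigma_prod_continuous K : continuous (sigma_prod K).
Proof.
elim: K => [|K IH] /=; first exact: cst_continuous.
apply: continuous_fmul => //.
apply: (@continuous_fcomp R R N (fun u => clamp (u - K%:R)%R) sigma); last exact: (proj1 cs).
apply: (@continuous_fcomp R R R (fun u => (u - K%:R)%R) clamp); last exact: continuous_clamp.
by move=> u; apply: cvgB; [exact: cvg_id|exact: cvg_cst].
Qed.

Let sigma_prod_hom K u : B (sigma_prod K u) /\
  t (sigma_prod K u) = (clip K%:R u * t x)%R.
Proof.
have [B1 BM BV] := sB; elim: K => [|K [IHB IHt]] /=.
  rewrite t1; split => //; suff -> : clip 0 u = 0%R by rewrite mul0r.
  by rewrite /clip; case: (leP u 0%R).
have [Bs ts] := binary_curve_hom Bx cs (clamp01 (u - K%:R)%R).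
split; first exact: BM.
rewrite ht// IHt ts -mulrDl; congr (_ * _)%R.
have K0 : (0 <= K%:R :> R)%R by rewrite ler0n.
rewrite -natr1 /clamp /clip; case: (leP u 0%R) => ?; case: (leP u K%:R) => ?;
  case: (leP u (K%:R + 1)%R) => ?; case: (leP (u - K%:R)%R 0%R) => ?;
  case: (leP (u - K%:R)%R 1%R) => ?; lra.
Qed.

Let sigma_prod_stable K L u : (u <= K%:R)%R -> (K <= L)%N ->
  sigma_prod L u = sigma_prod K u.
Proof.
move=> uK /subnKC <-; elim: (L - K)%N => [|j IH]; rewrite ?addn0// addnS /=.
rewrite IH clamp0 ?sigma0 ?mulg1// natrD.
have j0 : (0 <= j%:R :> R)%R by rewrite ler0n.
by lra.
Qed.

(** For each sign of [u] one of the two factors is 1, which gives a curve on both half-lines. *)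
Let A K u := sigma_prod K u / sigma_prod K (- u)%R.

Let A_continuous K : continuous (A K).
Proof.
apply: continuous_fmul; first exact: sigma_prod_continuous.
apply: continuous_finv.
apply: (@continuous_fcomp R R N (fun u => (- u)%R) (sigma_prod K));
  last exact: sigma_prod_continuous.
by move=> u; apply: cvgN; exact: cvg_id.
Qed.

Let A_stable K L u : (`|u| <= K%:R)%R -> (K <= L)%N -> A L u = A K u.
Proof.
rewrite ler_norml => /andP[Ku uK] KL.
by rewrite /A !(@sigma_prod_stable K L)// lerNl.
Qed.

Lemma exists_section_from_curve : exists a, hom_section B t a.
Proof.
have [B1 BM BV] := sB.
pose K u := (Num.truncn `|u : R|).+1.
have uK u : (`|u| <= (K u)%:R)%R by rewrite ltW// truncnS_gt.
exists (fun s => A (K (s / t x)%R) (s / t x)%R); split.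
(* The number of copies varies with the parameter, but [L] copies serve for a whole neighbourhood of
   [s] by stability. *)
- move=> s; pose L := K (`|s / t x| + 1)%R.
  have cA : continuous (fun r : R => A L (r / t x)%R).
    apply: (@continuous_fcomp R R N (fun r => (r / t x)%R) (A L)); last exact: A_continuous.
    by move=> r; apply: cvgM; [exact: cvg_id|exact: cvg_cst].
  have E r : (`|r / t x| <= `|s / t x| + 1)%R ->
      A L (r / t x)%R = A (K (r / t x)%R) (r / t x)%R.
    move=> h; apply: A_stable; first exact: uK.
    by rewrite /L /K ltnS le_truncn// (le_trans h)// ler_norm.
  have := cA s; rewrite /continuous_at /= (E s); last by lra.
  apply: cvg_trans; apply: near_eq_cvg.
  have : (fun r : R => (r / t x)%R) @ s --> (s / t x)%R.
    by apply: cvgM; [exact: cvg_id|exact: cvg_cst].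
  move=> /cvgrPdist_lt /(_ 1%R ltr01); apply: filterS => r h; apply: E.
  have -> : (r / t x = s / t x - (s / t x - r / t x))%R by lra.
  by apply: le_trans (ler_normB _ _) _; rewrite lerD2l ltW.
- move=> s; have [? _] := sigma_prod_hom (K (s / t x)%R) (s / t x)%R.
  have [? _] := sigma_prod_hom (K (s / t x)%R) (- (s / t x))%R.
  by apply: (BM) => //; exact: BV.
- move=> s; set u := (s / t x)%R.
  have [? e1] := sigma_prod_hom (K u) u; have [? e2] := sigma_prod_hom (K u) (- u)%R.
  rewrite ht//; last exact: BV.
  rewrite (hom_onV sB ht)// e1 e2 -mulrBl.
  have -> : s = (u * t x)%R by rewrite /u mulfVK//; exact/eqP.
  congr (_ * _)%R; have := uK u; rewrite ler_norml => /andP[? ?].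
  rewrite /clip; case: (leP u 0%R) => ?; case: (leP (- u)%R 0%R) => ?;
    case: (leP u (K u)%:R) => ?; case: (leP (- u)%R (K u)%:R) => ?; lra.
- by rewrite mul0r /A oppr0 mulgV.
Qed.

End Global.

Lemma exists_section x : (\forall z \near (1 : N), exists sigma, binary_curve z sigma) ->
  B x -> t x <> 0%R -> exists a, hom_section B t a.
Proof.
move=> W1 Bx tx; have [z [sigma zs] [Bz tz]] := hom_nonzero_near1 W1 Bx tx.
exact: exists_section_from_curve zs.
Qed.

End Existence.
End Sections.

(** * Towers of real characters *)

Section IntegerPowers.
Variable G : groupType.
Local Open Scope group_scope.

Definition zpow (x : G) (k : int) : G :=
  match k with Posz n => x ^+ n | Negz n => x ^- n.+1 end.

Lemma zpowS x k : zpow x (k + 1)%R = zpow x k * x.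
Proof.
case: k => [n|[|n]].
- by rewrite /zpow (_ : Posz n + 1 = Posz n.+1)%R ?expgSr//; lia.
- by rewrite (_ : Negz 0 + 1 = Posz 0)%R// /zpow expg0 expg1 mulVg.
- rewrite (_ : Negz n.+1 + 1 = Negz n)%R; last by lia.
  by rewrite /zpow [in RHS]expgS invgM mulgVK.
Qed.

Lemma zpowD x k l : zpow x (k + l)%R = zpow x k * zpow x l.
Proof.
case: l => n.
  elim: n => [|n IH]; first by rewrite addr0 /= mulg1.
  rewrite (_ : k + Posz n.+1 = (k + Posz n) + 1)%R; last by lia.
  by rewrite zpowS IH /= expgSr mulgA.
elim: n => [|n IH].
  rewrite -{2}[k](_ : (k + Negz 0) + 1 = k)%R ?zpowS; last by lia.
  by rewrite /= expg1 mulgK.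
have := zpowS x (k + Negz n.+1)%R.
rewrite (_ : k + Negz n.+1 + 1 = k + Negz n)%R ?IH; last by lia.
by move=> e; apply: (@mulIg _ x); rewrite -e /= [x ^+ n.+2]expgS invgM !mulgA mulgVK.
Qed.

Lemma zpowN x k : zpow x (- k)%R = (zpow x k)^-1.
Proof. by apply/esym/mulg1_eq; rewrite -zpowD subrr. Qed.

Lemma zpow_mem (H : set G) x k : subgroup H -> H x -> H (zpow x k).
Proof.
by move=> sH Hx; have [_ _ HV] := sH; case: k => n /=; [|apply: HV]; exact: subgroupX.
Qed.

Lemma gen_adjoinP (D E : set G) x y : subgroup D -> subgroup E -> E `<=` D ->
  normalized E D -> D x -> gen (E `|` [set x]) y -> exists k, E ((zpow x k)^-1 * y).
Proof.
move=> sD sE ED nE Dx; have [E1 EM EV] := sE; have [D1 DM DV] := sD.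
elim=> {y}.
- move=> y [Ey|->]; first by exists 0%R; rewrite /= invg1 mul1g.
  by exists 1%R; rewrite /= expg1 mulVg.
- by exists 0%R; rewrite /= invg1 mul1g.
- move=> y z _ [k Ey] _ [l Ez]; exists (k + l)%R.
  have -> : (zpow x (k + l)%R)^-1 * (y * z) =
      (((zpow x k)^-1 * y) ^ zpow x l) * ((zpow x l)^-1 * z).
    by rewrite zpowD /conjg !gnorm.
  by apply: EM => //; apply: nE => //; exact: zpow_mem.
- move=> y _ [k Ey]; exists (- k)%R; rewrite zpowN.
  have -> : (zpow x k)^-1^-1 * y^-1 = (((zpow x k)^-1 * y)^-1) ^ (zpow x k)^-1.
    by rewrite /conjg !gnorm.
  by apply: nE; [exact: EV|apply: DV; exact: zpow_mem].
Qed.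

End IntegerPowers.

Section Tower.
Variables (R : realType) (N : TopologicalGroup.type).
Local Open Scope group_scope.
Implicit Types (B D E U : set N) (x y z : N) (t : N -> R).

(* [t] extends to the real points [B] a nonzero homomorphism from [D `&` B] to
   the integers; [a] splits it continuously. *)
Record tower_step D B B' t (a : R -> N) : Prop := TowerStep {
  step_hom : hom_on B t;
  step_small : small_near1 B t;
  step_invariant : forall x y, B x -> t (x ^ y) = t x;
  step_next : B' = [set x | B x /\ t x = 0%R];
  step_section : hom_section B t a;
  step_discrete : exists s : seq R, forall d, D d -> B d ->
    exists2 e, e \in s & exists k : int, t d = (e + k%:~R)%R;
  step_unit : exists2 d, D d /\ B d & t d = 1%R }.

Record tower_group B : Prop := TowerGroup {
  tower_subgroup : subgroup B;
  tower_closed : closed B;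
  tower_normal : forall x y, B x -> B (x ^ y);
  tower_path : @path_connected1 R N B;
  tower_root : root_closed B }.

Record tower D (r : nat) (B : nat -> set N) (t : nat -> N -> R)
    (a : nat -> R -> N) : Prop := Tower {
  tower_step_at : forall j, (j < r)%N -> tower_step D (B j) (B j.+1) (t j) (a j);
  tower_group_at : forall j, (j <= r)%N -> tower_group (B j);
  tower_end : finite_set (D `&` B r) }.

(** The section serves for path connectedness: a path in [B] is pushed into the kernel by dividing
    it by [a (t (p s))]. *)
Lemma tower_kernel D B B' t a : hausdorff_space N -> tower_group B ->
  tower_step D B B' t a -> tower_group B'.
Proof.
move=> hN [sB cB nB pB rB] [ht tB tJ -> [ca Ba ta a0] _ _].
have [B1 BM BV] := sB.
have sB' : subgroup [set x | B x /\ t x = 0%R].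
  split=> /= [|x y [Bx tx] [By ty]|x [Bx tx]].
  - by split=> //; exact: hom_on1 sB ht.
  - by split; [exact: BM|rewrite ht// tx ty addr0].
  - by split; [exact: BV|rewrite (hom_onV sB ht)// tx oppr0].
split => //.
- move=> x clx; have Bx : B x.
    by apply: cB => W /clx[y [[By _] Wy]]; exists y.
  split=> //; apply/eqP; rewrite -normr_le0; apply/ler_addgt0Pl => e e0.
  have := tB _ e0 => /(nbhs_translate x) /clx[y /= [[By ty] h]].
  have := h (BM _ _ (BV _ Bx) By); rewrite ht//; last exact: BV.
  by rewrite (hom_onV sB ht)// ty addr0 normrN addr0 => /ltW.
- by move=> x y [Bx tx]; split; [exact: nB|rewrite tJ].
- move=> x [Bx tx]; have [p [cp p0 p1 Bp]] := pB _ Bx.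
  exists (fun s => p s / a (t (p s))); split.
  + apply: continuous_fmul => //; apply: continuous_finv.
    apply: (@continuous_fcomp R R N (t \o p) a) => //.
    exact: small_continuous sB ht tB cp Bp.
  + by rewrite p0 (hom_on1 sB ht) a0 divg1.
  + by rewrite p1 tx a0 divg1.
  + move=> s; have Ba' : B (a (t (p s)))^-1 by exact: BV.
    split; first exact: BM.
    by rewrite ht// (hom_onV sB ht)// ta subrr.
- move=> y [Byy]; have By := rB _ Byy.
  by rewrite ht// => e; split=> //; lra.
Qed.

Section Build.
Hypotheses (hN : hausdorff_space N) (nN : nilpotent_group N).
Hypothesis curves :
  \forall z \near (1 : N), exists sigma : R -> N, binary_curve z sigma.
Variables (D K U : set N).
Hypotheses (sD : subgroup D) (iD : D `<=` isolated D).
Hypotheses (bK : in_compact K) (KD : forall x, exists2 d, D d & K (x / d)).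
Hypotheses (nU : nbhs 1 U) (bU : in_compact U).

Definition cobounded_in B E :=
  exists2 K, in_compact K & forall x, B x -> exists2 d, E d & K (x / d).

Let bb := @in_compact_bornology N.

Lemma cobounded_finite B E L (F : set N) : in_compact L -> finite_set F ->
  (forall x, B x -> exists2 d, (exists2 f, F f & E (f^-1 * d)) & L (x / d)) ->
  cobounded_in B E.
Proof.
move=> bL fF h; have [_ _ _ bM] := bb.
exists [set x * y | x in L & y in F]; first by apply: bM => //; exact: finite_in_compact.
move=> x /h[d [f Ff Ed] Ld]; exists (f^-1 * d) => //.
by exists (x / d) => //; exists f => //; rewrite !gnorm.
Qed.

Lemma bounded_int_finite (M : R) : finite_set [set k : int | (`|k%:~R : R| <= M)%R].
Proof.
pose n := (Num.truncn M).+1.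
apply: (@sub_finite_set _ _ [set (Posz i - Posz n)%R | i in `I_(n + n).+1]).
  move=> k /= kM.
  have Mn : (M < n%:R)%R by exact: truncnS_gt.
  have kn : (`|k| <= n%:Z)%R.
    rewrite -(ler_int R) intr_norm; apply: (le_trans kM); exact: ltW.
  exists `|(k + n%:Z)%R|%N; [rewrite /=; lia|lia].
exact: finite_image (finite_II _).
Qed.

Let D_locally_bounded E (f : N -> R) : E `<=` D -> locally_bounded (@in_compact N) E f.
Proof.
move=> ED A bA; have /finite_seqP[s sE] := discrete_bounded_finite sD iD bA.
exists (\sum_(x <- s) `|f x|)%R => x Ex Ax.
have xs : x \in s by have : [set` s] x by rewrite -sE; split => //; exact: ED.
by rewrite (big_rem x)//= lerDl sumr_ge0.
Qed.

(** Since no positive power of [x] lies in [E], the exponent of [x] modulo [E] is an integral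
    character; [t] is its extension to [B]. *)
Lemma cyclic_step B E x : subgroup E -> E `<=` D -> normalized E D -> D x ->
  (forall d y, D d -> gen (E `|` [set x]) y -> E [~ d, y]) ->
  (forall m, ~ E (x ^+ m.+1)) ->
  tower_group B -> gen (E `|` [set x]) `<=` B ->
  cobounded_in B (gen (E `|` [set x])) ->
  exists B' t a, [/\ tower_step D B B' t a, tower_group B', E `<=` B' &
    cobounded_in B' E].
Proof.
move=> sE ED nE Dx cE Ex tgB; have [sB cB nB pB rB] := tgB.
set H := gen _ => HB [K' bK' KH].
have sH : subgroup H by exact: gen_subgroup.
have HD : H `<=` D by apply: gen_sub => // y [/ED//|->].
have [E1 EM EV] := sE; have [D1 DM DV] := sD; have [H1 HM HV] := sH.
have [B1 BM BV] := sB; have [bS b1 bV bM] := bb.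
have EH : E `<=` H by move=> y Ey; apply: gen_mem; left.
have Hx : H x by apply: gen_mem; right.
have zE k : E (zpow x k) -> k = 0%R.
  case: k => [[|n]|n] //=; first by move=> /Ex.
  by move=> /EV; rewrite invgK => /Ex.
have uniq k l y : E ((zpow x k)^-1 * y) -> E ((zpow x l)^-1 * y) -> k = l.
  move=> Ek El; apply/eqP; rewrite -subr_eq0; apply/eqP/zE.
  rewrite addrC zpowD zpowN.
  by have := EM _ _ El (EV _ Ek); rewrite !gnorm.
pose chi y : int := if pselect (exists k, E ((zpow x k)^-1 * y)) is left e
  then projT1 (cid e) else 0%R.
have chiP y : H y -> E ((zpow x (chi y))^-1 * y).
  move=> Hy; rewrite /chi; case: pselect => [e|[]]; first by case: cid.
  exact: gen_adjoinP sD sE ED nE Dx Hy.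
have chiE y k : E ((zpow x k)^-1 * y) -> H y -> chi y = k.
  by move=> Ek Hy; exact: uniq (chiP _ Hy) Ek.
pose f y : R := (chi y)%:~R%R.
have hf : hom_on H f.
  move=> y z Hy Hz; rewrite /f -intrD; congr (_%:~R)%R.
  apply: chiE; last exact: HM.
  have -> : (zpow x (chi y + chi z)%R)^-1 * (y * z) =
     (((zpow x (chi y))^-1 * y) ^ zpow x (chi z)) * ((zpow x (chi z))^-1 * z).
    by rewrite zpowD /conjg !gnorm.
  by apply: EM; [apply: nE; [exact: chiP|exact: zpow_mem]|exact: chiP].
have fE e : E e -> f e = 0%R.
  move=> Ee; rewrite /f (_ : chi e = 0%R)//; apply: chiE; last exact: EH.
  by rewrite /= invg1 mul1g.
have [t [ht bt tf]] := extend_hom nN bb sB sH HB bK' KH hf (D_locally_bounded f HD).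
have tB : small_near1 B t by exact: (locally_bounded_small sB ht nU bU bt).
have tH h d : H h -> D d -> t (h ^ d) = t h.
  move=> Hh Dd.
  have Ec : E [~ h, d] by rewrite -invgR; apply: EV; exact: cE.
  have -> : h ^ d = h * [~ h, d] by rewrite /commg mulVKg.
  by rewrite ht; [rewrite (tf [~ h, d]) ?fE ?addr0//; exact: EH|exact: HB|apply/HB/EH].
(* The difference of both sides is a homomorphism of [y] that vanishes on [H], hence is bounded,
   hence zero. *)
have tD y d : B y -> D d -> t (y ^ d) = t y.
  move=> By Dd; apply/eqP; rewrite -subr_eq0; apply/eqP.
  have [|M1 tM1] := bt [set u * v | u in [set d^-1] & v in [set u * v | u in K' & v in [set d]]].
    by apply: (bM) => //; exact: bM.
  have [M2 tM2] := bt _ bK'.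
  have hu : hom_on B (fun y => t (y ^ d)%g - t y)%R.
    move=> u v Bu Bv; rewrite conjMg (ht _ _ (nB _ d Bu) (nB _ d Bv)) (ht _ _ Bu Bv).
    by lra.
  apply: (bounded_hom_eq0 sB hu (M := (M1 + M2)%R)) => // u Bu.
  have [h Hh Kh] := KH _ Bu.
  have Bh := HB _ Hh.
  have Buh : B (u / h) by apply: (BM) => //; exact: BV.
  have -> : (t (u ^ d)%g - t u = t ((u / h) ^ d)%g - t (u / h)%g)%R.
    have {1 2}-> : u = (u / h) * h by rewrite mulgVK.
    rewrite conjMg (ht _ _ (nB _ d Buh) (nB _ d Bh)) (ht _ _ Buh Bh) (tH _ _ Hh Dd).
    by lra.
  apply: le_trans (ler_normB _ _) _; apply: lerD; last exact: tM2.
  apply: tM1; first exact: nB.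
  by exists d^-1 => //; exists ((u / h) * d) => //; exists (u / h) => //; exists d.
have tJ y z : B y -> t (y ^ z) = t y.
  move=> By; apply: (@cobounded_invariant R N (@in_compact N) B [set: N] D K t) => //.
- by move=> ? ? ? _; exact: nB.
have tx : t x = 1%R.
  by rewrite tf// /f (_ : chi x = 1%R)//; apply: chiE => //; rewrite /= expg1 mulVg.
have Bx := HB _ Hx.
have [a sa] : exists a, hom_section B t a.
  by apply: (@exists_section R N hN B t) Bx _ => //; rewrite tx; lra.
pose B' := [set y | B y /\ t y = 0%R].
have st : tower_step D B B' t a.
  split => //; last by exists x.
  (* An element of [D] in [B] is a product of a point of the finite set [D] cut by [K'] and of an
     element of [H], where [t] is integral. *)
  have /finite_seqP[s sP] := discrete_bounded_finite sD iD bK'.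
  exists [seq t y | y <- s] => d Dd Bd; have [h Hh Kh] := KH _ Bd.
  have Ddh : D (d / h) by apply: (DM) => //; apply: DV; exact: HD.
  exists (t (d / h)).
    apply/mapP; exists (d / h) => //.
    have : (D `&` K') (d / h) by [].
    by rewrite sP.
  have Bdh : B (d / h) by apply: (BM) => //; apply: BV; exact: HB.
  by exists (chi h); rewrite -[in LHS](mulgVK h d) (ht _ _ Bdh (HB _ Hh)) (tf h).
exists B', t, a; split => //.
- exact: tower_kernel st.
- by move=> e Ee; split; [exact/HB/EH|rewrite tf ?fE//; exact: EH].
(* An element of the kernel is close to some [h] in [H]; then [chi h] is bounded, so finitely many
   powers of [x] bring [h] back to [E]. *)
have [M tM] := bt _ bK'.
apply: (@cobounded_finite B' E K' [set zpow x k | k in [set k : int | (`|k%:~R : R| <= M)%R]]) => //.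
  exact: finite_image (bounded_int_finite _).
move=> b [Bb tb]; have [h Hh Kh] := KH _ Bb; exists h => //.
exists (zpow x (chi h)); last exact: chiP.
exists (chi h) => //=; rewrite -/(f h) -tf//.
have Bh := HB _ Hh; have Bbh : B (b / h) by apply: (BM) => //; exact: BV.
have -> : t h = (- t (b / h)%g)%R.
  by have := ht _ _ Bbh Bh; rewrite mulgVK tb; lra.
by rewrite normrN; exact: tM.
Qed.

(** A generator with a power in [E] changes nothing up to finite index and is skipped; any other
    contributes one level. At the bottom [B] is bounded, so it meets [D] in a finite set. *)
Lemma build_tower E B : central_series D E -> tower_group B -> E `<=` B ->
  cobounded_in B E -> exists r Bs ts as_, tower D r Bs ts as_ /\ Bs 0%N = B.
Proof.
move=> cs; elim: cs B => {E}.
  move=> B tgB _ [K' bK' KB]; exists 0%N, (fun=> B), (fun=> fun=> 0%R), (fun=> fun=> 1).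
  split => //; split => //.
  apply: (sub_finite_set _ (discrete_bounded_finite sD iD bK')).
  move=> x [Dx Bx]; split=> //; have [_ -> ] := KB _ Bx.
  by rewrite divg1.
move=> E x cs IH Dx cE B tgB HB cob.
have [sE ED nE] := central_series_sub sD cs.
have EH : E `<=` gen (E `|` [set x]) by move=> y Ey; apply: gen_mem; left.
have [[m Em]|nEx] := pselect (exists m, E (x ^+ m.+1)).
  apply: IH => //; first exact: subset_trans HB.
  have [K' bK' KH] := cob.
  apply: (@cobounded_finite B E K' [set x ^+ k | k in `I_m.+1]) => //.
    exact: finite_image (finite_II _).
  move=> y /KH[d Hd Kd]; exists d => //.
  have [k Ek] := gen_adjoinP sD sE ED nE Dx Hd.
  have [E1 EM EV] := sE.
  (* The remainder of the exponent modulo [m.+1] gives one of finitely many representatives. *)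
  exists (x ^+ `|(k %% m.+1%:Z)%Z|).
    exists `|(k %% m.+1%:Z)%Z|%N => //=; lia.
  pose q := (k %/ m.+1%:Z)%Z; pose n := `|(k %% m.+1%:Z)%Z|%N.
  have kE : k = (Posz n + q * m.+1%:Z)%R by rewrite /n /q; lia.
  have Ez : E (zpow x (q * m.+1%:Z)%R).
    have zM (j : nat) : E (zpow x (j%:Z * m.+1%:Z)%R).
      by rewrite /= mulnC expgnA; exact: subgroupX.
    case: (q) => j; first exact: zM.
    rewrite NegzE mulNr zpowN; apply: EV; exact: zM.
  suff : E ((zpow x n)^-1 * d) by [].
  rewrite (_ : _ * d = zpow x (q * m.+1%:Z)%R * ((zpow x k)^-1 * d)); first exact: EM.
  by rewrite [in RHS]kE zpowD !gnorm.
have nEx' m : ~ E (x ^+ m.+1) by move=> Em; apply: nEx; exists m.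
have [B' [t [a [st tgB' EB' cob']]]] := cyclic_step sE ED nE Dx cE nEx' tgB HB cob.
have [r [Bs [ts [as_ [[s1 s2 s3] B0]]]]] := IH B' tgB' EB' cob'.
exists r.+1, (fun j => if j is j'.+1 then Bs j' else B),
  (fun j => if j is j'.+1 then ts j' else t), (fun j => if j is j'.+1 then as_ j' else a).
split => //; split.
- by case=> [|j] jr; [rewrite B0|exact: s1].
- by case=> [|j] jr; [exact: tgB|exact: s2].
- exact: s3.
Qed.

Lemma exists_tower : connected [set: N] -> @path_connected1 R N [set: N] ->
  exists r Bs ts as_, tower D r Bs ts as_ /\ Bs 0%N = [set: N].
Proof.
move=> cN pN.
have [s sE] := connected_cocompact_fg sD iD cN nU bU bK KD.
apply: (@build_tower D) => //.
- by rewrite sE; exact: fg_central_series.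
- by exists K.
Qed.

End Build.
End Tower.

(** * Square roots and arcs in Lie groups *)

Section LocalLieGroup.
Variables (R : realType) (n : nat).
Local Notation W := 'rV[R]_n.

(** The factor 3 is the sum of the geometric series of ratio 2/3. *)
Lemma geometric_limit (a : nat -> W) (C : R) :
  (forall k, `|a k.+1 - a k| <= C * (2 / 3) ^+ k) ->
  exists l : W, forall k, `|l - a k| <= 3 * C * (2 / 3) ^+ k.
Proof.
move=> aC; have q0 k : 0 < (2 / 3 : R) ^+ k by rewrite exprn_gt0//; lra.
have C0 : 0 <= C by have := le_trans (normr_ge0 _) (aC 0%N); rewrite expr0 mulr1.
have qS k : (2 / 3 : R) ^+ k.+1 = 2 / 3 * (2 / 3) ^+ k by rewrite exprS.
have am k j : `|a (k + j)%N - a k| <= 3 * C * ((2 / 3) ^+ k - (2 / 3) ^+ (k + j)).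
  elim: j => [|j IH]; first by rewrite addn0 !subrr normr0 mulr0.
  rewrite addnS (_ : a (k + j).+1 - a k = (a (k + j).+1 - a (k + j)%N) +
    (a (k + j)%N - a k)); last by rewrite addrA subrK.
  apply: le_trans (ler_normD _ _) _.
  have := aC (k + j)%N; rewrite qS; move: IH; set u := `|_|; set v := `|_|.
  by move=> h1 h2; lra.
have am' k j : (k <= j)%N -> `|a j - a k| <= 3 * C * (2 / 3) ^+ k.
  move=> /subnKC <-; apply: le_trans (am _ _) _; rewrite ler_wpM2l//; first by lra.
  by rewrite gerBl ltW.
have small (e : R) : 0 < e -> exists k, 3 * C * (2 / 3) ^+ k < e.
  move=> e0; have : (fun k => 3 * C * (2 / 3 : R) ^+ k) @ \oo --> (0 : R).
    rewrite -[X in _ --> X](mulr0 (3 * C)); apply: cvgMr.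
    by apply: cvg_expr; rewrite ger0_norm; lra.
  move=> /cvgrPdist_lt /(_ _ e0) [k _ /(_ k (leqnn k))].
  rewrite sub0r normrN ger0_norm; first by exists k.
  by rewrite !mulr_ge0 ?(ltW (q0 k)).
have ca : cauchy (a @ \oo).
  apply: cauchy_exP => e e0; have [k ke] := small e e0.
  exists (a k); exists k => // j /= kj; rewrite -ball_normE /= distrC.
  exact: le_lt_trans (am' _ _ kj) ke.
have /cvg_ex[l al] : cvg (a @ \oo) by apply/cauchy_cvgP.
exists l => k.
have cl : closed [set u : W | `|u - a k| <= 3 * C * (2 / 3) ^+ k].
  apply: (@preimage_closed _ _ (fun u : W => `|u - a k|) [set r | r <= _]).
    move=> u _; have h : (fun v : W => v - a k) @ u --> u - a k.
      by apply: (@cvgB _ _ _ (nbhs u)); [exact: cvg_id|exact: cvg_cst].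
    exact: (@cvg_norm _ _ _ (nbhs u) _ _ _ h).
  exact: closed_le.
apply: (@closed_cvg _ _ _ _ _ _ cl _ _ al).
by exists k => // j /= kj; exact: am'.
Qed.

(** Passing from [2 ^ k * s] to [2 ^ k.+1 * s] appends one binary digit, the parity on the right. *)
Lemma truncn_double (u : R) : 0 <= u ->
  Num.truncn (2 * u) = ((Num.truncn u).*2 + odd (Num.truncn (2 * u)))%N.
Proof.
move=> u0; have /andP[a1 a2] := truncn_itv u0.
have u20 : 0 <= 2 * u by lra.
have /andP[b1 b2] := truncn_itv u20.
set p := Num.truncn u in a1 a2 *; set q := Num.truncn (2 * u) in b1 b2 *.
have h1 : (p.*2 <= q)%N.
  by rewrite -ltnS -(ltr_nat R) -muln2 natrM; move: b2; rewrite -natr1; lra.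
have h2 : (q < p.*2 + 2)%N.
  by rewrite -(ltr_nat R) natrD -muln2 natrM; move: a2; rewrite -natr1; lra.
have : q = p.*2 \/ q = p.*2.+1 by lia.
by case=> ->; rewrite ?oddS odd_double/= ?addn0 ?addn1.
Qed.

Section Curve.
Variables (N : TopologicalGroup.type) (par : W -> N) (mm : W -> W -> W) (r : R).
Hypotheses
  (par_continuous : forall u, `|u| <= r -> {for u, continuous par})
  (par_inj : forall u v, `|u| <= r -> `|v| <= r -> par u = par v -> u = v)
  (par0 : par 0 = 1%g)
  (parM : forall u v, `|u| <= r -> `|v| <= r -> (par u * par v)%g = par (mm u v))
  (mm_near : forall u v, `|u| <= r -> `|v| <= r -> `|mm u v - u| <= 9 / 8 * `|v|)
  (mm_sqrt : forall y, `|y| <= r -> exists2 u, `|u| <= 2 / 3 * `|y| & mm u u = y).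

(** The powers of the roots are followed in coordinates: each new digit multiplies by at most one
    root, of size at most [(2 / 3) ^+ k * |x|], so they converge geometrically. *)
Lemma exists_binary_curve (x : W) : `|x| <= r / 8 ->
  exists sigma, binary_curve (par x) (sigma : R -> N).
Proof.
move=> xr; have x0 : 0 <= `|x| by [].
have q0 k : 0 < (2 / 3 : R) ^+ k by rewrite exprn_gt0//; lra.
have q1 k : (2 / 3 : R) ^+ k <= 1 by rewrite exprn_ile1//; lra.
have qS k : (2 / 3 : R) ^+ k.+1 = 2 / 3 * (2 / 3) ^+ k by rewrite exprS.
have [rt rtP] : exists rt : W -> W, forall y, `|y| <= r ->
    `|rt y| <= 2 / 3 * `|y| /\ mm (rt y) (rt y) = y.
  have h (y : W) : exists u, `|y| <= r -> `|u| <= 2 / 3 * `|y| /\ mm u u = y.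
    have [/mm_sqrt[u u1 u2]|] := pselect (`|y| <= r); first by exists u.
    by move=> ny; exists 0 => /ny.
  by have [rt rtP] := choice h; exists rt.
pose y k := iter k rt x.
have yx k : `|y k| <= (2 / 3) ^+ k * `|x|.
  elim: k => [|k IH]; first by rewrite expr0 mul1r.
  have yr : `|y k| <= r by have := q1 k; have := q0 k; nra.
  have [h _] := rtP _ yr; rewrite qS; apply: le_trans h _; lra.
have yr k : `|y k| <= r by have := yx k; have := q1 k; have := q0 k; nra.
have y2 k : mm (y k.+1) (y k.+1) = y k by have [] := rtP _ (yr k).
pose nn k (s : R) := Num.truncn (2 ^+ k * s).
(* The coordinate of [par (y k) ^+ nn k s]; at level 0 the exponent is 0 except for [s = 1], where
   it is 1. *)
pose U := fix U s k := if k is k'.+1 then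
  if odd (nn k s) then mm (U s k') (y k) else U s k' else
  if nn 0%N s == 0%N then 0 else x.
have USE s k : U s k.+1 = if odd (nn k.+1 s) then mm (U s k) (y k.+1) else U s k.
  by [].
(* The increment is 9/8 times 2/3, that is 3/4, and 9/4 is its geometric sum. The total stays below
   [4 * |x|], hence below [r / 2], inside the domain of the local law. *)
have Ux s k : `|U s k| <= 4 * `|x| - 9 / 4 * (2 / 3) ^+ k * `|x| /\
    `|U s k.+1 - U s k| <= 3 / 4 * `|x| * (2 / 3) ^+ k.
  have step j : `|U s j| <= r -> `|U s j.+1 - U s j| <= 3 / 4 * `|x| * (2 / 3) ^+ j.
    move=> Ur; rewrite USE; case: ifP => _.
      apply: (le_trans (mm_near Ur (yr _))); have := yx j.+1; rewrite qS; lra.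
    by rewrite subrr normr0; have := q0 j; nra.
  have bound j : `|U s j| <= 4 * `|x| - 9 / 4 * (2 / 3) ^+ j * `|x|.
    elim: j => [|j IH].
      by rewrite expr0 /=; case: ifP => _; rewrite ?normr0; lra.
    have Ur : `|U s j| <= r by have := q0 j; nra.
    have := step _ Ur; rewrite qS => h.
    rewrite -[U s j.+1](subrK (U s j)); apply: le_trans (ler_normD _ _) _.
    by lra.
  split => //; apply: step; have := q0 k; have := bound k; nra.
have Ur s k : `|U s k| <= r by have [+ _] := Ux s k; have := q0 k; nra.
have parU s k : 0 <= s <= 1 -> par (U s k) = (par (y k) ^+ nn k s)%g.
  move=> /andP[s0 s1]; elim: k => [|k IH].
    rewrite /= /nn expr0 mul1r; case: eqP => [->|/eqP]; first by rewrite expg0.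
    rewrite -lt0n truncn_gt0 => s1'; have -> : s = 1 by lra.
    by rewrite truncn1 expg1.
  have nnS : nn k.+1 s = ((nn k s).*2 + odd (nn k.+1 s))%N.
    by rewrite {1}/nn exprS -mulrA truncn_double /nn ?exprS ?mulrA// mulr_ge0// exprn_ge0.
  rewrite USE; have -> : (par (y k.+1) ^+ nn k.+1 s =
      par (y k) ^+ nn k s * par (y k.+1) ^+ odd (nn k.+1 s))%g.
    rewrite {1}nnS expgnDr -mul2n expgnA; congr (_ ^+ _ * _)%g.
    by rewrite expg2 parM// y2.
  by case: (odd _); rewrite ?expg1 ?expg0 ?mulg1 -?IH// parM.
have [L LU] : exists L : R -> W, forall s k,
    `|L s - U s k| <= 9 / 4 * `|x| * (2 / 3) ^+ k.
  have h s : exists l, forall k, `|l - U s k| <= 9 / 4 * `|x| * (2 / 3) ^+ k.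
    have [k|l lU] := @geometric_limit (U s) (3 / 4 * `|x|); first by have [] := Ux s k.
    by exists l => k; apply: le_trans (lU k) _; lra.
  by have [L LU] := choice h; exists L.
have Lr s : `|L s| <= r.
  rewrite -[L s](subrK (U s 0%N)); apply: le_trans (ler_normD _ _) _.
  by have := LU s 0%N; have [+ _] := Ux s 0%N; rewrite !expr0; lra.
(* Exponents differing by one give points differing by the single factor [y k]; with the tails [LU]
   this yields the continuity of [L]. *)
have Usucc k s s' : 0 <= s <= 1 -> 0 <= s' <= 1 -> nn k s' = (nn k s).+1 ->
    `|U s' k - U s k| <= 9 / 8 * `|x| * (2 / 3) ^+ k.
  move=> s01 s'01 e; have -> : U s' k = mm (U s k) (y k).
    apply: par_inj => //.
      rewrite -[mm _ _](subrK (U s k)); apply: le_trans (ler_normD _ _) _.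
      have := mm_near (Ur s k) (yr k); have := yx k; have [+ _] := Ux s k.
      by have := q1 k; have := q0 k; nra.
    by rewrite parU// e expgSr -parU// parM.
  by apply: (le_trans (mm_near (Ur s k) (yr k))); have := yx k; lra.
have Unear k s s' : 0 <= s <= 1 -> 0 <= s' <= 1 -> s <= s' -> s' - s <= (2 ^+ k)^-1 ->
    `|U s' k - U s k| <= 9 / 8 * `|x| * (2 / 3) ^+ k.
  move=> s01 s'01 ss' d; have p2 : 0 < 2 ^+ k :> R by rewrite exprn_gt0.
  have /andP[s0 s1] := s01; have /andP[s'0 s'1] := s'01.
  have /andP[a1 a2] := truncn_itv (mulr_ge0 (ltW p2) s0).
  have /andP[b1 b2] := truncn_itv (mulr_ge0 (ltW p2) s'0).
  have d' : 2 ^+ k * s' <= 2 ^+ k * s + 1.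
    have := ler_wpM2l (ltW p2) d; rewrite mulfV ?gt_eqF//; lra.
  have le1 : (nn k s <= nn k s')%N by apply: le_truncn; rewrite ler_pM2l.
  have le2 : (nn k s' <= (nn k s).+1)%N.
    rewrite -ltnS -(ltr_nat R) -natr1; apply: le_lt_trans b1 _.
    by apply: le_lt_trans d' _; rewrite ltrD2r.
  have : nn k s' = nn k s \/ nn k s' = (nn k s).+1.
    by move: le1 le2; move: (nn k s') (nn k s); clear; lia.
  case=> e; last exact: Usucc.
  rewrite (_ : U s' k = U s k) ?subrr ?normr0; first by have := q0 k; nra.
  by apply: par_inj => //; rewrite !parU// e.
have Lnear k s s' : 0 <= s <= 1 -> 0 <= s' <= 1 -> s <= s' -> s' - s <= (2 ^+ k)^-1 ->
    `|L s' - L s| <= 6 * `|x| * (2 / 3) ^+ k.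
  move=> s01 s'01 ss' d; have h := Unear k _ _ s01 s'01 ss' d.
  have h1 := LU s k; have h2 := LU s' k.
  rewrite (_ : L s' - L s = (L s' - U s' k) + (U s' k - U s k) - (L s - U s k)).
    apply: le_trans (ler_normB _ _) _.
    have := ler_normD (L s' - U s' k) (U s' k - U s k); have := q0 k; nra.
  by rewrite addrA subrK opprB addrA subrK.
have small (e : R) : 0 < e -> exists k, 6 * `|x| * (2 / 3) ^+ k < e.
  move=> e0; have : (fun k => 6 * `|x| * (2 / 3 : R) ^+ k) @ \oo --> (0 : R).
    rewrite -[X in _ --> X](mulr0 (6 * `|x|)); apply: cvgMr.
    by apply: cvg_expr; rewrite ger0_norm; lra.
  move=> /cvgrPdist_lt /(_ _ e0) [k _ /(_ k (leqnn k))].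
  rewrite sub0r normrN ger0_norm; first by exists k.
  by rewrite !mulr_ge0 ?(ltW (q0 k)).
(* The estimates hold on the unit interval only, whereas a binary curve must be continuous on the
   whole line. *)
pose c (s : R) := I_val (clampI s).
have c01 s : 0 <= c s <= 1 by exact: I_val_itv.
have cc : continuous c.
  exact: continuous_fcomp (@continuous_clampI R) (@continuous_I_val R).
have cE s : 0 <= s <= 1 -> c s = s.
  by move=> /andP[s0 s1]; rewrite /c I_val_clamp min_r// max_r.
exists (par \o L \o c); split.
  move=> s; apply: (@continuous_comp _ _ _ (L \o c) par); last by apply: par_continuous; exact: Lr.
  apply/cvgrPdist_lt => e e0; have [k ke] := small _ e0.
  have p2 : 0 < (2 ^+ k)^-1 :> R by rewrite invr_gt0 exprn_gt0.
  have := cc s => /cvgrPdist_lt /(_ _ p2); apply: filterS => s' /ltW.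
  rewrite ler_norml => /andP[d1 d2]; apply: le_lt_trans ke => /=.
  have [ss'|/ltW s's] := leP (c s) (c s').
    by rewrite distrC; apply: Lnear => //; lra.
  by apply: Lnear => //; lra.
exists (fun k => par (y k)); split => //.
  by move=> k; rewrite parM// y2.
move=> s s01 /=; rewrite cE//.
have UL : U s @ \oo --> L s.
  apply/cvgrPdist_lt => e e0; have [k ke] := small _ e0.
  exists k => // j /= kj; apply: le_lt_trans ke.
  apply: (le_trans (LU s j)).
  have : (2 / 3 : R) ^+ j <= (2 / 3) ^+ k by apply: ler_wiXn2l => //; lra.
  by have := q0 j; nra.
have h : (fun k => par (U s k)) @ \oo --> par (L s).
  by apply: (cvg_comp _ _ UL); apply: par_continuous; exact: Lr.
move: h; by apply: cvg_trans; apply: near_eq_cvg; near=> k; rewrite /= parU.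
Unshelve. all: by end_near. Qed.

End Curve.

End LocalLieGroup.

(** * Mean value inequality along a direction *)

Section DirectionalMVT.
Variables (R : realType) (V : normedModType R) (n : nat).
Local Notation W := 'rV[R]_n.

Lemma mx_norm_leP (v : W) (e : R) : 0 <= e ->
  (forall k, `|v ord0 k| <= e) -> `|v| <= e.
Proof.
move=> e0 ve; rewrite /Num.norm /= mx_normrE; apply/bigmax_leP; split => //= -[i k] _.
by rewrite (ord1 i); exact: ve.
Qed.

Lemma mx_coord_le (v : W) k : `|v ord0 k| <= `|v|.
Proof.
rewrite [leRHS]/Num.norm /= mx_normrE; apply/bigmax_geP; right => /=.
by exists (ord0, k).
Qed.

Lemma is_derive_coord (f : V -> W) (x w : V) (h : R) k :
  derivable f (x + h *: w) w ->
  is_derive h 1 (fun s : R => f (x + s *: w) ord0 k) ('D_w f (x + h *: w) ord0 k).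
Proof.
move=> df; have /= c := df.
have {c} : (fun h' : R => (h'^-1 *: ((f \o shift (x + h *: w)) (h' *: w) -
    f (x + h *: w))) ord0 k) @ 0^' --> 'D_w f (x + h *: w) ord0 k.
  exact: (cvg_comp _ _ c (@coord_continuous R 1 n ord0 k _)).
set g := (fun s : R => f (x + s *: w) ord0 k).
rewrite (_ : (fun h' : R => _) =
    (fun h' : R => h'^-1 *: ((g \o shift h) (h' *: 1) - g h))); last first.
  apply/funext => h'; rewrite !mxE /g /= /shift /= scaler1; congr (_ * (f _ _ _ - _)).
  by rewrite scalerDl addrCA.
move=> c; apply: DeriveDef; first by apply/cvg_ex; exists ('D_w f (x + h *: w) ord0 k).
exact: cvg_lim c.
Qed.

(** The real mean value theorem is applied to each coordinate; since the norm is the maximum norm,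
    no constant is lost. *)
Lemma directional_mvt (f : V -> W) (x w : V) (c : W) (s e : R) :
  (forall h, `|h| <= `|s| ->
     derivable f (x + h *: w) w /\ `|'D_w f (x + h *: w) - c| <= e) ->
  `|f (x + s *: w) - f x - s *: c| <= e * `|s|.
Proof.
move=> H; have e0 : 0 <= e.
  by have [|_ h] := H 0; [rewrite normr0|exact: le_trans h].
apply: mx_norm_leP; first by rewrite mulr_ge0.
move=> k; rewrite !mxE.
pose g (r : R) : R := f (x + r *: w) ord0 k.
have -> : f x ord0 k = g 0 by rewrite /g scale0r addr0.
rewrite -/(g s); pose dg (r : R) : R := 'D_w f (x + r *: w) ord0 k.
have dgP (r : R) : `|r| <= `|s| -> is_derive r 1 g (dg r).
  by move=> /H[df _]; exact: is_derive_coord.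
have dgc r : `|r| <= `|s| -> `|dg r - c ord0 k| <= e.
  move=> /H[_]; apply: le_trans; have := mx_coord_le ('D_w f (x + r *: w) - c) k.
  by rewrite !mxE.
have [r rs ->] : exists2 r, `|r| <= `|s| & g s - g 0 = dg r * s.
  have [s0|s0] := leP 0 s.
    have I r : r \in `[0, s] -> `|r| <= `|s|.
      by rewrite in_itv /= => /andP[? ?]; rewrite !ger0_norm.
    have [| |r rI] := @MVT_segment R g dg 0 s s0.
    - by move=> r rI; apply/dgP/I; apply: subset_itv_oo_cc.
    - by apply: derivable_within_continuous => r /I /dgP [].
    - by rewrite subr0 => e1; exists r => //; exact: I.
  have I r : r \in `[s, 0] -> `|r| <= `|s|.
    by rewrite in_itv /= => /andP[? ?]; rewrite !ler0_norm ?lerN2// ltW.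
  have [| |r rI] := @MVT_segment R g dg s 0 (ltW s0).
  - by move=> r rI; apply/dgP/I; apply: subset_itv_oo_cc.
  - by apply: derivable_within_continuous => r /I /dgP [].
  - by rewrite sub0r => e1; exists r; [exact: I|lra].
have := dgc _ rs; rewrite (_ : _ * s - _ = (dg r - c ord0 k) * s); last by ring.
by rewrite normrM => h; exact: ler_wpM2r.
Qed.

End DirectionalMVT.

(** * Perturbations of addition and their square roots *)

Section LocalGroupLaw.
Variables (R : realType) (n : nat).
Local Notation W := 'rV[R]_n.

(** One coordinate of [u] is replaced by that of [u'] at a time; the intermediate points [z j] stay
    in the same ball, and [n] steps cost the factor [n]. *)
Lemma coordinatewise_lipschitz (g : W -> W) (r e : R) :
  (forall (z : W) (i : 'I_n) h, `|z| <= r -> `|h| <= 2 * r ->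
     `|g (z + h *: delta_mx ord0 i) - g z - h *: delta_mx ord0 i| <= e * `|h|) ->
  0 <= e -> forall u u' : W, `|u| <= r -> `|u'| <= r ->
  `|g u' - g u - (u' - u)| <= n%:R * e * `|u' - u|.
Proof.
move=> H e0 u u' ur u'r; have r0 : 0 <= r by exact: le_trans ur.
pose z (j : nat) : W := \row_(k < n) (if (k < j)%N then u' ord0 k else u ord0 k).
have zr j : `|z j| <= r.
  apply: mx_norm_leP => // k; rewrite mxE; case: ifP => _.
    exact: le_trans (mx_coord_le _ _) u'r.
  exact: le_trans (mx_coord_le _ _) ur.
have zS (j : 'I_n) : z j.+1 = z j + (u' - u) ord0 j *: delta_mx ord0 j.
  apply/rowP => k; rewrite !mxE eqxx /=.
  have [->|kj] := eqVneq k j.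
    by rewrite ltnS leqnn ltnn mulr1 addrC subrK.
  by rewrite mulr0 addr0 ltnS leq_eqVlt val_eqE (negbTE kj).
have z0 : z 0%N = u by apply/rowP => k; rewrite mxE.
have zn : z n = u' by apply/rowP => k; rewrite mxE ltn_ord.
have d2 (j : 'I_n) : `|(u' - u) ord0 j| <= `|u' - u| by exact: mx_coord_le.
have dr : `|u' - u| <= 2 * r by apply: le_trans (ler_normB _ _) _; lra.
suff claim j : (j <= n)%N -> `|g (z j) - g u - (z j - u)| <= j%:R * e * `|u' - u|.
  by have := claim n (leqnn n); rewrite zn.
elim: j => [|j IH] jn; first by rewrite z0 !subrr normr0 !mul0r.
have := H (z j) (Ordinal jn) ((u' - u) ord0 (Ordinal jn)) (zr j) (le_trans (d2 _) dr).
set d := (u' - u) ord0 _; set dl := delta_mx _ _ => h.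
have zSj : z j.+1 = z j + d *: dl := zS (Ordinal jn).
rewrite -zSj in h.
have zz : z j.+1 - z j = d *: dl by rewrite zSj addrC addKr.
rewrite -zz in h.
rewrite (_ : g (z j.+1) - g u - (z j.+1 - u) =
  (g (z j.+1) - g (z j) - (z j.+1 - z j)) + (g (z j) - g u - (z j - u))); last first.
  by apply/rowP => k; rewrite !mxE; ring.
apply: le_trans (ler_normD _ _) _.
have h1 := IH (ltnW jn); have := d2 (Ordinal jn); rewrite -/d => hd.
rewrite -natr1 !mulrDl mul1r addrC; apply: lerD => //.
by apply: le_trans h _; rewrite ler_wpM2l.
Qed.

Lemma le_geometric (a b C : R) : 0 <= C ->
  (forall k, a <= b + C * (2 / 3) ^+ k) -> a <= b.
Proof.
move=> C0 H; apply/ler_addgt0Pl => e e0.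
have : (fun k => C * (2 / 3 : R) ^+ k) @ \oo --> (0 : R).
  rewrite -[X in _ --> X](mulr0 C); apply: cvgMr.
  by apply: cvg_expr; rewrite ger0_norm; lra.
move=> /cvgrPdist_lt /(_ _ e0) [k _ /(_ k (leqnn k))].
have q0 : 0 < (2 / 3 : R) ^+ k by rewrite exprn_gt0//; lra.
rewrite sub0r normrN ger0_norm; last by rewrite mulr_ge0// ltW.
by have := H k; lra.
Qed.

(** With [E u = mm u u - u - u], a square root of [y] is a fixed point of [u |-> (y - E u) / 2],
    which is a contraction of ratio 1/8 and preserves the ball of radius [2 / 3 * |y|]. *)
Lemma local_square_root (mm : W -> W -> W) (r : R) :
  mm 0 0 = 0 ->
  (forall u u' v v', `|u| <= r -> `|u'| <= r -> `|v| <= r -> `|v'| <= r ->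
    `|mm u' v' - mm u v - (u' - u) - (v' - v)| <= 1 / 8 * `|u' - u| + 1 / 8 * `|v' - v|) ->
  forall y, `|y| <= r -> exists2 u, `|u| <= 2 / 3 * `|y| & mm u u = y.
Proof.
move=> mm0 mmL y yr; have y0 : 0 <= `|y| by [].
pose E u : W := mm u u - u - u.
have E0 : E 0 = 0 by rewrite /E mm0 !subr0.
have EL u u' : `|u| <= r -> `|u'| <= r -> `|E u' - E u| <= 1 / 4 * `|u' - u|.
  move=> ur u'r; have := mmL _ _ _ _ ur u'r ur u'r.
  rewrite (_ : _ - _ - (u' - u) - _ = E u' - E u); first by lra.
  by apply/rowP => k; rewrite !mxE; ring.
pose T u : W := 2^-1 *: (y - E u).
have normT (u : W) : `|2^-1 *: u| = 1 / 2 * `|u|.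
  by rewrite normrZ ger0_norm; lra.
have Tr u : `|u| <= 2 / 3 * `|y| -> `|T u| <= 2 / 3 * `|y|.
  move=> uy; rewrite /T normT.
  have ur : `|u| <= r by lra.
  have := @EL 0 u; rewrite normr0 E0 !subr0 => /(_ (le_trans y0 yr) ur) h.
  by have := ler_normB y (E u); lra.
have TL u u' : `|u| <= 2 / 3 * `|y| -> `|u'| <= 2 / 3 * `|y| ->
    `|T u' - T u| <= 1 / 8 * `|u' - u|.
  move=> uy u'y; rewrite (_ : T u' - T u = 2^-1 *: (E u - E u')).
    have ur : `|u| <= r by lra.
    have u'r : `|u'| <= r by lra.
    by rewrite normT (distrC (E u)); have := EL _ _ ur u'r; lra.
  by apply/rowP => k; rewrite !mxE; ring.
pose a k := iter k T 0.
have ay k : `|a k| <= 2 / 3 * `|y|.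
  by elim: k => [|k IH] /=; [rewrite normr0; lra|exact: Tr].
have aS k : `|a k.+1 - a k| <= `|y| * (2 / 3) ^+ k.
  elim: k => [|k IH].
    rewrite /= /T E0 !subr0 normT expr0; lra.
  have h : `|a k.+2 - a k.+1| <= 1 / 8 * `|a k.+1 - a k| := TL _ _ (ay k) (ay k.+1).
  have p0 : 0 <= `|y| * (2 / 3 : R) ^+ k by rewrite mulr_ge0// exprn_ge0//; lra.
  by rewrite exprS mulrCA; lra.
have [l la] := geometric_limit aS.
have ly : `|l| <= 2 / 3 * `|y|.
  apply: (@le_geometric _ _ (3 * `|y|)); first lra.
  move=> k; rewrite -[l](subrK (a k)); apply: le_trans (ler_normD _ _) _.
  by have := la k; have := ay k; lra.
exists l => //.
suff : `|l - T l| <= 0.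
  rewrite normr_le0 subr_eq0 => /eqP lT.
  have e2 : l + l = y - E l.
    by rewrite {1 2}lT /T -scalerDl (_ : 2^-1 + 2^-1 = 1 :> R) ?scale1r//; lra.
  have -> : mm l l = E l + (l + l) by rewrite /E addrA !subrK.
  by rewrite e2 addrC subrK.
apply: (@le_geometric _ _ (5 * `|y|)); first lra.
move=> k; rewrite add0r (_ : l - T l = (l - a k.+1) + (T (a k) - T l)); last first.
  by rewrite /= addrA subrK.
apply: le_trans (ler_normD _ _) _.
have h1 := TL _ _ ly (ay k); rewrite (distrC (a k)) in h1.
have h2 := la k; have h3 := la k.+1; rewrite exprS in h3.
have q0 : 0 <= `|y| * (2 / 3 : R) ^+ k by rewrite mulr_ge0// exprn_ge0//; lra.
by lra.
Qed.

End LocalGroupLaw.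

Lemma near_ord (T : Type) (F : set_system T) (FF : Filter F) (n : nat)
    (P : 'I_n -> T -> Prop) :
  (forall i, \forall x \near F, P i x) -> \forall x \near F, forall i, P i x.
Proof.
move=> FP; suff H k : F [set x | forall i : 'I_n, (i < k)%N -> P i x].
  by apply: filterS (H n) => x h i; apply: h.
elim: k => [|k IH]; first by apply: filterS filterT.
have [kn|nk] := ltnP k n; last first.
  by apply: filterS IH => x h i _; apply: h; exact: leq_trans (ltn_ord i) nk.
apply: filterS2 IH (FP (Ordinal kn)) => x h hk i; rewrite ltnS leq_eqVlt.
by move=> /orP[/eqP ik|]; [rewrite (_ : i = Ordinal kn)//; exact: val_inj|exact: h].
Qed.

Section Charts.
Variables (R : realType) (n : nat) (M : topologicalType) (c : chart R n M).
Hypothesis hc : is_chart c.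

Lemma chart_coordK x : chart_dom c x -> chart_param c (chart_coord c x) = x.
Proof. by case: hc => _ _ cK _ _; exact: cK. Qed.

Lemma chart_paramP u : chart_cod c u ->
  chart_dom c (chart_param c u) /\ chart_coord c (chart_param c u) = u.
Proof. by move=> [x dx <-]; rewrite chart_coordK. Qed.

Lemma chart_coord_continuous x : chart_dom c x ->
  {for x, continuous (chart_coord c)}.
Proof.
case: hc => od _ _ + _; rewrite continuous_open_subspace// => h dx.
by apply: h; exact/mem_set.
Qed.

Lemma chart_param_continuous u : chart_cod c u ->
  {for u, continuous (chart_param c)}.
Proof.
case: hc => _ oc _ _; rewrite continuous_open_subspace// => h dx.
by apply: h; exact/mem_set.
Qed.

End Charts.

(** * Arcs and compact neighbourhoods at the identity of a Lie group *)

Section LieGroups.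
Variables (R : realType) (n : nat) (N : lieGroupType R n).
Local Notation W := 'rV[R]_n.

Variable c : chart R n N.
Hypotheses (Ac : lie_atlas c) (c1 : chart_dom c 1%g).

Let hc : is_chart c. Proof. by case: (@lie_atlasP R n N) => h _ _; exact: h. Qed.

Let u0 : W := chart_coord c 1%g.

Let cod_u0 : chart_cod c u0. Proof. by exists 1%g. Qed.

Let F (p : W * W) : W := chart_coord c (chart_param c p.1 * chart_param c p.2)%g.

Let Om : set (W * W) := [set p | [/\ chart_cod c p.1, chart_cod c p.2 &
  chart_dom c (chart_param c p.1 * chart_param c p.2)%g]].

Let Om_nbhs : nbhs (u0, u0) Om.
Proof.
have [od oc _ _ _] := hc.
have p1 : chart_param c u0 = 1%g by exact: chart_coordK.
have cod_near : nbhs u0 (chart_cod c) by exact: open_nbhs_nbhs.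
have : nbhs (chart_param c u0 * chart_param c u0)%g (chart_dom c).
  by rewrite p1 mulg1; exact: open_nbhs_nbhs.
move=> /nbhs_mulg[U Uu [U' U'u UU']].
have pU := chart_param_continuous hc cod_u0 Uu.
have pU' := chart_param_continuous hc cod_u0 U'u.
exists (chart_cod c `&` chart_param c @^-1` U, chart_cod c `&` chart_param c @^-1` U').
  by split; apply: filterI.
by move=> [u v] /= [[cu Uu'] [cv Uv]]; split => //; exact: UU'.
Qed.

Let F1 u : chart_cod c u -> F (u, u0) = u.
Proof.
move=> cu; rewrite /F /= (_ : chart_param c u0 = 1%g) ?mulg1; last exact: chart_coordK.
by have [] := chart_paramP hc cu.
Qed.

Let F2 u : chart_cod c u -> F (u0, u) = u.
Proof.
move=> cu; rewrite /F /= (_ : chart_param c u0 = 1%g) ?mul1g; last exact: chart_coordK.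
by have [] := chart_paramP hc cu.
Qed.

Let dF (w : W * W) (e : W) :
  (forall h : R, chart_cod c (u0 + h *: e) -> F ((u0, u0) + h *: w) = u0 + h *: e) ->
  'D_w F (u0, u0) = e.
Proof.
move=> H; apply: cvg_lim => //.
have [od oc _ _ _] := hc.
have ce : (fun h : R => u0 + h *: e) @ (0 : R) --> u0 + 0 *: e.
  by apply: cvgD; [exact: cvg_cst|exact: scalel_continuous].
rewrite scale0r addr0 in ce.
have cn : \forall h \near (0 : R), chart_cod c (u0 + h *: e).
  by apply: ce; exact: open_nbhs_nbhs.
apply: cvg_near_cst.
have : \forall h \near (0 : R)^', chart_cod c (u0 + h *: e) by exact: cvg_within cn.
apply: filter_app; have := @nbhs_dnbhs_neq R 0; apply: filterS => h /= h0 ch.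
rewrite /shift /= [h *: w + _]addrC H// (_ : F (u0, u0) = u0) ?F1//.
by rewrite addrC addKr scalerA mulVf ?scale1r.
Qed.

Let e_ i : W := delta_mx ord0 i.

(** At the identity the partial derivatives of the multiplication are those of addition, and they
    are continuous. The bound, multiplied by [n], is at most 1/8; the radius [4 * r] leaves room for
    the points [z + k *: e_ i] with [|z| <= r] and [|k| <= 2 * r]. *)
Let law_near : exists2 r : R, 0 < r & forall p : W * W,
  `|p.1 - u0| < 4 * r -> `|p.2 - u0| < 4 * r -> Om p /\ forall i : 'I_n,
  `|'D_(e_ i, 0) F p - e_ i| <= (8 * n.+1%:R)^-1 /\
  `|'D_(0, e_ i) F p - e_ i| <= (8 * n.+1%:R)^-1.
Proof.
have [_ HF] := @smooth_mulg R n N c c c Ac Ac Ac 1%N.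
have Om0 : Om (u0, u0) by exact: nbhs_singleton Om_nbhs.
have cD w : {for (u0, u0), continuous ('D_w F)}.
  by have [_ [h _]] := HF w; exact: h.
have e0 : 0 < (8 * n.+1%:R : R)^-1 by rewrite invr_gt0 mulr_gt0// ltr0n.
have near1 w (e : W) : 'D_w F (u0, u0) = e ->
    \forall p \near (u0, u0), `|'D_w F p - e| <= (8 * n.+1%:R)^-1.
  move=> De; have /cvgrPdistC_lt /(_ _ e0) := cD w; rewrite /= De.
  by apply: filterS => p /ltW.
have H1 i : 'D_(e_ i, 0) F (u0, u0) = e_ i.
  apply: dF => h ch; rewrite (_ : _ + _ = (u0 + h *: e_ i, u0)) ?F1//.
  by congr (_, _); rewrite /= scaler0 addr0.
have H2 i : 'D_(0, e_ i) F (u0, u0) = e_ i.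
  apply: dF => h ch; rewrite (_ : _ + _ = (u0, u0 + h *: e_ i)) ?F2//.
  by congr (_, _); rewrite /= scaler0 addr0.
have N1 := @near_ord _ _ (nbhs_filter (u0, u0)) n _ (fun i => near1 _ _ (H1 i)).
have N2 := @near_ord _ _ (nbhs_filter (u0, u0)) n _ (fun i => near1 _ _ (H2 i)).
have := @filterI _ _ (nbhs_filter (u0, u0)) _ _ Om_nbhs
  (@filterI _ _ (nbhs_filter (u0, u0)) _ _ N1 N2).
move=> [[A B] /= [/nbhs_ballP[a a0 aA] /nbhs_ballP[b b0 bB]] AB].
exists (Num.min a b / 4); first by rewrite divr_gt0// lt_min a0.
have -> : 4 * (Num.min a b / 4) = Num.min a b by field.
move=> p; rewrite !lt_min => /andP[pa _] /andP[_ pb].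
have ABp : (A `*` B) p.
  by split; [apply: aA|apply: bB]; rewrite -ball_normE /= distrC.
by have [Op [h1 h2]] := AB p ABp; split.
Qed.

(** The chart is recentred at [u0], so that the identity has coordinate 0 and [mm] is a perturbation
    of addition. *)
Lemma lie_binary_curves_chart :
  \forall z \near (1%g : N), exists sigma : R -> N, binary_curve z sigma.
Proof.
have [r r0 Hr] := law_near; have [od oc _ _ _] := hc.
have addKl (a b : W) : a + b - a = b by rewrite addrC addKr.
pose par (u : W) : N := chart_param c (u0 + u).
pose mm (u v : W) : W := F (u0 + u, u0 + v) - u0.
have Om_r u v : `|u| <= r -> `|v| <= r -> Om (u0 + u, u0 + v).
  by move=> ur vr; have [||//] := Hr (u0 + u, u0 + v); rewrite /= addKl; lra.
have cod_r u : `|u| <= r -> chart_cod c (u0 + u).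
  move=> ur; have z0r : `|0 : W| <= r by rewrite normr0 ltW.
  by have [] := Om_r u 0 ur z0r.
have par0 : par 0 = 1%g by rewrite /par addr0; exact: chart_coordK.
have parM u v : `|u| <= r -> `|v| <= r -> (par u * par v)%g = par (mm u v).
  move=> ur vr; have [_ _ dm] := Om_r _ _ ur vr.
  by rewrite /par /mm [u0 + (_ - _)]addrC subrK /F /= chart_coordK.
have par_inj u v : `|u| <= r -> `|v| <= r -> par u = par v -> u = v.
  move=> ur vr e; apply: (@addrI _ u0).
  have [_ <-] := chart_paramP hc (cod_r _ ur); have [_ <-] := chart_paramP hc (cod_r _ vr).
  by rewrite -/(par u) e.
have par_cont u : `|u| <= r -> {for u, continuous par}.
  move=> ur; apply: continuous_comp; last by apply: chart_param_continuous => //; exact: cod_r.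
  by apply: (@cvgD _ _ _ (nbhs u)); [exact: cvg_cst|exact: cvg_id].
have ne : n%:R * (8 * n.+1%:R)^-1 <= 1 / 8 :> R.
  rewrite ler_pdivrMr ?mulr_gt0 ?ltr0n// -[n.+1]addn1 natrD; lra.
have L1 v : `|v| <= r -> forall u u', `|u| <= r -> `|u'| <= r ->
    `|F (u0 + u', u0 + v) - F (u0 + u, u0 + v) - (u' - u)| <= 1 / 8 * `|u' - u|.
  move=> vr u u' ur u'r.
  have := @coordinatewise_lipschitz R n (fun z => F (u0 + z, u0 + v)) r (8 * n.+1%:R)^-1.
  move=> /(_ _ _ u u' ur u'r) h; apply: le_trans (h _ _) _ => {h}.
  - move=> z i h zr hr.
    have := @directional_mvt R _ n F (u0 + z, u0 + v) (e_ i, 0) (e_ i) h (8 * n.+1%:R)^-1.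
    have hE k : (u0 + z, u0 + v) + k *: (e_ i, 0) = (u0 + (z + k *: e_ i), u0 + v) :> W * W.
      by congr (_, _); rewrite /= ?scaler0 ?addr0 ?addrA.
    rewrite hE; apply => k kh; rewrite hE.
    have [||Op /(_ i)[h1 _]] := Hr (u0 + (z + k *: e_ i), u0 + v).
    + rewrite /= addKl; apply: le_lt_trans (ler_normD _ _) _.
      have : `|k *: e_ i| <= `|k|.
        rewrite normrZ ler_piMr//; apply: mx_norm_leP => // j.
        by rewrite mxE; case: (_ && _); rewrite ?normr1 ?normr0.
      by lra.
    + by rewrite /= addKl; lra.
    split => //; have [_ HF] := @smooth_mulg R n N c c c Ac Ac Ac 1%N.
    by have [dd _] := HF (e_ i, 0); exact: dd.
  - by rewrite invr_ge0 mulr_ge0// ler0n.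
  - by apply: ler_wpM2r.
have L2 u : `|u| <= r -> forall v v', `|v| <= r -> `|v'| <= r ->
    `|F (u0 + u, u0 + v') - F (u0 + u, u0 + v) - (v' - v)| <= 1 / 8 * `|v' - v|.
  move=> ur v v' vr v'r.
  have := @coordinatewise_lipschitz R n (fun z => F (u0 + u, u0 + z)) r (8 * n.+1%:R)^-1.
  move=> /(_ _ _ v v' vr v'r) h; apply: le_trans (h _ _) _ => {h}.
  - move=> z i h zr hr.
    have := @directional_mvt R _ n F (u0 + u, u0 + z) (0, e_ i) (e_ i) h (8 * n.+1%:R)^-1.
    have hE k : (u0 + u, u0 + z) + k *: (0, e_ i) = (u0 + u, u0 + (z + k *: e_ i)) :> W * W.
      by congr (_, _); rewrite /= ?scaler0 ?addr0 ?addrA.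
    rewrite hE; apply => k kh; rewrite hE.
    have [||Op /(_ i)[_ h1]] := Hr (u0 + u, u0 + (z + k *: e_ i)).
    + by rewrite /= addKl; lra.
    + rewrite /= addKl; apply: le_lt_trans (ler_normD _ _) _.
      have : `|k *: e_ i| <= `|k|.
        rewrite normrZ ler_piMr//; apply: mx_norm_leP => // j.
        by rewrite mxE; case: (_ && _); rewrite ?normr1 ?normr0.
      by lra.
    split => //; have [_ HF] := @smooth_mulg R n N c c c Ac Ac Ac 1%N.
    by have [dd _] := HF (0, e_ i); exact: dd.
  - by rewrite invr_ge0 mulr_ge0// ler0n.
  - by apply: ler_wpM2r.
have mmu0 u : `|u| <= r -> mm u 0 = u.
  by move=> ur; rewrite /mm addr0 F1 ?addKl//; exact: cod_r.
have mm_near u v : `|u| <= r -> `|v| <= r -> `|mm u v - u| <= 9 / 8 * `|v|.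
  move=> ur vr; have := L2 u ur 0 v; rewrite normr0 subr0 => /(_ (ltW r0) vr).
  have -> : F (u0 + u, u0 + v) - F (u0 + u, u0 + 0) = mm u v - u.
    by rewrite -[X in _ = _ - X](mmu0 u)// /mm opprB addrA subrK.
  move=> h; rewrite -[mm u v - u](subrK v); apply: le_trans (ler_normD _ _) _.
  by lra.
have mm_sqrt : forall y, `|y| <= r -> exists2 u, `|u| <= 2 / 3 * `|y| & mm u u = y.
  apply: local_square_root; first by rewrite mmu0// normr0 ltW.
  move=> u u' v v' ur u'r vr v'r.
  have -> : mm u' v' - mm u v - (u' - u) - (v' - v) =
      (F (u0 + u', u0 + v') - F (u0 + u, u0 + v') - (u' - u)) +
      (F (u0 + u, u0 + v') - F (u0 + u, u0 + v) - (v' - v)).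
    by apply/rowP => k; rewrite !mxE; ring.
  by apply: le_trans (ler_normD _ _) _; apply: lerD; [exact: L1|exact: L2].
have : \forall z \near (1%g : N), `|chart_coord c z - u0| < r / 8.
  have := chart_coord_continuous hc c1 => /cvgrPdistC_lt; apply.
  by rewrite divr_gt0.
apply: filterS2 (_ : nbhs (1%g : N) (chart_dom c)); last exact: open_nbhs_nbhs.
move=> z dz /ltW zr; have := exists_binary_curve par_cont par_inj par0 parM mm_near mm_sqrt zr.
by rewrite /par addrC subrK chart_coordK.
Qed.

Lemma lie_locally_compact_chart : exists2 U, nbhs (1%g : N) U & in_compact U.
Proof.
have [od oc _ _ _] := hc.
have /nbhs_ballP[e e0 eU] : nbhs u0 (chart_cod c) by exact: open_nbhs_nbhs.
pose B := [set u : W | `|u - u0| <= e / 2].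
have BU : B `<=` chart_cod c.
  move=> u /= ue; apply: eU; rewrite -ball_normE /= distrC; apply: le_lt_trans ue _.
  by have : 0 < e by []; lra.
have cB : compact B.
  apply: bounded_closed_compact.
    exists (`|u0| + e); split; first exact: num_real.
    move=> M uM u /= uB; rewrite -[u](subrK u0); apply: le_trans (ler_normD _ _) _.
    have {}uB : `|u - u0| <= e / 2 := uB; have {}e0 : 0 < e := e0.
    by lra.
  apply: (@preimage_closed _ _ (fun u : W => `|u - u0|) [set r | r <= _]).
    move=> u _; have h : (fun v : W => v - u0) @ u --> u - u0.
      by apply: (@cvgB _ _ _ (nbhs u)); [exact: cvg_id|exact: cvg_cst].
    exact: (@cvg_norm _ _ _ (nbhs u) _ _ _ h).
  exact: closed_le.
exists (chart_param c @` B).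
  have : \forall z \near (1%g : N), `|chart_coord c z - u0| < e / 2.
    have := chart_coord_continuous hc c1 => /cvgrPdistC_lt; apply.
    by rewrite divr_gt0.
  apply: filterS2 (_ : nbhs (1%g : N) (chart_dom c)); last exact: open_nbhs_nbhs.
  move=> z dz /ltW zr; exists (chart_coord c z) => //; exact: chart_coordK.
exists (chart_param c @` B) => //; apply: continuous_compact => //.
apply: continuous_in_subspaceT => u /set_mem Bu.
by apply: chart_param_continuous => //; exact: BU.
Qed.

End LieGroups.

Lemma lie_binary_curves (R : realType) (n : nat) (N : lieGroupType R n) :
  \forall z \near (1%g : N), exists sigma : R -> N, binary_curve z sigma.
Proof.
have [_ /(_ 1%g)[c Ac c1] _] := @lie_atlasP R n N.
exact: lie_binary_curves_chart Ac c1.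
Qed.

Lemma lie_locally_compact (R : realType) (n : nat) (N : lieGroupType R n) :
  exists2 U, nbhs (1%g : N) U & in_compact U.
Proof.
have [_ /(_ 1%g)[c Ac c1] _] := @lie_atlasP R n N.
exact: lie_locally_compact_chart Ac c1.
Qed.

(** * Twisted actions *)

Lemma zpow_conj (G : groupType) (x y : G) k : (zpow x k ^ y = zpow (x ^ y) k)%g.
Proof. by case: k => n /=; rewrite ?conjVg conjXg. Qed.

Lemma hom_on_zpow (R : realType) (G : groupType) (H : set G) (f : G -> R) x k :
  subgroup H -> hom_on H f -> H x -> f (zpow x k) = k%:~R * f x.
Proof.
move=> sH hf Hx; case: k => n /=; first by rewrite (hom_onX n sH hf).
by rewrite (hom_onV sH hf) ?(hom_onX n.+1 sH hf)// ?NegzE ?mulrNz ?mulNr//; exact: subgroupX.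
Qed.

(* For [N] with a tower [B] and [G = N * N], [S j] will be the set of pairs [p] with
   [p.1 / p.2] in [B j], so that [S j (p ^ (u, 1))] means that the twisted action
   [u |-> p.1 * u / p.2] fixes the coset of [u] modulo [B j]. *)
Section TwistedStabilizers.
Variables (R : realType) (G : groupType).
Local Open Scope group_scope.
Variables (i : nat) (S : nat -> set G) (phi : nat -> G -> R) (M Delta P : set G).
Hypotheses (nG : nilpotent_group G) (S0 : S 0%N = [set: G])
  (sS : forall j, (j <= i)%N -> subgroup (S j))
  (hphi : forall j, (j <= i)%N -> hom_on (S j) (phi j))
  (SS : forall j, (j < i)%N -> S j.+1 = [set x | S j x /\ phi j x = 0%R])
  (sM : subgroup M) (nM : normalized M [set: G])
  (MS : forall j x, (j <= i)%N -> M x -> S j x /\ phi j x = 0%R)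
  (rootM : forall x l, exists y, M (x^-1 * y ^+ l.+1))
  (sD : subgroup Delta)
  (ratD : forall j d, (j <= i)%N -> Delta d -> S j d ->
     exists k (z : int), (k.+1%:R * phi j d = z%:~R)%R)
  (sP : subgroup P) (PD : P `<=` Delta).

Definition twisted_nonzero j V := exists2 p, P p & S j (p ^ V) /\ phi j (p ^ V) <> 0%R.

Let adjoin (Q : set G) : set G := [set x | exists2 p, Q p & M (p^-1 * x)].

Let adjoin_subgroup Q : subgroup Q -> subgroup (adjoin Q).
Proof.
have [M1 MM MV] := sM; move=> [Q1 QM QV]; split.
- by exists 1; rewrite // invg1 mul1g.
- move=> x y [p Qp px] [q Qq qy]; exists (p * q); first exact: QM.
  have -> : (p * q)^-1 * (x * y) = ((p^-1 * x) ^ q) * (q^-1 * y).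
    by rewrite /conjg !gnorm.
  by apply: MM => //; exact: nM.
- move=> x [p Qp px]; exists p^-1; first exact: QV.
  have -> : p^-1^-1 * x^-1 = ((p^-1 * x)^-1) ^ p^-1.
    by rewrite /conjg !gnorm.
  by apply: nM => //; exact: MV.
Qed.

Let S_root j x l : (j <= i)%N -> S j (x ^+ l.+1) -> S j x.
Proof.
elim: j => [|j IH] ji; first by rewrite S0.
rewrite SS// => -[/= Sx]; have {}Sx := IH (ltnW ji) Sx.
rewrite (hom_onX l.+1 (sS (ltnW ji)) (hphi (ltnW ji)) Sx) => /eqP.
by rewrite mulf_eq0 pnatr_eq0 /= => /eqP.
Qed.

Let S_mod j x y : (j <= i)%N -> M (x^-1 * y) -> S j x -> S j y /\ phi j y = phi j x.
Proof.
move=> ji mxy Sx; have [Sm m0] := MS ji mxy; have [_ SM _] := sS ji.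
have -> : y = x * (x^-1 * y) by rewrite !gnorm.
by split; [exact: SM|rewrite (hphi ji Sx Sm) m0 addr0].
Qed.

(** This provides the roots needed for the transport, while the values of [phi] remain rational on
    [isol Delta]. *)
Let isol (Q : set G) : set G := [set x | exists l, adjoin Q (x ^+ l.+1)].

Let isol_subgroup Q : subgroup Q -> subgroup (isol Q).
Proof. by move=> sQ; apply: (isolator_subgroup nG); exact: adjoin_subgroup. Qed.

Let adjoin_mem Q x : Q x -> adjoin Q x.
Proof. by move=> Qx; exists x => //; rewrite mulVg; case: sM. Qed.

Let isol_mem Q x : Q x -> isol Q x.
Proof. by move=> Qx; exists 0%N; rewrite expg1; exact: adjoin_mem. Qed.

Let isolP_D x : isol P x -> isol Delta x.
Proof. by move=> [l [p Pp px]]; exists l, p => //; exact: PD. Qed.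

Let rat_isol j x : (j <= i)%N -> isol Delta x -> S j x ->
  exists k (z : int), (k.+1%:R * phi j x = z%:~R)%R.
Proof.
move=> ji [l [d Dd dx]] Sx.
have [_ MM MV] := sM.
have dx' : M ((x ^+ l.+1)^-1 * d) by have := MV _ dx; rewrite !gnorm.
have [Sd dE] := S_mod ji dx' (subgroupX l.+1 (sS ji) Sx).
have [k [z kz]] := ratD ji Dd Sd; exists (k.+1 * l.+1).-1%N, z.
by rewrite -kz dE (hom_onX l.+1 (sS ji) (hphi ji) Sx) mulrA -natrM.
Qed.

(* By induction on [j <= i], some [rho] in the isolator of [P * M] moves the coset
   of [U] modulo [S j] to that of [V]: a rational power of an element with nonzero
   value at level [j] corrects the difference. Conjugation by [rho] then carries
   the nonzero value at level [i] from [U] to [V]. *)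
Lemma twisted_nonzero_transport (T : set G) U V : T `<=` Delta -> T U -> T V ->
  (forall j W, (j < i)%N -> T W -> twisted_nonzero j W) ->
  twisted_nonzero i U -> twisted_nonzero i V.
Proof.
move=> TD TU TV NZ [p0 Pp0 [Sp0 np0]].
have [P1 PM PV] := sP; have [M1 MM MV] := sM.
have [Q1 QM QV] := isol_subgroup sP.
have [I1 IM IV] := isol_subgroup sD.
have key : forall j, (j <= i)%N -> exists2 rho, isol P rho & S j (V^-1 * rho * U).
  elim=> [_|j IH ji]; first by exists 1; rewrite ?S0.
  have [rho Qrho] := IH (ltnW ji); set w := _ * U => Sw.
  have Dw : isol Delta w.
    apply: (IM); last exact/isol_mem/TD.
    by apply: (IM); [exact/IV/isol_mem/TD|exact: isolP_D].
  have {IH} ji' := ltnW ji.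
  have [p Pp [Spv npv]] := NZ j V ji TV.
  have Dpv : isol Delta (p ^ V).
    rewrite /conjg; have DV := isol_mem (TD _ TV).
    by apply: (IM); [exact: IV|apply: (IM) => //; apply/isol_mem/PD].
  have [a1 [z1 e1]] := rat_isol ji' Dw Sw.
  have [a2 [z2 e2]] := rat_isol ji' Dpv Spv.
  have z20 : z2 != 0%R.
    apply/eqP => z0; apply: npv; move: e2; rewrite z0 => /eqP.
    by rewrite mulf_eq0 pnatr_eq0 /= => /eqP.
  (* Both values are rational and the second is nonzero, so some integral multiples of them
     cancel. *)
  have [b [m e]] : exists b (m : int),
      (b.+1%:R * phi j w = - (m%:~R * phi j (p ^ V)))%R.
    exists (a1.+1 * `|z2|).-1%N, (- (Num.sg z2 * z1 * a2.+1%:Z))%R.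
    rewrite prednK ?muln_gt0 ?absz_gt0//.
    have zz : (`|z2|%:R = (Num.sg z2)%:~R * z2%:~R :> R)%R.
      by rewrite -intrM -[LHS]/((Posz `|z2|)%:~R)%R abszE normrEsg.
    rewrite natrM zz rmorphN !rmorphM/= mulNr opprK.
    transitivity ((a1.+1%:R * phi j w) * ((Num.sg z2)%:~R * z2%:~R))%R; first by ring.
    by rewrite e1 -e2 -[(a2.+1%:Z)%:~R%R]/(a2.+1%:R)%R; ring.
  (* [sigma] plays the role of [p] to the power [m / b.+1]; it need not lie in [P], only in its
     isolator. *)
  have [sigma Msigma] := rootM (zpow p m) b.
  have Pm : P (zpow p m) by exact: zpow_mem.
  have Qsigma : isol P sigma by exists b, (zpow p m).
  have Mpow : M ((zpow (p ^ V) m)^-1 * (sigma ^ V) ^+ b.+1).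
    rewrite -zpow_conj -conjXg -conjVg -conjMg; exact: nM.
  have Spow : S j (zpow (p ^ V) m) by apply: zpow_mem => //; exact: sS.
  have [Ss es] := S_mod ji' Mpow Spow.
  have {Ss} Ss : S j (sigma ^ V) by exact: S_root Ss.
  move: es; rewrite (hom_onX b.+1 (sS ji') (hphi ji') Ss).
  rewrite (hom_on_zpow m (sS ji') (hphi ji') Spv) => es.
  exists (sigma * rho); first exact: QM.
  have -> : V^-1 * (sigma * rho) * U = sigma ^ V * w.
    by rewrite /w /conjg !gnorm.
  rewrite SS//; split; first by have [_ SM _] := sS ji'; exact: SM.
  rewrite (hphi ji' Ss Sw); apply: (@mulfI _ b.+1%:R%R); first by rewrite pnatr_eq0.
  by rewrite mulrDr es e mulr0 addrN.
have [rho Qrho Sw] := key i (leqnn i); set w := _ * U in Sw.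
have si := sS (leqnn i); have [Si1 SiM SiV] := si.
have Qtau : isol P (p0 ^ rho^-1).
  rewrite /conjg invgK; apply: (QM) => //; apply: (QM); last exact: QV.
  exact: isol_mem.
have tauV : (p0 ^ rho^-1) ^ V = (p0 ^ U) ^ w^-1 by rewrite /w /conjg !gnorm.
have Stau : S i ((p0 ^ rho^-1) ^ V).
  by rewrite tauV /conjg; apply: (SiM); [rewrite invgK|apply: (SiM) => //; exact: SiV].
(* The two arguments are conjugate by [w], which lies in [S i], where [phi i] is a homomorphism. *)
have phitau : phi i ((p0 ^ rho^-1) ^ V) = phi i (p0 ^ U).
  by rewrite tauV (hom_onJ si (hphi (leqnn i)))//; exact: SiV.
have [l [p Pp Mp]] := Qtau; exists p => //.
have Mp' : M ((((p0 ^ rho^-1) ^ V) ^+ l.+1)^-1 * p ^ V).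
  rewrite -conjXg -conjVg -conjMg; apply: (nM) => //.
  by have := MV _ Mp; rewrite !gnorm.
have [Sp pE] := S_mod (leqnn i) Mp' (subgroupX l.+1 si Stau).
split=> //; rewrite pE (hom_onX l.+1 si (hphi (leqnn i)) Stau) phitau.
by move=> /eqP; rewrite mulf_eq0 pnatr_eq0 /= => /eqP.
Qed.

End TwistedStabilizers.

(** * Counting twisted orbits along the tower *)

Section TowerCounting.
Variables (R : realType) (N : TopologicalGroup.type).
Local Open Scope group_scope.
Variables (D : set N) (r : nat) (B : nat -> set N) (t : nat -> N -> R)
  (a : nat -> R -> N).
Hypotheses (nN : nilpotent_group N) (sD : subgroup D) (tw : tower D r B t a)
  (B0 : B 0%N = [set: N]).

Lemma tower_decreasing j k : (j <= k <= r)%N -> B k `<=` B j.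
Proof.
move=> /andP[+ kr]; elim: k kr => [_|k IH kr]; first by rewrite leqn0 => /eqP->.
rewrite leq_eqVlt => /orP[/eqP->//|jk] x.
by have [_ _ _ -> _ _ _] := tower_step_at tw kr; move=> [/(IH (ltnW kr) jk)].
Qed.

Lemma tower_roots j x l : (j <= r)%N -> exists y, B j (x^-1 * y ^+ l.+1).
Proof.
elim: j => [|j IH] jr; first by exists x; rewrite B0.
have [y] := IH (ltnW jr); set c := _ * _ => Bc.
have [ht _ tJ -> [_ Ba ta _] _ _] := tower_step_at tw jr.
have [sB _ nB _ _] := tower_group_at tw (ltnW jr); have [B1 BM BV] := sB.
(* Multiplying [y] by [e] adds [l.+1] times [t j e] to [t j c], by invariance of [t j]; this value
   makes the sum zero. *)
pose e := a j (- t j c / l.+1%:R)%R.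
have te : t j e = (- t j c / l.+1%:R)%R by exact: ta.
have Be : B j e by exact: Ba.
have key m : exists2 d, B j d /\ t j d = (m%:R * t j e)%R & (y * e) ^+ m = y ^+ m * d.
  elim: m => [|m [d [Bd dE] IHm]].
    by exists 1; rewrite ?expg0 ?mulg1// mul0r (hom_on1 sB ht).
  exists (d ^ y * e); first split.
  - by apply: (BM) => //; exact: nB.
  - by rewrite ht//; [rewrite tJ// dE -natr1; lra|exact: nB].
  - by rewrite expgSr IHm expgSr /conjg !gnorm.
have [d [Bd dE] yE] := key l.+1; exists (y * e).
rewrite yE mulgA -/c; split; first exact: BM.
rewrite ht// dE te mulrC divfK ?pnatr_eq0//; lra.
Qed.

(** Modulo the integers the values on the powers of [d] form a finite set, so two powers have values
    differing by an integer. *)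
Lemma tower_rational j d : (j < r)%N -> D d -> B j d ->
  exists k (z : int), (k.+1%:R * t j d = z%:~R)%R.
Proof.
move=> jr Dd Bd; have [ht _ _ _ _ [s sP] _] := tower_step_at tw jr.
have [sB _ _ _ _] := tower_group_at tw (ltnW jr).
have /choice[e eP] : forall n : nat, exists e : R, e \in s /\
    exists k : int, t j (d ^+ n) = (e + k%:~R)%R.
  move=> n; have [e es ek] := sP (d ^+ n) (subgroupX n sD Dd) (subgroupX n sB Bd).
  by exists e.
have : ~~ uniq (map e (iota 0 (size s).+1)).
  apply/negP => /(@uniq_leq_size _ _ s) h.
  have : (size (map e (iota 0 (size s).+1)) <= size s)%N.
    by apply: h => _ /mapP[n _ ->]; have [] := eP n.
  by rewrite size_map size_iota ltnn.
move=> /(uniqPn 0%R)[m [n [mn]]]; rewrite size_map size_iota => ns.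
rewrite !(nth_map 0%N) ?size_iota ?nth_iota// ?(ltn_trans mn)// !add0n => emn.
have [_ [k1 e1]] := eP m; have [_ [k2 e2]] := eP n.
move: e1 e2; rewrite !(hom_onX _ sB ht Bd) emn => e1 e2.
exists (n - m).-1%N, (k2 - k1)%R; rewrite prednK ?subn_gt0//.
rewrite natrB ?(ltnW mn)// mulrBl e1 e2 rmorphB /=; lra.
Qed.

Lemma tower_finite_values j (M : R) : (j < r)%N -> exists s : seq N,
  (forall d, d \in s -> D d /\ B j d) /\
  forall w, D w -> B j w -> (`|t j w| <= M)%R -> exists2 d, d \in s & t j d = t j w.
Proof.
move=> jr; have [_ _ _ _ _ [s sP] _] := tower_step_at tw jr.
pose M' := (M + \sum_(e <- s) `|e|)%R.
have fZ := @bounded_int_finite R M'.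
have /finite_seqP[v vE] : finite_set [set (x.1 + x.2%:~R)%R | x in
    [set` s] `*` [set k : int | (`|k%:~R : R| <= M')%R]].
  by apply/finite_image/finite_setX => //; exact: finite_seq.
have /choice[f fP] : forall x : R, exists d, (exists2 w, D w /\ B j w & t j w = x) ->
    (D d /\ B j d) /\ t j d = x.
  move=> x; have [[w Dw wx]|h] := pselect (exists2 w, D w /\ B j w & t j w = x).
    by exists w.
  by exists 1 => /h.
exists [seq f x | x <- [seq x <- v | `[< exists2 w, D w /\ B j w & t j w = x >]]].
split.
  by move=> d /mapP[x]; rewrite mem_filter => /andP[/asboolP /fP[Df _] _] ->.
move=> w Dw Bw wM; have h : exists2 w', D w' /\ B j w' & t j w' = t j w by exists w.
exists (f (t j w)); last by have [] := fP _ h.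
apply/mapP; exists (t j w) => //; rewrite mem_filter; apply/andP; split; first exact/asboolP.
have [e es [k wE]] := sP w Dw Bw.
have : [set` v] (t j w).
  rewrite -vE; exists (e, k) => //; split => //=.
  have -> : (k%:~R = t j w - e)%R by rewrite wE; lra.
  apply: le_trans (ler_normB _ _) _; rewrite /M' (big_rem e)//=.
  have : (0 <= \sum_(y <- rem e s) `|y|)%R by rewrite sumr_ge0.
  by lra.
by [].
Qed.

Variable P : set (N * N).
Hypotheses (sP : subgroup P) (PD : forall p, P p -> D p.1 /\ D p.2).

Let S j : set (N * N) := [set p | B j (p.1 / p.2)].
Let phi j (p : N * N) : R := t j (p.1 / p.2).

Let S_subgroup j : (j <= r)%N -> subgroup (S j).
Proof.
move=> jr; have [[B1 BM BV] _ nB _ _] := tower_group_at tw jr; split.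
- by rewrite /S /= divg1.
- move=> x y Sx Sy; rewrite /S /=.
  have -> : x.1 * y.1 / (x.2 * y.2) = (y.1 / y.2) ^ x.1^-1 * (x.1 / x.2).
    by rewrite /conjg !gnorm.
  by apply: BM => //; exact: nB.
- move=> x Sx; rewrite /S /=.
  have -> : x.1^-1 / x.2^-1 = ((x.1 / x.2)^-1) ^ x.1 by rewrite /conjg !gnorm.
  by apply: nB; exact: BV.
Qed.

Let phi_hom j : (j < r)%N -> hom_on (S j) (phi j).
Proof.
move=> jr x y Sx Sy; have [ht _ tJ _ _ _ _] := tower_step_at tw jr.
have [_ _ nB _ _] := tower_group_at tw (ltnW jr).
rewrite /phi /=.
have -> : x.1 * y.1 / (x.2 * y.2) = (y.1 / y.2) ^ x.1^-1 * (x.1 / x.2).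
  by rewrite /conjg !gnorm.
by rewrite ht ?tJ 1?addrC//; exact: nB.
Qed.

Lemma nilpotent_square : nilpotent_group (N * N)%type.
Proof.
have [k kT] := nN; exists k.
have : upper_central k = [set: N] by [].
suff H l : forall p : N * N, upper_central l p.1 -> upper_central l p.2 -> upper_central l p.
  by move=> e; rewrite eqEsubset; split=> // p _; apply: H; rewrite e.
elim: l => [[x y] /= -> ->//|l IH] p h1 h2 q.
by apply: IH; [exact: h1|exact: h2].
Qed.

Let conj_left p u : p ^ (u, 1) = (p.1 ^ u, p.2) :> N * N.
Proof. by case: p => p1 p2; rewrite /conjg; congr (_, _); rewrite /= !gnorm. Qed.

Definition twisted_vanishing i := forall u p, D u -> P p ->
  B i (p.1 ^ u / p.2) -> t i (p.1 ^ u / p.2) = 0%R.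

(** One nonzero value at each level up to [i] is spread to all cosets by
    [twisted_nonzero_transport], taken modulo the pairs with both entries in [B i.+1]; strong
    induction supplies the lower levels. *)
Lemma twisted_nonzero_all i : (i < r)%N ->
  (forall j, (j <= i)%N -> ~ twisted_vanishing j) ->
  forall u, D u -> twisted_nonzero S phi P i (u, 1).
Proof.
elim/ltn_ind: i => i IH ir NV u Du.
have [D1 DM DV] := sD.
have [u0 Du0 Nu0] : exists2 u0, D u0 & twisted_nonzero S phi P i (u0, 1).
  have := NV i (leqnn i); apply: contra_notP => h u0 p Du0 Pp Bp.
  apply/not_notP => np; apply: h; exists u0 => //; exists p => //.
  by rewrite conj_left.
have [sB1 cB1 nB1 _ _] := tower_group_at tw ir; have [B1 BM BV] := sB1.
pose M : set (N * N) := [set p | B i.+1 p.1 /\ B i.+1 p.2].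
apply: (@twisted_nonzero_transport R _ i S phi M [set p | D p.1 /\ D p.2] P
  nilpotent_square _ _ _ _ _ _ _ _ _ _ sP _ [set p | D p.1 /\ p.2 = 1] (u0, 1) (u, 1)) => //.
- by rewrite eqEsubset; split=> // p _; rewrite /S /= B0.
- by move=> j ji; apply: S_subgroup; lia.
- by move=> j ji; apply: phi_hom; lia.
- move=> j ji; have jr : (j < r)%N by lia.
  by have [_ _ _ e _ _ _] := tower_step_at tw jr; rewrite /S e.
- split=> //.
  + by move=> x y [x1 x2] [y1 y2]; split; exact: BM.
  + by move=> x [x1 x2]; split; exact: BV.
- by move=> x y [x1 x2] _; split; exact: nB1.
- move=> j x ji [x1 x2]; have jr : (j < r)%N by lia.
  have : B j.+1 (x.1 / x.2).
    apply: (@tower_decreasing j.+1 i.+1); first lia.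
    by apply: BM => //; exact: BV.
  by have [_ _ _ -> _ _ _] := tower_step_at tw jr.
- move=> x l; have [y1 h1] := tower_roots x.1 l ir; have [y2 h2] := tower_roots x.2 l ir.
  exists (y1, y2); have e : (y1, y2) ^+ l.+1 = (y1 ^+ l.+1, y2 ^+ l.+1) :> N * N.
    by elim: l.+1 => // k IHk; rewrite !expgS IHk.
  by rewrite e.
- split=> //.
  + by move=> x y [x1 x2] [y1 y2]; split; exact: DM.
  + by move=> x [x1 x2]; split; exact: DV.
- move=> j d ji [d1 d2] Sd; apply: tower_rational => //; first lia.
  by apply: DM => //; exact: DV.
- by move=> [x y] /= [Dx ->].
- move=> j [w w'] ji [/= Dw ->]; apply: IH => //; first lia.
  by move=> k kj; apply: NV; lia.
Qed.

Definition finitely_twisted j := exists s : seq N, (forall v, v \in s -> D v) /\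
  forall u, D u -> exists2 v, v \in s & exists2 p, P p & B j (u^-1 * p.1 * v / p.2).

(** Inside the coset of [v], powers of a stabilizing pair shift [t j] by multiples of a nonzero
    number, so only a bounded range of values remains, and [D] takes finitely many values there. *)
Lemma finitely_twistedS j : (j < r)%N ->
  (forall u, D u -> twisted_nonzero S phi P j (u, 1)) ->
  finitely_twisted j -> finitely_twisted j.+1.
Proof.
move=> jr NZ [s [sDs sP']]; have [D1 DM DV] := sD; have [P1 PM PV] := sP.
have [ht _ tJ BE _ _ _] := tower_step_at tw jr.
have [sB _ nB _ _] := tower_group_at tw (ltnW jr); have [B1 BM BV] := sB.
have /choice[pv pvP] : forall v, exists p, D v ->
    [/\ P p, S j (p ^ (v, 1)) & phi j (p ^ (v, 1)) <> 0%R].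
  move=> v; have [Dv|nD] := pselect (D v); last by exists 1 => /nD.
  by have [p Pp [Sp np]] := NZ v Dv; exists p.
pose lam v := phi j (pv v ^ (v, 1)).
have /choice[F FP] := fun v => tower_finite_values `|lam v| jr.
exists [seq v * d | v <- s, d <- F v]; split.
  move=> _ /allpairsPdep[v [d [/sDs Dv dF ->]]]; apply: DM => //.
  by have [+ _] := FP v; move=> /(_ _ dF)[].
move=> u Du; have [v vs [q Pq Bq]] := sP' u Du; have Dv := sDs v vs.
have [Dq1 Dq2] := PD Pq.
pose w := v^-1 * q.1^-1 * u * q.2.
have Bw : B j w.
  have -> : w = ((u^-1 * q.1 * v / q.2)^-1) ^ q.2 by rewrite /w /conjg !gnorm.
  by apply: nB; exact: BV.
have Dw : D w by rewrite /w; do !(apply: (DM) => //); exact: DV.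
have [Pp Sp np] := pvP v Dv.
(* Euclidean division of [t j w] by [lam v]: the remainder is at most [|lam v|] in absolute
   value. *)
pose m : int := (- Num.floor (t j w / lam v))%R.
pose x := zpow (pv v) m.
have Px : P x by exact: zpow_mem.
have [Dx1 Dx2] := PD Px.
have Sx : S j (x ^ (v, 1)).
  by rewrite /x zpow_conj; apply: zpow_mem => //; exact: S_subgroup (ltnW jr).
have phix : phi j (x ^ (v, 1)) = (m%:~R * lam v)%R.
  by rewrite /x zpow_conj (hom_on_zpow m (S_subgroup (ltnW jr)) (phi_hom jr)).
rewrite conj_left in Sx phix.
pose w' := x.1 ^ v / x.2 * w ^ x.2^-1.
have Bw' : B j w' by apply: (BM) => //; exact: nB.
have Dw' : D w'.
  by rewrite /w' /conjg; do ?[apply: (DM) => //|apply: (DV) => //].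
have tw' : t j w' = (t j w + m%:~R * lam v)%R.
  by rewrite /w' ht//; [rewrite tJ// -phix addrC|exact: nB].
have tw'_le : (`|t j w'| <= `|lam v|)%R.
  have l0 : lam v != 0%R by exact/eqP.
  have -> : (t j w' = (t j w / lam v - (Num.floor (t j w / lam v))%:~R) * lam v)%R.
    by rewrite tw' /m mulrBl divfK// rmorphN mulNr.
  rewrite normrM ler_piMl//; have := floor_itv (t j w / lam v)%R.
  by rewrite intrD; move=> /andP[h1 h2]; rewrite ger0_norm; lra.
have [_ /(_ w' Dw' Bw' tw'_le)[d dF td]] := FP v.
exists (v * d); first by apply/allpairsPdep; exists v, d.
have [/(_ _ dF)[Dd Bd] _] := FP v.
exists (q * x^-1); first by apply: PM => //; exact: PV.
have -> : u^-1 * (q * x^-1).1 * (v * d) / (q * x^-1).2 =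
    (w'^-1 * d) ^ (q * x^-1).2^-1.
  by rewrite /w' /w /= /conjg !gnorm.
have [_ _ nB' _ _] := tower_group_at tw jr; apply: nB'; rewrite BE /=.
by split; [apply: BM => //; exact: BV|rewrite ht ?(hom_onV sB ht) ?td ?addNr//; exact: BV].
Qed.

(* If every level had a nonvanishing element, every level would split into finitely
   many orbits, hence so would [D]. *)
Lemma exists_twisted_vanishing :
  (forall s : seq N, exists2 u, D u &
     forall v p, v \in s -> P p -> u <> p.1 * v / p.2) ->
  exists2 i, (i < r)%N & twisted_vanishing i.
Proof.
move=> inf; apply: contrapT => NV; have [D1 DM DV] := sD; have [P1 PM PV] := sP.
have {}NV i : (i < r)%N -> ~ twisted_vanishing i by move=> ir h; apply: NV; exists i.
have fin j : (j <= r)%N -> finitely_twisted j.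
  elim: j => [_|j IH jr].
    exists [:: 1]; split=> [v|u Du]; first by rewrite inE => /eqP->.
    by exists 1; [rewrite inE|exists 1 => //; rewrite B0].
  apply: finitely_twistedS (IH (ltnW jr)) => //; apply: twisted_nonzero_all => // k kj.
  by apply: NV; lia.
have [s [sDs sE]] := fin r (leqnn r).
have /finite_seqP[e eE] := tower_end tw.
have [u Du nu] := inf [seq v * d | v <- s, d <- e].
have [v vs [p Pp]] := sE u Du; have [Dp1 Dp2] := PD Pp; have Dv := sDs v vs.
set c := _ / _ => Bc; pose w := (c^-1) ^ p.2.
have [[_ _ BV] _ nB _ _] := tower_group_at tw (leqnn r).
have : (D `&` B r) w.
  split; last by apply: nB; exact: BV.
  by rewrite /w /c /conjg; do ?[apply: (DM) => //|apply: (DV) => //].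
rewrite eE => ew; apply: (nu (v * w) p) => //; first by apply/allpairsPdep; exists v, w.
by rewrite /w /c /conjg !gnorm.
Qed.

End TowerCounting.

(** * Coset projections and path lifting *)

(** These are the properties of the projection onto left cosets that the lifting arguments use,
    stated directly for [Y] so that the homeomorphism can be forgotten. *)
Definition coset_projection (N : TopologicalGroup.type) (Y : topologicalType)
    (D : set N) (q : N -> Y) :=
  [/\ continuous q, forall U, open U -> open (q @` U), forall y, exists n, q n = y &
    forall n n', q n = q n' <-> D (n^-1 * n')%g].

Lemma exists_coset_projection (N : TopologicalGroup.type) (Gamma : groupClosed N)
    (Y : topologicalType) :
  homeomorphic Y (coset_space Gamma) ->
  exists q : N -> Y, coset_projection [set` Gamma] q.
Proof.
move=> [h [k [ch ck hK kK]]].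
pose p (n : N) : coset_space Gamma := (\pi_(coset_space Gamma) n)%qT.
have cp : continuous p by exact: pi_continuous.
have pE n n' : p n = p n' <-> [set` Gamma] (n^-1 * n')%g.
  by split=> [/eqmodP//|h']; apply/eqmodP.
exists (k \o p); split.
- by move=> n; apply: continuous_comp; [exact: cp|exact: ck].
- move=> U oU.
  have -> : (k \o p) @` U = h @^-1` (p @` U).
    rewrite eqEsubset; split=> [_ [n Un <-]|y [n Un py]] /=.
      by exists n => //; rewrite kK.
    by exists n => //=; rewrite py hK.
  apply: open_comp; first by move=> y _; exact: ch.
  suff : open (p @^-1` (p @` U)) by [].
  have -> : p @^-1` (p @` U) =
      \bigcup_(g in [set` Gamma]) [set (u * g)%g | u in U].
    rewrite eqEsubset; split=> [n [u Uu /pE un]|n [g Gg [u Uu <-]]].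
      by exists (u^-1 * n)%g => //; exists u => //; rewrite mulVKg.
    by exists u => //; apply/pE; rewrite /= mulKg.
  by apply: bigcup_open => g _; exact: open_translater.
- by move=> y; exists (repr (h y)); rewrite /= /p reprK hK.
- move=> n n'; rewrite -pE /=; split=> [/(congr1 h)|-> //].
  by rewrite !kK.
Qed.

Section Covering.
Variables (R : realType) (N : TopologicalGroup.type) (Y : topologicalType)
  (D : set N) (q : N -> Y).
Local Open Scope group_scope.
Hypotheses (sD : subgroup D) (iD : D `<=` isolated D) (hq : coset_projection D q).

Lemma projection_fiber n d : D d -> q (n * d) = q n.
Proof. by case: hq => _ _ _ qE Dd; apply/esym/qE; rewrite mulKg. Qed.

Lemma projection_nbhs n U : nbhs n U -> nbhs (q n) (q @` U).
Proof.
case: hq => _ oq _ _ nU.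
have [V [oV Vn] VU] : exists2 V, open_nbhs n V & V `<=` U by move: nU; rewrite nbhsE.
apply: (@filterS _ (nbhs (q n)) _ (q @` V)); first exact: image_subset.
by apply: open_nbhs_nbhs; split; [exact: oq|exists n].
Qed.

Lemma cocompact_representatives (U : set N) : nbhs 1 U -> in_compact U -> compact [set: Y] ->
  exists2 K : set N, in_compact K & forall x, exists2 d, D d & K (x / d).
Proof.
move=> U1 bU cY; have [cq oq sq qE] := hq; have [bS b1 bV bM] := in_compact_bornology N.
suff : exists2 K : set N, in_compact K & forall x, [set: Y] (q x) -> exists2 d, D d & K (x / d).
  by move=> [K bK KD]; exists K => // x; exact: KD.
apply: (@compact_induction _ [set: Y]
  (fun A => exists2 K : set N, in_compact K & forall x, A (q x) -> exists2 d, D d & K (x / d)) cY).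
- by exists U.
- by move=> A B AB [K bK KD]; exists K => // x /AB; exact: KD.
- move=> A B [K [K' cK KK'] KD] [L [L' cL LL'] LD]; exists (K `|` L).
    by exists (K' `|` L'); [exact: compactU|exact: setUSS].
  by move=> x [/KD|/LD] [d Dd Kd]; exists d => //; [left|right].
- move=> y _; have [n <-] := sq y.
  exists (q @` [set n * u | u in U]).
    apply: projection_nbhs; have := (@nbhs_translate N n U).1 U1.
    apply: (@filterS _ (nbhs n)) => x /= h.
    by exists (n^-1 * x) => //; rewrite mulVKg.
  exists [set n * u | u in U].
    apply: (bS _ [set x * y | x in [set n] & y in U]).
      by move=> _ [u Uu <-]; exists n => //; exists u.
    exact: bM.
  move=> x [w Uw /qE h]; exists (w^-1 * x) => //.
  by rewrite !gnorm.
Qed.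

(** For a small [V] the only element of [D] among the quotients of [V] is 1, so [q] is injective on
    [m V]; being open, it has a continuous inverse there. *)
Lemma projection_section m : exists s : Y -> N, s (q m) = m /\
  exists2 U, open_nbhs (q m) U & forall y, U y -> q (s y) = y /\ {for y, continuous s}.
Proof.
have [cq oq sq qE] := hq; have [U0 oU0 U0D] := discrete_nbhs sD iD.
have [V [oV V1] VU] := nbhs_divide (open_nbhs_nbhs oU0).
pose mV := [set m * v | v in V].
have omV : open mV by exact: open_translate.
have mVm : mV m by exists 1; rewrite ?mulg1.
have inj u v : mV u -> mV v -> q u = q v -> u = v.
  move=> [u' Vu <-] [v' Vv <-] /qE h.
  have : (m * u')^-1 * (m * v') = 1.
    by apply: U0D => //; have := VU _ _ Vu Vv; rewrite !gnorm.
  by move=> /mulg1_eq <-; rewrite invgK.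
have /choice[s sP] : forall y, exists u, (q @` mV) y -> mV u /\ q u = y.
  by move=> y; have [[u mu <-]|h] := pselect ((q @` mV) y); [exists u|exists 1 => /h].
have qm : (q @` mV) (q m) by exists m.
exists s; split; first by have [mu e] := sP _ qm; exact: inj.
exists (q @` mV); first by split; [exact: oq|].
move=> y yU; have [ms qs] := sP y yU; split=> // W Ws.
have h : nbhs (s y) (mV `&` W) by apply: filterI => //; exact: open_nbhs_nbhs.
have := projection_nbhs h; rewrite qs; apply: (@filterS _ (nbhs y)).
move=> _ [w [mw Ww] <-]; have [mw' qw'] := sP (q w) (ex_intro2 _ _ w mw erefl).
by rewrite /= (inj _ _ mw' mw).
Qed.

(** The point is that [U] does not depend on [m]: one section over [U] is translated by [D] to pass
    through any point above it. *)
Lemma even_cover y : exists2 U, open_nbhs y U & forall m, U (q m) ->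
  exists s : Y -> N, s (q m) = m /\
    forall y', U y' -> q (s y') = y' /\ {for y', continuous s}.
Proof.
have [cq oq sq qE] := hq; have [n <-] := sq y; have [s [sn [U oU sU]]] := projection_section n.
exists U => // m Um; have [qsm _] := sU _ Um.
have Dg : D ((s (q m))^-1 * m) by apply/qE.
exists (fun y => s y * ((s (q m))^-1 * m)); split; first by rewrite mulVKg.
move=> y' Uy'; have [qy cy] := sU _ Uy'; split; first by rewrite projection_fiber.
by apply: cvg_mulg; [exact: cy|exact: cvg_cst].
Qed.

(* The set of [T] up to which a lift exists is open and closed in [R]. *)
Lemma curve_lifting (p : R -> Y) (n : N) (T : R) : continuous p -> q n = p 0%R ->
  exists2 L : R -> N, continuous L &
    L 0%R = n /\ forall t, (0 <= t <= T)%R -> q (L t) = p t.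
Proof.
move=> cp qn.
pose E : set R := [set T | exists2 L : R -> N, continuous L &
    L 0%R = n /\ forall t, (0 <= t <= T)%R -> q (L t) = p t].
have Eneg T0 : (T0 <= 0)%R -> E T0.
  move=> T0n; exists (cst n); first exact: cst_continuous.
  split=> // t /andP[t0 tT].
  by rewrite (_ : t = 0%R) //; apply/eqP; rewrite eq_le t0 andbT (le_trans tT).
have step s0 : exists2 e : R, (0 < e)%R & forall s s', (`|s0 - s| < e)%R ->
    (`|s0 - s'| < e)%R -> E s -> E s'.
  have [U [oU Us0] Usec] := even_cover (p s0).
  have : nbhs s0 (p @^-1` U) by apply: cp; exact: open_nbhs_nbhs.
  move=> /nbhs_ballP[e /= e0 eU]; exists e => // s s' ss ss' Es.
  have [s'0|s'0] := leP s' 0%R; first exact: Eneg.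
  wlog s_ge0 : s ss Es / (0 <= s)%R.
    move=> W; have [s0'|sn] := leP 0%R s; first exact: (W s).
    apply: (W 0%R) => //; last exact: Eneg.
    by move: ss ss'; rewrite !ltr_norml => /andP[h1 h2] /andP[h3 h4]; apply/andP; split; lra.
  have [L cL [L0 LE]] := Es.
  have [s's|s's] := leP s' s.
    exists L => //; split=> // t /andP[t0 ts]; apply: LE.
    by rewrite t0 (le_trans ts).
  have Us : U (p s) by apply: eU.
  have qLs : q (L s) = p s by apply: LE; rewrite s_ge0 lexx.
  have [sg [sgL sgP]] := Usec (L s) (eq_rect_r U Us qLs).
  (* Clamping to the interval from [s] to [s'] keeps [p] in [U], so the second branch is continuous
     for all [t]. *)
  pose cl (t : R) : R := Num.max s (Num.min t s').
  have clU t : U (p (cl t)).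
    apply: eU; rewrite /ball /= /cl /Num.max /Num.min.
    by do ![case: ifPn => //]; rewrite -?leNgt => h1 h2;
      move: ss ss'; rewrite !ltr_norml => /andP[? ?] /andP[? ?]; apply/andP; split; lra.
  have ccl : continuous cl.
    apply: continuous_fmax; first exact: cst_continuous.
    by apply: continuous_fmin; [move=> ?; exact: cvg_id|exact: cst_continuous].
  exists (fun t => if (t <= s)%R then L t else sg (p (cl t))); last split.
  - apply: continuous_if => [t|//|t|t ->]; first exact: cvg_id.
      apply: (@continuous_comp _ _ _ (p \o cl) sg).
        by apply: continuous_comp; [exact: ccl|exact: cp].
      by have [_] := sgP _ (clU t).
    by rewrite /cl min_l ?ltW// maxxx -qLs sgL.
  - by rewrite s_ge0.
  - move=> t /andP[t0 ts']; case: ifPn => [ts|]; first by apply: LE; rewrite t0.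
    rewrite -ltNge => st; have [-> _] := sgP _ (clU t).
    by rewrite /cl min_l// max_r// ltW.
suff ET : E = [set: R] by have : E T by rewrite ET.
have /connected_intervalP cR : is_interval [set: R] by [].
apply: cR.
- by exists 0%R; exact: Eneg.
- exists E; last by rewrite setTI.
  rewrite openE => s Es; have [e e0 he] := step s.
  apply/nbhs_ballP; exists e => //= s' ss'; apply: (he s) => //.
  by rewrite subrr normr0.
- exists E; last by rewrite setTI.
  move=> s cs; have [e e0 he] := step s.
  have [s' [Es' ss']] := cs (ball s e) (nbhsx_ballx s e e0).
  by apply: (he s') => //; rewrite subrr normr0.
Qed.

Definition lifts (X : Type) (f : X -> Y) (p : unit_interval R -> X) n n'
  (L : path_in R n n') := forall t, q (L t) = f (p t).

Lemma path_lifting (X : topologicalType) (f : X -> Y) x x' (p : path_in R x x') n :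
  continuous f -> q n = f x -> exists n' (L : path_in R n n'), lifts f p L.
Proof.
move=> cf qn; have cfp : continuous (fun t => f (path_ext p t)).
  by apply: continuous_fcomp cf => //; exact: continuous_path_ext.
have [L cL [L0 LE]] := @curve_lifting _ n 1%R cfp
  (etrans qn (congr1 f (esym (path_ext_le0 p (lexx _))))).
have cLI : continuous (L \o I_val : unit_interval R -> N).
  by move=> t; apply: continuous_comp; [exact: continuous_I_val|exact: cL].
have L0' : (L \o I_val) (zero : unit_interval R) = n by rewrite /= I_val0.
exists (L (I_val one)), (mk_path cLI L0' erefl) => t.
by rewrite -(path_extE p t) -LE//; exact: I_val_itv.
Qed.

Section Lifts.
Variables (X : topologicalType) (f : X -> Y).

Lemma lifts_start x x' (p : path_in R x x') n n' (L : path_in R n n') :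
  lifts f p L -> q n = f x.
Proof. by move=> h; rewrite -(@path_zero _ _ _ _ p) -h path_zero. Qed.

Lemma lifts_end x x' (p : path_in R x x') n n' (L : path_in R n n') :
  lifts f p L -> q n' = f x'.
Proof. by move=> h; rewrite -(@path_one _ _ _ _ p) -h path_one. Qed.

Lemma lifts_cat x x' x'' (p : path_in R x x') (p' : path_in R x' x'')
    n n' n'' (L : path_in R n n') (L' : path_in R n' n'') :
  lifts f p L -> lifts f p' L' -> lifts f (path_cat p p') (path_cat L L').
Proof.
move=> h h' t; rewrite -!path_extE !path_ext_cat.
by case: ifP => _; rewrite /path_ext.
Qed.

Lemma lifts_rev x x' (p : path_in R x x') n n' (L : path_in R n n') :
  lifts f p L -> lifts f (path_rev p) (path_rev L).
Proof. by move=> h t; rewrite -!path_extE !path_ext_rev /path_ext. Qed.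

Lemma lifts_translate p n n' (L : path_in R n n') d :
  lifts f p L -> D d -> exists L' : path_in R (n * d) (n' * d), lifts f p L'.
Proof.
move=> h Dd.
have c : continuous (fun t => L t * d).
  by apply: continuous_fmul; [exact: cts_fun|exact: cst_continuous].
have e0 : (fun t => L t * d) zero = n * d by rewrite /= path_zero.
have e1 : (fun t => L t * d) one = n' * d by rewrite /= path_one.
by exists (mk_path c e0 e1) => t; rewrite -h -(projection_fiber (L t) Dd).
Qed.

End Lifts.

Lemma simply_connected_homotopic (n n' : N) (L L' : path_in R n n') :
  simply_connected R N -> path_homotopic L L'.
Proof.
move=> [_ pi0].
have nul : path_homotopic (path_cat L (path_rev L')) (path_cst R n).
  by apply/pi1_classP; rewrite [LHS]pi0 [RHS]pi0.
apply: (path_homotopic_trans (path_homotopic_sym (path_cat_cstr L))).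
apply: (@path_homotopic_trans _ _ _ _ _ (path_cat L (path_cat (path_rev L') L'))).
  apply: path_homotopic_cat; first exact: path_homotopic_refl.
  exact/path_homotopic_sym/path_cat_rev.
apply: (path_homotopic_trans (path_catA _ _ _)).
apply: (path_homotopic_trans (path_homotopic_cat nul (path_homotopic_refl L'))).
exact: path_cat_cstl.
Qed.

Lemma lifts_homotopic (y y' : Y) (p p' : path_in R y y') (n n' : N) (L L' : path_in R n n') :
  simply_connected R N -> lifts id p L -> lifts id p' L' -> path_homotopic p p'.
Proof.
move=> sN h h'; have [H [cH H0 H1 Hx Hy]] := simply_connected_homotopic L L' sN.
case: hq => cq _ _ _; exists (q \o H); split.
- by move=> z; apply: continuous_comp; [exact: cH|exact: cq].
- by move=> t /=; rewrite H0.
- by move=> t /=; rewrite H1.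
- by move=> s /=; rewrite Hx; exact: lifts_start h.
- by move=> s /=; rewrite Hy; exact: lifts_end h.
Qed.

End Covering.

(** * Monodromy and Reidemeister classes *)

Lemma pi1_classM (R : realType) (T : topologicalType) (x : T) (p p' : path_in R x x) :
  (pi1_class p * pi1_class p')%g = pi1_class (path_cat p p').
Proof. exact: pi1_mulE. Qed.

Section Monodromy.
Variables (R : realType) (N : TopologicalGroup.type) (X Y : topologicalType)
  (D : set N) (q : N -> Y).
Local Open Scope group_scope.
Hypotheses (sD : subgroup D) (iD : D `<=` isolated D) (hq : coset_projection D q).
Variables (f g : continuousType X Y) (x0 : X) (nf ng : N).
Hypotheses (qf : q nf = f x0) (qg : q ng = g x0).

Let cf : continuous f := @cts_fun _ _ f.
Let cg : continuous g := @cts_fun _ _ g.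

Let fiberP m m' : q m = q m' -> D (m^-1 * m').
Proof. by case: hq => _ _ _ qE /qE. Qed.

(* Pairs are stored inverted, so that [(a, b)] acts on the difference [h] of two
   lifts (see [reach]) by [h |-> a h b^-1]. *)
Definition monodromy : set (N * N) := [set p |
  exists (al : path_in R x0 x0) mf mg (Lf : path_in R nf mf) (Lg : path_in R ng mg),
    [/\ lifts q f al Lf, lifts q g al Lg, mf = nf * p.2^-1 & mg = ng * p.1^-1]].

(** By the fibre condition on [q], such an [h] lies in [D] exactly when [f x = g x]. *)
Definition reach x : set N := [set h |
  exists (al : path_in R x0 x) mf mg (Lf : path_in R nf mf) (Lg : path_in R ng mg),
    [/\ lifts q f al Lf, lifts q g al Lg & h = mg^-1 * mf]].

Lemma monodromyD p : monodromy p -> D p.1 /\ D p.2.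
Proof.
have [_ _ DV] := sD; move=> [al [mf [mg [Lf [Lg [lf lg ef eg]]]]]].
have hf : D (nf^-1 * mf) by apply: fiberP; rewrite (lifts_end lf).
have hg : D (ng^-1 * mg) by apply: fiberP; rewrite (lifts_end lg).
rewrite ef mulKg in hf; rewrite eg mulKg in hg.
by split; [rewrite -[p.1]invgK|rewrite -[p.2]invgK]; exact: DV.
Qed.

Lemma monodromy_subgroup : subgroup monodromy.
Proof.
have [D1 DM DV] := sD; split.
- exists (path_cst R x0), nf, ng, (path_cst R nf), (path_cst R ng).
  by split; rewrite ?invg1 ?mulg1//.
- move=> p p' [al [mf [mg [Lf [Lg [lf lg ef eg]]]]]] Mp'.
  have [Dp1 Dp2] : D p.1 /\ D p.2.
    by apply: monodromyD; exists al, mf, mg, Lf, Lg.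
  move: Mp' => [al' [mf' [mg' [Lf' [Lg' [lf' lg' ef' eg']]]]]].
  subst mf mg.
  have [Mf hf] := lifts_translate hq lf' (DV _ Dp2).
  have [Mg hg] := lifts_translate hq lg' (DV _ Dp1).
  exists (path_cat al al'), _, _, (path_cat Lf Mf), (path_cat Lg Mg).
  split; [exact: lifts_cat|exact: lifts_cat| |].
    by rewrite ef' /= !gnorm.
  by rewrite eg' /= !gnorm.
- move=> p Mp; have [Dp1 Dp2] := monodromyD Mp.
  move: Mp => [al [mf [mg [Lf [Lg [lf lg ef eg]]]]]]; subst mf mg.
  have := lifts_translate hq (lifts_rev lf) Dp2.
  have := lifts_translate hq (lifts_rev lg) Dp1.
  rewrite !mulgVK => -[Mg hg] [Mf hf].
  by exists (path_rev al), _, _, Mf, Mg; split => //=; rewrite invgK.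
Qed.

(** Going to [x] along one path and back along the other is a loop at [x0], which provides the
    pair. *)
Lemma reach_related x h h' : reach x h -> reach x h' ->
  exists2 p, monodromy p & h' = p.1 * h / p.2.
Proof.
move=> [al [mf [mg [Lf [Lg [lf lg ->]]]]]] [al' [mf' [mg' [Lf' [Lg' [lf' lg' ->]]]]]].
have hf : D (mf^-1 * mf') by apply: fiberP; rewrite (lifts_end lf) (lifts_end lf').
have hg : D (mg^-1 * mg') by apply: fiberP; rewrite (lifts_end lg) (lifts_end lg').
have := lifts_translate hq (lifts_rev lf) hf; have := lifts_translate hq (lifts_rev lg) hg.
rewrite !mulVKg => -[Mg lMg] [Mf lMf].
exists (mg'^-1 * mg, mf'^-1 * mf); last by rewrite /= !gnorm.
exists (path_cat al' (path_rev al)), _, _, (path_cat Lf' Mf), (path_cat Lg' Mg).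
by split; [exact: lifts_cat|exact: lifts_cat| |]; rewrite /= !gnorm.
Qed.

Lemma reach_act x h p : reach x h -> monodromy p -> reach x (p.1 * h / p.2).
Proof.
have [_ _ DV] := sD; move=> [al [mf [mg [Lf [Lg [lf lg ->]]]]]] Mp.
have [Dp1 Dp2] := monodromyD Mp.
move: Mp => [be [kf [kg [Kf [Kg [kf' kg' ef eg]]]]]]; subst kf kg.
have [Mf lMf] := lifts_translate hq lf (DV _ Dp2).
have [Mg lMg] := lifts_translate hq lg (DV _ Dp1).
exists (path_cat be al), _, _, (path_cat Kf Mf), (path_cat Kg Mg).
by split; [exact: lifts_cat|exact: lifts_cat|rewrite !gnorm].
Qed.

Lemma reach_exists x : (exists p : path_in R x0 x, True) -> exists h, reach x h.
Proof.
move=> [p _]; have [mf [Lf lf]] := path_lifting sD iD hq p cf qf.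
have [mg [Lg lg]] := path_lifting sD iD hq p cg qg.
by exists (mg^-1 * mf), p, mf, mg, Lf, Lg.
Qed.

Lemma reach_coincidence x h : reach x h -> exists2 m : N * N,
  h = m.2^-1 * m.1 & q m.1 = f x /\ q m.2 = g x.
Proof.
move=> [al [mf [mg [Lf [Lg [lf lg ->]]]]]]; exists (mf, mg) => //=.
by rewrite (lifts_end lf) (lifts_end lg).
Qed.

Definition locally_path_connected := forall (x : X) U, nbhs x U ->
  \forall x' \near x, exists p : path_in R x x', forall t, U (p t).

(** Local sections of [q] through the two end points give a continuous difference; the path to [x]
    is prolonged to a nearby point inside the domains of both sections. *)
Lemma reach_local x h : locally_path_connected -> reach x h ->
  exists eta : X -> N, [/\ {for x, continuous eta}, eta x = h &
    \forall x' \near x, reach x' (eta x')].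
Proof.
move=> lX [al [mf [mg [Lf [Lg [lf lg ->]]]]]].
have qmf := lifts_end lf; have qmg := lifts_end lg.
have [sf [sfm [Uf oUf sfP]]] := projection_section sD iD hq mf.
have [sg [sgm [Ug oUg sgP]]] := projection_section sD iD hq mg.
rewrite qmf in sfm oUf; rewrite qmg in sgm oUg.
have Ufx : Uf (f x) by case: oUf. have Ugx : Ug (g x) by case: oUg.
exists (fun x => (sg (g x))^-1 * sf (f x)); split.
- apply: cvg_mulg.
    apply: cvg_invg; apply: (@continuous_comp _ _ _ g sg); first exact: cg.
    by have [] := sgP _ Ugx.
  apply: (@continuous_comp _ _ _ f sf); first exact: cf.
  by have [] := sfP _ Ufx.
- by rewrite sfm sgm.
- have nf' : nbhs x (f @^-1` Uf) by apply: cf; exact: open_nbhs_nbhs.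
  have ng' : nbhs x (g @^-1` Ug) by apply: cg; exact: open_nbhs_nbhs.
  have hW := lX _ _ (@filterI _ _ (nbhs_filter x) _ _ nf' ng').
  apply: (@filterS _ (nbhs x) _ _ _ _ hW) => x' [be Ube].
  have mk (k : continuousType X Y) (s : Y -> N) (U : set Y) :
      (forall t, U (k (be t))) -> (forall y, U y -> q (s y) = y /\ {for y, continuous s}) ->
      exists L : path_in R (s (k x)) (s (k x')), lifts q k be L.
    move=> Uk sP.
    have c : continuous (fun t => s (k (be t))).
      move=> t; apply: (@continuous_comp _ _ _ (k \o be) s).
        by apply: continuous_comp; exact: cts_fun.
      by have [] := sP _ (Uk t).
    have e0 : (fun t => s (k (be t))) zero = s (k x) by rewrite /= path_zero.
    have e1 : (fun t => s (k (be t))) one = s (k x') by rewrite /= path_one.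
    by exists (mk_path c e0 e1) => t; have [] := sP _ (Uk t).
  have [Mf lMf] := mk f sf Uf (fun t => (Ube t).1) sfP.
  have [Mg lMg] := mk g sg Ug (fun t => (Ube t).2) sgP.
  move: Mf lMf Mg lMg; rewrite sfm sgm => Mf lMf Mg lMg.
  exists (path_cat al be), _, _, (path_cat Lf Mf), (path_cat Lg Mg).
  by split => //; exact: lifts_cat.
Qed.

End Monodromy.

(** * Reidemeister classes as twisted orbits of the deck group *)

Section Reidemeister.
Variables (R : realType) (N : TopologicalGroup.type) (X Y : topologicalType)
  (D : set N) (q : N -> Y).
Local Open Scope group_scope.
Hypotheses (sD : subgroup D) (iD : D `<=` isolated D) (hq : coset_projection D q)
  (sN : simply_connected R N).
Variables (f g : continuousType X Y) (x0 : X) (w : path_in R (f x0) (g x0)).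
Variables (nf ng : N) (Lw : path_in R nf ng).
Hypothesis lw : lifts q id w Lw.

Let qf : q nf = f x0. Proof. exact: lifts_start lw. Qed.
Let qg : q ng = g x0. Proof. exact: lifts_end lw. Qed.

Let liftY y y' (p : path_in R y y') n : q n = y ->
  exists n' (L : path_in R n n'), lifts q id p L.
Proof. by move=> qn; apply: (path_lifting sD iD hq) => // z; exact: cvg_id. Qed.

Lemma pi1_transportE (p : path_in R (f x0) (f x0)) :
  pi1_transport w (pi1_class p) = pi1_class (path_cat (path_rev w) (path_cat p w)).
Proof.
apply/pi1_classP; apply: path_homotopic_cat; first exact: path_homotopic_refl.
by apply: path_homotopic_cat; [exact: repr_pi1|exact: path_homotopic_refl].
Qed.

(** Instead of cancelling [w] against its reverse by hand, both sides are lifted to paths with the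
    same ends. *)
Lemma pi1_transportM : {morph (pi1_transport w) : u v / u * v}.
Proof.
move=> u v; rewrite -(pi1_repr u) -(pi1_repr v) pi1_classM.
rewrite !pi1_transportE pi1_classM; apply/pi1_classP.
have [m [A lA]] := liftY (repr u) qf; have qm := lifts_end lA.
have [m' [A' lA']] := liftY (repr v) qm.
have [k [B lB]] := liftY w qm; have [k' [B' lB']] := liftY w (lifts_end lA').
apply: (lifts_homotopic hq sN
  (L := path_cat (path_rev Lw) (path_cat (path_cat A A') B'))
  (L' := path_cat (path_cat (path_rev Lw) (path_cat A B))
           (path_cat (path_rev B) (path_cat A' B')))).
  by apply: lifts_cat; [exact: lifts_rev|do !apply: lifts_cat].
by do !apply: lifts_cat => //; exact: lifts_rev.
Qed.

Lemma reidemeister_rel_trans (u v z : pi1 R (g x0)) : reidemeister_rel w u v ->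
  reidemeister_rel w v z -> reidemeister_rel w u z.
Proof.
move=> [x ->] [y ->]; exists (y * x).
by rewrite !pi1_mapM pi1_transportM !gnorm.
Qed.

Lemma finite_reidemeister_classes (s : seq N) :
  (forall u, D u -> exists v p, [/\ v \in s, monodromy R q f g x0 nf ng p &
    u = p.1 * v / p.2]) ->
  finite_set (reidemeister_classes w).
Proof.
move=> sP; have [D1 DM DV] := sD.
have sM := @monodromy_subgroup R N X Y D q sD hq f g x0 nf ng qf qg.
have [M1 MM MV] := sM.
(* [T] reads off the end point of a lifted loop, inverted to match the convention of [monodromy]. *)
have /choice[T TP] : forall be : pi1 R (g x0), exists u, exists L : path_in R ng (ng * u^-1),
    D u /\ lifts q id (repr be) L.
  move=> be; have [m [L lL]] := liftY (repr be) qg.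
  have Dm : D (ng^-1 * m) by case: hq => _ _ _ qE; apply/qE; rewrite (lifts_end lL).
  exists (ng^-1 * m)^-1; rewrite invgK mulVKg; exists L; split => //; exact: DV.
have key be be' p : monodromy R q f g x0 nf ng p -> T be' = p.1 * T be / p.2 ->
    reidemeister_rel w be be'.
  move=> Mp Te; have [Dp1 Dp2] := monodromyD sD hq qf qg Mp.
  move: Mp => [al [mf [mg [Lf [Lg [lf lg ef eg]]]]]]; subst mf mg.
  have [L [Du lL]] := TP be; have [L' [Du' lL']] := TP be'.
  exists (pi1_class al); rewrite -[LHS](mulgK (pi1_transport w (pi1_map f (pi1_class al)))).
  congr (_ / _); rewrite !pi1_mapE pi1_transportE.
  rewrite -{1}(pi1_repr be') -{1}(pi1_repr be) !pi1_classM.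
  apply/pi1_classP.
  have [B lB] := lifts_translate hq lw (DV _ Dp2).
  have lLf : lifts q id [the path_in R (f x0) (f x0) of f \o al] Lf by [].
  have lLg : lifts q id [the path_in R (g x0) (g x0) of g \o al] Lg by [].
  have lV := lifts_cat (lifts_rev lw) (lifts_cat lLf lB).
  have [V' lV'] := lifts_translate hq lV (DV _ Du').
  have [M lM] := lifts_translate hq lL (DV _ Dp1).
  have := lifts_cat lLg lM; have := lifts_cat lL' lV'.
  move: (path_cat L' V') (path_cat Lg M).
  (* The twisted relation between [T be] and [T be'] says precisely that the two lifted loops end at
     the same point. *)
  have -> : ng * p.2^-1 * (T be')^-1 = ng * (T be)^-1 * p.1^-1 by rewrite Te !gnorm.
  by move=> l1 l2 h1 h2; exact: (lifts_homotopic hq sN h1 h2).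
have classE be be' v : (exists2 p, monodromy R q f g x0 nf ng p & T be = p.1 * v / p.2) ->
    (exists2 p, monodromy R q f g x0 nf ng p & T be' = p.1 * v / p.2) ->
    [set z | reidemeister_rel w be z] = [set z | reidemeister_rel w be' z].
  move=> [p Mp e] [p' Mp' e'].
  have h : reidemeister_rel w be be'.
    apply: (key _ _ (p' * p^-1)); first by apply: MM => //; exact: MV.
    by rewrite e e' /= !gnorm.
  have h' : reidemeister_rel w be' be.
    apply: (key _ _ (p * p'^-1)); first by apply: MM => //; exact: MV.
    by rewrite e e' /= !gnorm.
  rewrite eqEsubset; split=> z /= ?; [exact: reidemeister_rel_trans h' _|
    exact: reidemeister_rel_trans h _].
have /choice[rp rpP] : forall v, exists be, forall be',
    (exists2 p, monodromy R q f g x0 nf ng p & T be' = p.1 * v / p.2) ->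
    exists2 p, monodromy R q f g x0 nf ng p & T be = p.1 * v / p.2.
  move=> v; have [[be h]|h] := pselect (exists be,
    exists2 p, monodromy R q f g x0 nf ng p & T be = p.1 * v / p.2).
    by exists be.
  by exists 1 => be' h'; case: h; exists be'.
apply: (@sub_finite_set _ _ [set [set z | reidemeister_rel w (rp v) z] | v in [set` s]]).
  move=> _ [be _ <-]; have [_ [Db _]] := TP be.
  have [v [p [vs Mp e]]] := sP _ Db; exists v => //.
  have h : exists2 p, monodromy R q f g x0 nf ng p & T be = p.1 * v / p.2 by exists p.
  exact: classE (rpP v be h) h.
exact/finite_image/finite_seq.
Qed.

End Reidemeister.

(** * Finite complexes *)

Section Disks.
Variable R : realType.

Lemma continuous_sqnorm n : continuous (@sqnorm R n).
Proof.
rewrite /sqnorm; elim: (index_enum _) => [|i l IH].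
  by under eq_fun do rewrite big_nil; exact: cst_continuous.
under eq_fun do rewrite big_cons.
have c : continuous (fun u : 'rV[R]_n => u ord0 i ^+ 2).
  apply: (@continuous_fcomp _ _ _ (fun u : 'rV[R]_n => u ord0 i) (fun r : R => r ^+ 2)).
    exact: coord_continuous.
  exact: exprn_continuous.
by move=> v; apply: (@cvgD _ _ _ (nbhs v)); [exact: c|exact: IH].
Qed.

Lemma disk_convex n (v v' : 'rV[R]_n) (t : R) : @disk R n v -> @disk R n v' ->
  0 <= t <= 1 -> @disk R n (v + t *: (v' - v)).
Proof.
rewrite /disk /= => hv hv' /andP[t0 t1].
have : sqnorm (v + t *: (v' - v)) <= (1 - t) * sqnorm v + t * sqnorm v'.
  rewrite /sqnorm !mulr_sumr -big_split /=; apply: ler_sum => i _; rewrite !mxE.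
  have : 0 <= t * (1 - t) * (v ord0 i - v' ord0 i) ^+ 2.
    by rewrite mulr_ge0 ?sqr_ge0// mulr_ge0// subr_ge0.
  by lra.
have : (1 - t) * sqnorm v <= (1 - t) * 1 by apply: ler_wpM2l => //; lra.
have : t * sqnorm v' <= t * 1 by apply: ler_wpM2l.
by lra.
Qed.

Lemma closed_disk n : closed (@disk R n).
Proof.
apply: (@preimage_closed _ _ (@sqnorm R n) [set r | r <= 1]); last exact: closed_le.
by move=> v _; exact: continuous_sqnorm.
Qed.

Lemma compact_disk n : compact (@disk R n).
Proof.
apply: bounded_closed_compact; last exact: closed_disk.
exists 1; split; first exact: num_real.
move=> M M1 v hv; apply: mx_norm_leP => [|k]; first lra.
have vk : (v ord0 k) ^+ 2 <= 1.
  apply: le_trans hv; rewrite /sqnorm (bigD1 k)//= lerDl.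
  by apply: sumr_ge0 => j _; exact: sqr_ge0.
rewrite -real_normK ?num_real// in vk.
have : `|v ord0 k| <= 1 by rewrite -(@expr_le1 _ 2).
by lra.
Qed.

Lemma disk_locally_path_connected (X : topologicalType) n (Phi : 'rV[R]_n -> X) v U :
  {within @disk R n, continuous Phi} -> @disk R n v -> open U -> U (Phi v) ->
  \forall v' \near v, @disk R n v' -> exists p : path_in R (Phi v) (Phi v'), forall t, U (p t).
Proof.
move=> /subspace_continuousP cP dv oU Uv.
have : nbhs v [set z | @disk R n z -> U (Phi z)].
  by apply: (cP v dv); exact: open_nbhs_nbhs.
move=> /nbhs_ballP[e /= e0 eU]; apply/nbhs_ballP; exists e => //= v' vv' dv'.
pose s (t : unit_interval R) := v + I_val t *: (v' - v).
have ds t : @disk R n (s t) by apply: disk_convex => //; exact: I_val_itv.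
have cs : continuous s.
  move=> t; apply: (@cvgD _ _ _ (nbhs t)); first exact: cvg_cst.
  apply: (@continuous_fcomp _ _ _ (@I_val R) (fun h : R => h *: (v' - v))).
    exact: continuous_I_val.
  by move=> h; exact: scalel_continuous.
have c : continuous (Phi \o s).
  move=> t W /= /(cP (s t) (ds t)) h.
  have := cs t _ h; apply: (@filterS _ (nbhs t)) => t' /=; exact.
have e0' : (Phi \o s) zero = Phi v by rewrite /s /= I_val0 scale0r addr0.
have e1 : (Phi \o s) one = Phi v' by rewrite /s /= I_val1 scale1r addrC subrK.
exists (mk_path c e0' e1) => t; apply: (eU (s t)) => //.
rewrite -ball_normE /= /s opprD addNKr normrN normrZ.
move: vv'; rewrite -ball_normE /= distrC => vv'.
have /andP[t0 t1] := I_val_itv t.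
by rewrite ger0_norm//; apply: le_lt_trans vv'; rewrite ler_piMl.
Qed.

End Disks.

Section FiniteComplexes.
Variables (R : realType) (X : topologicalType).
Hypothesis hX : finite_complex R X.

Lemma finite_complex_disks : hausdorff_space X /\
  exists (I : finType) (d : I -> nat) (Phi : forall i, 'rV[R]_(d i) -> X),
  (forall i, {within @disk R (d i), continuous (Phi i)}) /\
  forall x, exists i, exists2 v, @disk R (d i) v & Phi i v = x.
Proof.
have [hd [I [d [Phi [c _ _ cov _]]]]] := hX; split=> //; exists I, d, Phi.
split=> // x; have [i [[v hv e] _]] := cov x; exists i, v => //.
exact: ltW.
Qed.

Lemma compact_bigcup_fin (I : finType) (A : I -> set X) : (forall i, compact (A i)) ->
  compact [set x | exists i, A i x].
Proof.
move=> cA.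
have -> : [set x | exists i, A i x] = \big[setU/set0]_(i : I) A i.
  rewrite -bigcup_seq eqEsubset; split=> x [i]; first by exists i => //=; rewrite mem_index_enum.
  by move=> _ Ax; exists i.
elim/big_ind: _ => //; [exact: compact0|exact: compactU].
Qed.

Lemma finite_complex_compact : compact [set: X].
Proof.
have [hd [I [d [Phi [c cov]]]]] := finite_complex_disks.
have -> : [set: X] = [set x | exists i, (Phi i @` @disk R (d i)) x].
  by rewrite eqEsubset; split=> // x _; exact: cov.
apply: compact_bigcup_fin => i; apply: continuous_compact => //; exact: compact_disk.
Qed.

Lemma finite_complex_normal : normal_space X.
Proof.
have [hd _] := hX; exact: compact_normal hd finite_complex_compact.
Qed.

(** For the set [W] of points joined to [x] inside [V], the complement is a finite union of images
    of closed parts of disks, closed because disks are locally path connected; it is therefore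
    compact, and [W] is open. *)
Lemma finite_complex_locally_path_connected : locally_path_connected R X.
Proof.
have [hd [I [d [Phi [c cov]]]]] := finite_complex_disks => x U.
rewrite {1}nbhsE => -[V [oV Vx] VU].
pose W := [set x' | exists p : path_in R x x', forall t, V (p t)].
have WV x' : W x' -> V x' by move=> [p /(_ one)]; rewrite path_one.
have Wx : W x by exists (path_cst R x).
have near i v : @disk R (d i) v -> W (Phi i v) ->
    \forall v' \near v, @disk R (d i) v' -> W (Phi i v').
  move=> dv Wv; have h := disk_locally_path_connected (c i) dv oV (WV _ Wv).
  apply: (@filterS _ (nbhs v) _ _ _ _ h) => v' hv' /hv'[p pV].
  have [p0 p0V] := Wv; exists (path_cat p0 p) => t.
  by rewrite -path_extE path_ext_cat; case: ifP => _; [exact: p0V|exact: pV].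
have cW : closed (~` W).
  have -> : ~` W = [set y | exists i, (Phi i @` (@disk R (d i) `&` Phi i @^-1` (~` W))) y].
    rewrite eqEsubset; split=> [y Wy|y [i [v [dv Wv] <-]]//].
    by have [i [v dv e]] := cov y; exists i, v => //; split=> //=; rewrite e.
  apply: compact_closed => //; apply: compact_bigcup_fin => i.
  apply: continuous_compact.
    by apply: continuous_subspaceW (c i) => v [].
  apply: (subclosed_compact _ (@compact_disk R (d i))); last by move=> v [].
  move=> v clv.
  have dv : @disk R (d i) v.
    by apply: closed_disk => B /clv[z [[dz _] Bz]]; exists z.
  split=> //= Wv; have [z [[dz nWz] hz]] := clv _ (near i v dv Wv).
  by apply: nWz; exact: hz.
have oW : open W by rewrite -[W]setCK; exact: closed_openC.
have : nbhs x W by exact: open_nbhs_nbhs.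
apply: (@filterS _ (nbhs x)) => x' [p pV]; exists p => t; exact/VU/pV.
Qed.

Lemma finite_complex_path_connected (x y : X) : connected [set: X] ->
  exists p : path_in R x y, True.
Proof.
move=> cX; have lX := finite_complex_locally_path_connected.
pose E := [set y | exists p : path_in R x y, True].
suff ET : E = [set: X] by have : E y by rewrite ET.
apply: cX.
- by exists x, (path_cst R x).
- exists E; last by rewrite setTI.
  rewrite openE => z [p _]; have h := lX z setT (@filterT _ _ (nbhs_filter z)).
  apply: (@filterS _ (nbhs z) _ _ _ _ h) => z' [p' _].
  by exists (path_cat p p').
- exists E; last by rewrite setTI.
  move=> z clz; have [z' [[p _] [p' _]]] := clz _ (lX z setT (@filterT _ _ (nbhs_filter z))).
  by exists (path_cat p (path_rev p')).
Qed.

End FiniteComplexes.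

(** * Removal of coincidences *)

Section DiscreteTower.
Variables (R : realType) (N : TopologicalGroup.type).
Local Open Scope group_scope.
Variables (D : set N) (r : nat) (B : nat -> set N) (t : nat -> N -> R)
  (a : nat -> R -> N).
Hypotheses (sD : subgroup D) (tw : tower D r B t a) (B0 : B 0%N = [set: N]).

Lemma finite_gap (T : eqType) (f : T -> R) (s : seq T) : exists2 e : R,
  (0 < e <= 1)%R & forall d, d \in s -> (`|f d| < e)%R -> f d = 0%R.
Proof.
elim: s => [|d s [e /andP[e0 e1] IH]]; first by exists 1%R; rewrite ?ltr01 ?lexx.
have [fd|fd] := eqVneq (f d) 0%R.
  by exists e; rewrite ?e0// => d'; rewrite inE => /orP[/eqP->//|]; exact: IH.
exists (Num.min e `|f d|)%R.
  by rewrite lt_min e0 normr_gt0 fd ge_min e1.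
move=> d'; rewrite inE => /orP[/eqP->|h]; first by rewrite lt_min ltxx andbF.
by rewrite lt_min => /andP[h' _]; exact: IH.
Qed.

Lemma tower_gap j : (j < r)%N -> exists2 e : R, (0 < e)%R &
  forall d, D d -> B j d -> (`|t j d| < e)%R -> t j d = 0%R.
Proof.
move=> jr; have [s [_ sP]] := tower_finite_values tw 1%R jr.
have [e /andP[e0 e1] eP] := finite_gap (t j) s; exists e => // d Dd Bd te.
have [d' ds td] := sP d Dd Bd (ltW (lt_le_trans te e1)).
by rewrite -td; apply: eP; rewrite ?td.
Qed.

Definition coset_union j : set N := [set x | exists2 d, D d & B j (x / d)].

(** By induction the [D]-component of [x] lies in [B j]; its [t j] value is that of [x], too small
    to be nonzero on [D]. *)
Lemma near1_coset_union j : (j <= r)%N -> \forall x \near (1 : N), coset_union j x -> B j x.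
Proof.
have [D1 DM DV] := sD.
elim: j => [_|j IH jr]; first by apply: nearW => x _; rewrite B0.
have [e e0 eP] := tower_gap jr.
have [ht tB tJ BE _ _ _] := tower_step_at tw jr.
have [sB _ _ _ _] := tower_group_at tw (ltnW jr); have [B1 BM BV] := sB.
have h1 := IH (ltnW jr); have h2 := tB e e0.
apply: (@filterS2 _ _ (nbhs_filter (1 : N)) _ _ _ _ h1 h2) => x hx tx [d Dd].
rewrite BE => -[/= Bxd txd].
have Bx : B j x by apply: hx; exists d.
have Bd : B j d.
  have -> : d = (x / d)^-1 * x by rewrite !gnorm.
  by apply: BM => //; exact: BV.
have e1 : t j x = t j d by have := ht _ _ Bxd Bd; rewrite !gnorm txd add0r.
by split=> //; rewrite e1; apply: eP => //; rewrite -e1; exact: tx.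
Qed.

Lemma coset_unionM j x y : (j <= r)%N -> coset_union j x -> coset_union j y ->
  coset_union j (x * y).
Proof.
have [D1 DM DV] := sD; move=> jr [d Dd Bx] [d' Dd' By].
have [[_ BM _] _ nB _ _] := tower_group_at tw jr.
exists (d * d'); first exact: DM.
have -> : x * y / (d * d') = (x / d) * ((y / d') ^ d^-1) by rewrite /conjg !gnorm.
by apply: BM => //; exact: nB.
Qed.

Lemma coset_unionV j x : (j <= r)%N -> coset_union j x -> coset_union j x^-1.
Proof.
have [D1 DM DV] := sD; move=> jr [d Dd Bx].
have [[_ _ BV] _ nB _ _] := tower_group_at tw jr.
exists d^-1; first exact: DV.
have -> : x^-1 / d^-1 = ((x / d)^-1) ^ d by rewrite /conjg !gnorm.
by apply: nB; exact: BV.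
Qed.

Lemma coset_union_mem j x : (j <= r)%N -> D x -> coset_union j x.
Proof.
by move=> jr Dx; have [[B1 _ _] _ _ _ _] := tower_group_at tw jr; exists x => //; rewrite mulgV.
Qed.

Lemma coset_union_sub j x : B j x -> coset_union j x.
Proof. by have [D1 _ _] := sD => Bx; exists 1 => //; rewrite divg1. Qed.

(** Two points of this group close to [x] differ by an element near 1, hence in [B j], which is
    closed. *)
Lemma closed_coset_union j : (j <= r)%N -> closed (coset_union j).
Proof.
move=> jr x clx; have [sB cB nB _ _] := tower_group_at tw jr.
have [V oV VU] := nbhs_divide (near1_coset_union jr).
have xV : nbhs x [set y | V (x^-1 * y)].
  by apply/(@nbhs_translate N x V); exact: open_nbhs_nbhs.
have [y0 [Uy0 Vy0]] := clx _ xV.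
have : B j (y0^-1 * x).
  apply: cB => W nW.
  have c : (fun z => y0^-1 * z) @ x --> y0^-1 * x.
    by apply: cvg_mulg; [exact: cvg_cst|exact: cvg_id].
  have nW' := @filterI _ _ (nbhs_filter x) _ _ xV (c _ nW).
  have [y [Uy [Vy Wy]]] := clx _ nW'.
  exists (y0^-1 * y); split=> //.
  have := VU _ _ Vy0 Vy; rewrite !gnorm; apply.
  by apply: coset_unionM => //; exact: coset_unionV.
move=> /coset_union_sub h.
by have := coset_unionM jr Uy0 h; rewrite mulVKg.
Qed.

End DiscreteTower.

Lemma continuous_pack (X Y : topologicalType) (k : X -> Y) : continuous k ->
  exists k' : continuousType X Y, k' = k :> (X -> Y).
Proof.
by move=> ck; exists (HB.pack_for (continuousType X Y) k (@isContinuous.Build X Y k ck)).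
Qed.

Section CosetAction.
Variables (N : TopologicalGroup.type) (Y : topologicalType) (D : set N) (q : N -> Y).
Local Open Scope group_scope.
Hypothesis hq : coset_projection D q.

Lemma exists_coset_action : exists act : N -> Y -> Y,
  (forall n m, act n (q m) = q (n * m)) /\
  continuous (fun p : N * Y => act p.1 p.2).
Proof.
have [cq oq sq qE] := hq; have /choice[rp rpP] := sq.
have actE n m : q (n * rp (q m)) = q (n * m).
  by apply/qE; have /qE := rpP (q m); rewrite !gnorm.
exists (fun n y => q (n * rp y)); split=> // -[n y] W /=.
have [m <-] := sq y; rewrite actE => /cq /nbhs_mulg[U nU [V nV UV]].
exists (U, q @` V); first by split => //=; exact: (projection_nbhs hq).
by move=> [n' y'] /= [Un' [v Vv <-]]; rewrite actE; exact: UV.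
Qed.

End CosetAction.

(** * The function theta and the coincidence-free deformation *)

Section Obstruction.
Variables (R : realType) (N : TopologicalGroup.type) (X Y : topologicalType)
  (D : set N) (q : N -> Y).
Local Open Scope group_scope.
Hypotheses (sD : subgroup D) (iD : D `<=` isolated D) (hq : coset_projection D q).
Hypotheses (cX : compact [set: X]) (nX : normal_space X)
  (lX : locally_path_connected R X).
Variables (f g : continuousType X Y) (x0 : X) (nf ng : N).
Hypotheses (qf : q nf = f x0) (qg : q ng = g x0)
  (pX : forall x, exists p : path_in R x0 x, True).
Variables (r : nat) (B : nat -> set N) (t : nat -> N -> R) (a : nat -> R -> N).
Hypotheses (tw : tower D r B t a) (B0 : B 0%N = [set: N]).
Local Notation P := (monodromy R q f g x0 nf ng).
Local Notation reach := (@reach R N X Y q f g x0 nf ng).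
Variable i : nat.
Hypotheses (ir : (i < r)%N) (van : twisted_vanishing D B t P i).

Let tg := tower_group_at tw (ltnW ir).
Let sB : subgroup (B i) := tower_subgroup tg.
Let nB : forall x y, B i x -> B i (x ^ y) := tower_normal tg.
Let ht : hom_on (B i) (t i) := step_hom (tower_step_at tw ir).
Let tJ : forall x y, B i x -> t i (x ^ y) = t i x := step_invariant (tower_step_at tw ir).
Let sP : subgroup P := monodromy_subgroup R sD hq qf qg.
Let PD p : P p -> D p.1 /\ D p.2 := @monodromyD R N X Y D q sD hq f g x0 nf ng qf qg p.

Let twisted u v := D v /\ exists2 p, P p & B i (p.1 * u / p.2 / v).

Let twisted_trans u v w : twisted u v -> twisted v w -> twisted u w.
Proof.
have [_ BM _] := sB; have [_ PM _] := sP.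
move=> [Dv [p Pp Bp]] [Dw [p' Pp' Bp']]; split=> //; exists (p' * p); first exact: PM.
have -> : (p' * p).1 * u / (p' * p).2 / w =
    ((p.1 * u / p.2 / v) ^ p'.1^-1) * (p'.1 * v / p'.2 / w).
  by rewrite /conjg /= !gnorm.
by apply: BM => //; exact: nB.
Qed.

Let twisted_sym u v : D u -> twisted u v -> twisted v u.
Proof.
have [_ _ BV] := sB; have [_ _ PV] := sP.
move=> Du [Dv [p Pp Bp]]; split=> //; exists p^-1; first exact: PV.
have -> : p^-1.1 * v / p^-1.2 / u = ((p.1 * u / p.2 / v)^-1) ^ p.1.
  by rewrite /conjg /= !gnorm.
by apply: nB; exact: BV.
Qed.

Let rep u := xget 1 (twisted u).

Let rep_eq u v : D u -> twisted u v -> rep u = rep v.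
Proof.
move=> Du uv; rewrite /rep; congr xget; rewrite eqEsubset; split=> w h.
  by apply: twisted_trans h; exact: twisted_sym.
exact: twisted_trans uv h.
Qed.

Let repP u : D u -> twisted u (rep u).
Proof.
move=> Du; apply: (xgetPex 1); exists u; split => //; exists 1; first by case: sP.
by have [B1 _ _] := sB; rewrite /= !gnorm.
Qed.

(** Requiring [rep u = u] fixes the coset to which [h] is compared; otherwise [t i (h / u)] would
    depend on the choice of [u]. *)
Definition difference x h u := [/\ reach x h, D u, rep u = u & B i (h / u)].

Definition coset_coincidence : set X := [set x | exists2 h, reach x h & coset_union D B i h].

Lemma difference_exists x : coset_coincidence x -> exists h u, difference x h u.
Proof.
move=> [h rh [u Du Bu]]; have [Dv [p Pp Bp]] := repP Du.
have [_ BM _] := sB.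
exists (p.1 * h / p.2), (rep u); split=> //.
- exact: (reach_act sD hq qf qg).
- by apply/esym/rep_eq => //; exact: repP.
- have -> : p.1 * h / p.2 / rep u = ((h / u) ^ p.1^-1) * (p.1 * u / p.2 / rep u).
    by rewrite /conjg !gnorm.
  by apply: BM => //; exact: nB.
Qed.

(** Both representatives agree, so the pair relating [h] and [h'] stabilizes the coset of [u], and
    the vanishing hypothesis kills its contribution. *)
Lemma difference_unique x h u h' u' : difference x h u -> difference x h' u' ->
  t i (h / u) = t i (h' / u').
Proof.
have [_ BM BV] := sB.
move=> [rh Du ru Bu] [rh' Du' ru' Bu']; have [p Pp h'E] := reach_related hq rh rh'.
have uu' : B i (p.1 * u / p.2 / u').
  have -> : p.1 * u / p.2 / u' = ((h / u)^-1) ^ p.1^-1 * (h' / u').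
    by rewrite h'E /conjg !gnorm.
  by apply: BM => //; apply: nB; exact: BV.
have uu : u = u' by rewrite -ru -ru'; apply: rep_eq => //; split => //; exists p.
subst u'.
have -> : h' / u = ((h / u) ^ p.1^-1) * (p.1 * u / p.2 / u).
  by rewrite h'E /conjg !gnorm.
rewrite (ht (nB _ Bu) uu').
have eJ : (p.1 * u / p.2 / u) ^ u = p.1 ^ u / p.2 by rewrite /conjg !gnorm.
rewrite -(tJ u uu') eJ van//; last by rewrite -eJ; exact: nB.
by rewrite addr0 tJ.
Qed.

Let theta x := xget (0 : R)%R [set s | exists h u, difference x h u /\ t i (h / u) = s].

Let thetaE x h u : difference x h u -> theta x = t i (h / u).
Proof.
move=> dx; have : [set s | exists h u, difference x h u /\ t i (h / u) = s] (theta x).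
  by apply: (@xgetPex _ 0%R); exists (t i (h / u)), h, u.
by move=> [h' [u' [dx' <-]]]; exact: difference_unique dx' dx.
Qed.

Let coset_coincidence_reach x h : coset_coincidence x -> reach x h -> coset_union D B i h.
Proof.
move=> [h' rh' Uh'] rh; have [p Pp ->] := reach_related hq rh' rh.
have [D1 D2] := PD Pp; have ir' := ltnW ir.
apply: (coset_unionM sD tw) => //; last by apply: (coset_unionV sD tw) => //; exact: (coset_union_mem tw).
by apply: (coset_unionM sD tw) => //; exact: (coset_union_mem tw).
Qed.

Lemma closed_coset_coincidence : closed coset_coincidence.
Proof.
move=> x clx; have [h rh] := reach_exists sD iD hq qf qg (pX x).
exists h => //; apply: contrapT => nU.
have [eta [ce ex re]] := reach_local sD iD hq lX rh.
have oU : open (~` coset_union D B i).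
  by apply: closed_openC; exact: (closed_coset_union sD tw B0 (ltnW ir)).
have n1 : nbhs x (eta @^-1` (~` coset_union D B i)).
  by apply: ce; rewrite ex; exact: open_nbhs_nbhs.
have [x' [Cx' [/= nU' re']]] := clx _ (@filterI _ _ (nbhs_filter x) _ _ n1 re).
by apply: nU'; exact: coset_coincidence_reach re'.
Qed.

(** The same [u] serves near [x]: the local difference [eta x'] changes [h] by an element of [B i]
    near 1, on which [t i] is small. *)
Let theta_near x (e : R) : (0 < e)%R -> coset_coincidence x ->
  \forall x' \near x, coset_coincidence x' -> (`|theta x' - theta x| < e)%R.
Proof.
move=> e0 Cx; have ir' := ltnW ir; have [h [u dx]] := difference_exists Cx.
have [rh Du ru Bu] := dx.
have [eta [ce ex re]] := reach_local sD iD hq lX rh.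
have c : (fun x' => eta x' / h) @ x --> h / h.
  by apply: cvg_mulg; [rewrite -[X in _ --> X]ex; exact: ce|exact: cvg_cst].
rewrite mulgV in c.
have n1 := c _ (near1_coset_union sD tw B0 ir').
have n2 := c _ (step_small (tower_step_at tw ir) e0).
have n12 := @filterI _ _ (nbhs_filter x) _ _ n1 n2.
have n := @filterI _ _ (nbhs_filter x) _ _ re n12.
apply: (@filterS _ (nbhs x) _ _ _ _ n) => x' [re' [/= h1 h2]] Cx'.
have Bk : B i (eta x' / h).
  apply: h1; apply: (coset_unionM sD tw) => //; first exact: coset_coincidence_reach re'.
  by apply: (coset_unionV sD tw) => //; exact: coset_coincidence_reach rh.
have dx' : difference x' (eta x') u.
  split=> //; have -> : eta x' / u = (eta x' / h) * (h / u) by rewrite !gnorm.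
  by have [_ BM _] := sB; exact: BM.
rewrite (thetaE dx) (thetaE dx').
have -> : eta x' / u = (eta x' / h) * (h / u) by rewrite !gnorm.
by rewrite ht// addrK; exact: h2.
Qed.

Let theta_bounded : exists2 M : R, (0 < M)%R &
  forall x, coset_coincidence x -> (`|theta x| <= M)%R.
Proof.
suff : exists2 M : R, (0 < M)%R &
    forall x, [set: X] x -> coset_coincidence x -> (`|theta x| <= M)%R.
  by move=> [M M0 h]; exists M => // x; exact: h.
apply: (@compact_induction _ [set: X] (fun A => exists2 M : R, (0 < M)%R &
  forall x, A x -> coset_coincidence x -> (`|theta x| <= M)%R) cX).
- by exists 1%R.
- by move=> A A' AA' [M M0 h]; exists M => // x /AA'; exact: h.
- move=> A A' [M M0 h] [M' M'0 h']; exists (M + M')%R; first by rewrite addr_gt0.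
  by move=> x [/h|/h'] {}h /h; lra.
- move=> x _; have [Cx|nCx] := pselect (coset_coincidence x).
    have h := theta_near ltr01 Cx; exists [set x' | coset_coincidence x' -> (`|theta x' - theta x| < 1)%R] => //.
    exists (`|theta x| + 1)%R => [|x' /= hx' /hx' {}hx']; first by rewrite ltr_wpDl.
    rewrite -[theta x'](subrK (theta x)); apply: le_trans (ler_normD _ _) _; lra.
  exists (~` coset_coincidence).
    apply: open_nbhs_nbhs; split => //.
    by apply: closed_openC; exact: closed_coset_coincidence.
  by exists 1%R.
Qed.

Lemma deform_coincidence_free : exists f' : continuousType X Y,
  homotopic R f f' /\ coincidence_set f' g = set0.
Proof.
have [M M0 thM] := theta_bounded.
have thc : {within coset_coincidence, continuous theta}.
  apply/subspace_continuousP => x Cx; apply/cvgrPdistC_lt => e e0.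
  have h := theta_near e0 Cx; rewrite /within; near_simpl.
  exact: h.
have [th [thE cth _]] := @continuous_bounded_extension X R nX coset_coincidence
  closed_coset_coincidence theta M M0 thc thM.
have [e e0 eP] := tower_gap tw ir.
(* Half the gap of [t i] on [D]: a positive number that is not a value there. *)
pose c : R := (e / 2)%R.
have c0 : (0 < c)%R by rewrite divr_gt0.
have cP d : D d -> B i d -> t i d <> c.
  move=> Dd Bd tc; have := eP d Dd Bd; rewrite tc gtr0_norm// => h.
  suff ce : (c < e)%R by move: c0; rewrite (h ce) ltxx.
  by rewrite /c; lra.
have [ca Ba ta a0] := step_section (tower_step_at tw ir).
have [act [actE cact]] := exists_coset_action hq.
pose H (p : X * unit_interval R) := act (a i (I_val p.2 * (c - th p.1))%R) (f p.1).
have cH : continuous H.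
  apply: (@continuous_fcomp _ _ _ (fun p : X * unit_interval R =>
    (a i (I_val p.2 * (c - th p.1))%R, f p.1)) (fun z => act z.1 z.2)) => //.
  apply: continuous_fpair.
    apply: (@continuous_fcomp _ _ _ (fun p : X * unit_interval R =>
      (I_val p.2 * (c - th p.1))%R) (a i)) => //.
    move=> p; apply: (@cvgM _ _ (nbhs p)).
      apply: (@continuous_comp _ _ _ snd I_val); first exact: cvg_snd.
      exact: continuous_I_val.
    apply: (@cvgB _ _ _ (nbhs p)); first exact: cvg_cst.
    apply: (@continuous_comp _ _ _ fst th); [exact: cvg_fst|exact: cth].
  move=> p; apply: (@continuous_comp _ _ _ fst f); [exact: cvg_fst|exact: cts_fun].
have cf' : continuous (fun x => H (x, one)).
  apply: (@continuous_fcomp _ _ _ (fun x : X => (x, one : unit_interval R)) H) => //.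
  by apply: continuous_fpair => ?; [exact: cvg_id|exact: cvg_cst].
have [_ _ sq qE] := hq.
have [f' f'E] := continuous_pack cf'; exists f'; split.
  exists H; split=> // x.
    have [m qm] := sq (f x).
    by rewrite /H /= I_val0 mul0r a0 -qm actE mul1g.
  by rewrite f'E.
rewrite -subset0 => x; rewrite /coincidence_set /= f'E /H /= I_val1 mul1r => fg.
set n := a i _ in fg; have Bn : B i n by exact: Ba.
have key h : reach x h -> exists2 w, B i w /\ t i w = (c - th x)%R & D (w * h).
  move=> /reach_coincidence[[mf mg] /= -> [qmf qmg]].
  exists (n ^ mg); first by split; [exact: nB|rewrite tJ// /n ta].
  have /qE : q mg = q (n * mf) by rewrite -actE qmf fg.
  by rewrite /conjg !gnorm.
(* The deformation moves [f] by elements of [B i] only, so a new coincidence can only occur where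
   [f] and [g] already agree modulo [B i]. *)
have Cx : coset_coincidence x.
  have [h rh] := reach_exists sD iD hq qf qg (pX x); exists h => //.
  have [w [Bw _] Dwh] := key h rh; exists (w * h) => //.
  have -> : h / (w * h) = w^-1 by rewrite !gnorm.
  by have [_ _ BV] := sB; exact: BV.
have [h [u dx]] := difference_exists Cx; have [rh Du ru Bu] := dx.
have [w [Bw tw'] Dwh] := key h rh.
have [D1 DM DV] := sD; have [_ BM _] := sB.
(* The value of [t i] here is [c - th x + theta x], and [th] extends [theta], so it equals the
   forbidden [c]. *)
apply: (cP (w * h / u)); first by apply: DM => //; exact: DV.
  by rewrite -mulgA; exact: BM.
rewrite -mulgA ht// tw' -(thetaE dx) -thE ?subrK//; exact/mem_set.
Qed.

End Obstruction.

Lemma simply_connected_path_connected1 (R : realType) (N : TopologicalGroup.type) :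
  simply_connected R N -> @path_connected1 R N [set: N].
Proof.
move=> [pN _] x _; have [p _] := pN 1%g x; exists (path_ext p); split=> //.
- exact: continuous_path_ext.
- exact: path_ext_le0.
- exact: path_ext_ge1.
Qed.

Lemma path_connected1_connected (R : realType) (N : TopologicalGroup.type) :
  @path_connected1 R N [set: N] -> connected [set: N].
Proof.
move=> pN; have /choice[p pP] : forall x : N, exists p : R -> N,
    [/\ continuous p, p 0 = 1%g & p 1 = x].
  by move=> x; have [p [cp p0 p1 _]] := pN x I; exists p.
have -> : [set: N] = \bigcup_(x in [set: N]) range (p x).
  rewrite eqEsubset; split=> // x _; exists x => //; exists 1 => //.
  by have [] := pP x.
apply: bigcup_connected => [|x _].
  by exists 1%g => x _; exists 0 => //; have [] := pP x.
apply: connected_continuous_connected.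
  by apply/connected_intervalP.
by apply: continuous_subspaceT; have [] := pP x.
Qed.

Theorem mainTheorem5 (R : realType) (X Y : topologicalType)
    (hX : finite_complex R X) (cX : connected [set: X])
    (hY : compact_nilmanifold R Y)
    (f g : continuousType X Y)
    (x0 : X) (w : path_in R (f x0) (g x0))
    (hR : reidemeister_number f g w = +oo%E) :
  exists f' : continuousType X Y,
    homotopic R f f' /\ coincidence_set f' g = set0.
Proof.
have [n [N [Gamma [nN scN iG cG hG]]]] := hY.
pose D : set N := [set` Gamma].
have sD : subgroup D.
  split=> [|x y Gx Gy|x Gx]; [exact: gpred1|exact: gpredM|by rewrite /D /= gpredV].
have [q hq] := exists_coset_projection hG.
have cY : compact [set: Y].
  have [h [k [ch ck hK kK]]] := hG.
  have -> : [set: Y] = k @` [set: coset_space Gamma].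
    by rewrite eqEsubset; split=> // y _; exists (h y).
  by apply: continuous_compact => //; exact: continuous_subspaceT.
have hN : hausdorff_space N by exact: lie_hausdorff.
have pN := simply_connected_path_connected1 scN.
have cN := path_connected1_connected pN.
have [U U1 bU] := lie_locally_compact N.
have [K bK KD] := cocompact_representatives hq U1 bU cY.
have [r [B [t [a [tw B0]]]]] :=
  exists_tower hN nN (lie_binary_curves N) sD iG bK KD U1 bU cN pN.
have [_ _ sq _] := hq; have [nf qf] := sq (f x0).
(* The base lift of [g] is the end of the lift of [w], so that the transport along [w] agrees with
   the comparison of the two lifts. *)
have [ng [Lw lw]] := path_lifting sD iG hq (f := id) w (fun z => @cvg_id _ _) qf.
have qg := lifts_end lw.
have sP := monodromy_subgroup R sD hq qf qg.
have PD := monodromyD sD hq qf qg.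
have [i ir van] : exists2 i, (i < r)%N &
    twisted_vanishing D B t (monodromy R q f g x0 nf ng) i.
  apply: (exists_twisted_vanishing nN sD tw B0 sP) => [p /PD//|s].
  (* A finite list meeting every twisted orbit would make the set of Reidemeister classes finite,
     and [counting] would not be infinite. *)
  apply: contrapT => h.
  have fin : finite_set (reidemeister_classes w).
    apply: (finite_reidemeister_classes sD iG hq scN lw (s := s)) => u Du.
    apply: contrapT => h'; apply: h; exists u => // v p vs Pp e.
    by apply: h'; exists v, p.
  by move: hR; rewrite /reidemeister_number /counting asboolT.
apply: (deform_coincidence_free sD iG hq _ _ _ qf qg _ tw B0 ir van).
- exact: finite_complex_compact hX.
- exact: finite_complex_normal hX.
- exact: finite_complex_locally_path_connected hX.
- by move=> x; exact: (finite_complex_path_connected hX x0 x cX).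
Qed.
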